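(* Let $\mathbb{F}$ be an algebraically closed field with $\mathrm{char}\,\mathbb{F}\neq 2$ and $n\ge 1$. Every odd fine grading on the associative superalgebra $M(n,n)$ is equivalent to some $\Gamma(H,t_0)$. Every grading $\Gamma(H,t_0)$ is fine, and $G_H$ is its universal group. Two gradings, $\Gamma(H,t_0)$ and $\Gamma(H',t_0')$, are equivalent if, and only if, $H=H'$ and $t_0'$ lies in the orbit of $t_0$ under the natural action of $\mathrm{Aut}(T_H,\beta_H)$.
   Context: $M(n,n)$ is the associative superalgebra $M_{2n}(\mathbb{F})=\mathrm{End}(\mathbb{F}^n\oplus\mathbb{F}^n)$ whose even (odd) part consists of the block-diagonal (block-off-diagonal) matrices. Only gradings by abelian groups are considered. A grading on a superalgebra by a group $G$ is an algebra grading whose components are $\mathbb{Z}_2$-graded subspaces. A grading $\Gamma'$ is a refinement of $\Gamma$ if every component of $\Gamma'$ is contained in a component of $\Gamma$, proper if some nonzero containment is strict; a grading is fine if it has no proper refinement. Two gradings $A=\bigoplus_{g\in G}A_g$, $B=\bigoplus_{h\in K}B_h$ with supports $S$, $S'$ are equivalent if there are an isomorphism of superalgebras $\varphi:A\to B$ and a bijection $\alpha:S\to S'$ with $\varphi(A_s)=B_{\alpha(s)}$. The universal (abelian) group of a grading with support $S$ is the abelian group generated by $S$ with defining relations $s_1s_2=s_3$ whenever $0\neq A_{s_1}A_{s_2}\subseteq A_{s_3}$. Odd gradings. A $G$-grading on $M(n,n)$ is the same as a $G\times\mathbb{Z}_2$-grading on the underlying algebra, for which $M(n,n)\cong\mathrm{End}_D(\mathcal{U})$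 with $D$ a $G\times\mathbb{Z}_2$-graded division algebra (every nonzero homogeneous element invertible) and $\mathcal{U}$ a graded right $D$-module of finite rank; the grading is odd if $\mathrm{supp}\,D$ is not contained in $G\times\{\bar 0\}$. The grading $\Gamma(H,t_0)$. For a finite abelian group $H$ of order not divisible by $\mathrm{char}\,\mathbb{F}$, let $\widehat{H}$ be its group of characters $H\to\mathbb{F}^\times$, $T_H=H\times\widehat{H}$ and $\beta_H((h_1,\chi_1),(h_2,\chi_2))=\chi_1(h_2)\chi_2(h_1)^{-1}$, a nondegenerate alternating bicharacter; $\mathrm{Aut}(T_H,\beta_H)$ is the group of automorphisms of $T_H$ preserving $\beta_H$. For each natural number $\ell\mid n$ with $\mathrm{char}\,\mathbb{F}\nmid\ell$, put $k=n/\ell$ and let $\Theta_{2\ell}$ be a set of representatives of the isomorphism classes of abelian groups of order $2\ell$. For $H\in\Theta_{2\ell}$, let $D$ be the graded division algebra with support $T_H$, one-dimensional components $\mathbb{F}X_t$, and $X_uX_v=\beta_H(u,v)X_vX_u$ (a matrix algebra of size $2\ell$), and consider the $T_H\times\mathbb{Z}^k$-grading on $M_{2n}(\mathbb{F})=M_k(\mathbb{F})\otimes D$ (Kronecker product) given by $\deg(E_{ij}\otimes d)=e_i+\deg d-e_j$, where $e_1,\dots,e_k$ is the standard basis of $\mathbb{Z}^k$. Choose $t_0\in T_H$ of order $2$ and define a homomorphism $p:T_H\times\mathbb{Z}^k\to\mathbb{Z}_2$ by $p(t,x_1,\dots,x_k)=\bar 0$ if $\beta_H(t_0,t)=1$ and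 $\bar 1$ if $\beta_H(t_0,t)=-1$. Via $p$, $M_{2n}(\mathbb{F})$ becomes a superalgebra, which is isomorphic to $M(n,n)$; $\Gamma(H,t_0)=\Gamma(H,t_0,k)$ is the $T_H\times\mathbb{Z}^k$-grading $\deg(E_{ij}\otimes d)=e_i+\deg d-e_j$ considered as a grading on this superalgebra $M(n,n)$. Here $n$ is fixed and $H$ ranges over all $\Theta_{2\ell}$ with $\ell$ a natural number such that $\ell\mid n$ and $\mathrm{char}\,\mathbb{F}\nmid\ell$. $G_H=T_H\times\mathbb{Z}^k_0$, where $\mathbb{Z}^k_0=\{x\in\mathbb{Z}^k: x_1+\dots+x_k=0\}$; this is the subgroup generated by the support of $\Gamma(H,t_0)$. *)

(* Defs.v *)
From HB Require Import structures.
From mathcomp Require Import all_boot all_algebra all_fingroup all_solvable all_field.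
From mathcomp Require Import mxtens freeg.

Set Implicit Arguments.
Unset Strict Implicit.
Unset Printing Implicit Defensive.

Import GRing.Theory.
Local Open Scope ring_scope.

(* Abelian groups are zmodTypes, written additively.  All superalgebras are
   full matrix algebras 'M[F]_m with a chosen parity decomposition
   A : 'Z_2 -> {vspace 'M[F]_m}, where A 0 is the even part. *)

Section Gradings.

Variable F : fieldType.

(* V is the direct sum of the E g; as V is finite-dimensional, finitely many
   of the E g already span it, even when G is infinite. *)
Definition direct_decomposition (V : vectType F) (G : zmodType)
    (E : G -> {vspace V}) : Prop :=
  (forall s : seq G, uniq s -> directv (\sum_(g <- s) E g)%VS) /\
  (exists s : seq G, uniq s /\ (\sum_(g <- s) E g)%VS = fullv).

Definition is_superalgebra_grading (m : nat) (A : 'Z_2 -> {vspace 'M[F]_m})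
    (G : zmodType) (E : G -> {vspace 'M[F]_m}) : Prop :=
  [/\ direct_decomposition E,
      (forall g h a b, a \in E g -> b \in E h -> a *m b \in E (g + h)) &
      (forall g, E g = (E g :&: A 0%R + E g :&: A 1%R)%VS)].

Definition refines (V : vectType F) (K G : zmodType)
    (E' : K -> {vspace V}) (E : G -> {vspace V}) : Prop :=
  forall h, exists g, (E' h <= E g)%VS.

Definition properly_refines (V : vectType F) (K G : zmodType)
    (E' : K -> {vspace V}) (E : G -> {vspace V}) : Prop :=
  refines E' E /\
  exists h g, [/\ E' h != 0%VS, (E' h <= E g)%VS & E' h != E g].

Definition is_fine (m : nat) (A : 'Z_2 -> {vspace 'M[F]_m})
    (G : zmodType) (E : G -> {vspace 'M[F]_m}) : Prop :=
  forall (K : zmodType) (E' : K -> {vspace 'M[F]_m}),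
    is_superalgebra_grading A E' -> ~ properly_refines E' E.

Definition is_superalgebra_iso (m m' : nat) (A : 'Z_2 -> {vspace 'M[F]_m})
    (B : 'Z_2 -> {vspace 'M[F]_m'}) (phi : 'Hom('M[F]_m, 'M[F]_m')) : Prop :=
  [/\ bijective phi,
      (forall a b, phi (a *m b) = phi a *m phi b) &
      (forall i, (phi @: A i)%VS = B i)].

Definition superalgebras_isomorphic (m m' : nat)
    (A : 'Z_2 -> {vspace 'M[F]_m}) (B : 'Z_2 -> {vspace 'M[F]_m'}) : Prop :=
  exists phi : 'Hom('M[F]_m, 'M[F]_m'), is_superalgebra_iso A B phi.

Definition support (V : vectType F) (G : zmodType) (E : G -> {vspace V}) :=
  {g : G | E g != 0%VS}.

Definition gradings_equivalent (m m' : nat)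
    (A : 'Z_2 -> {vspace 'M[F]_m}) (G : zmodType) (E : G -> {vspace 'M[F]_m})
    (B : 'Z_2 -> {vspace 'M[F]_m'}) (K : zmodType) (E' : K -> {vspace 'M[F]_m'})
    : Prop :=
  exists (phi : 'Hom('M[F]_m, 'M[F]_m')) (alpha : support E -> support E'),
    [/\ is_superalgebra_iso A B phi, bijective alpha &
        forall s, (phi @: E (val s))%VS = E' (val (alpha s))].

(* Universal group: the free abelian group on the support S modulo the
   subgroup generated by the relators s1 + s2 - s3. *)
Section Universal.

Variables (m : nat) (G : zmodType) (E : G -> {vspace 'M[F]_m}).

Definition support_relation (s1 s2 s3 : support E) : Prop :=
  (exists a b, [/\ a \in E (val s1), b \in E (val s2) & a *m b != 0]) /\
  (forall a b, a \in E (val s1) -> b \in E (val s2) -> a *m b \in E (val s3)).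

Inductive relator_subgroup : {freeg (support E)} -> Prop :=
| relator_gen s1 s2 s3 : support_relation s1 s2 s3 ->
    relator_subgroup
      ([freeg [:: (1, s1)]] + [freeg [:: (1, s2)]] - [freeg [:: (1, s3)]])
| relator_zero : relator_subgroup 0
| relator_sub x y :
    relator_subgroup x -> relator_subgroup y -> relator_subgroup (x - y).

Definition eval_support (x : {freeg (support E)}) : G :=
  \sum_(s <- dom x) val s *~ coeff s x.

(* The subgroup U of G, together with the inclusion of the support in U, is
   presented by the generators S and the relations s1 + s2 = s3: the canonical
   map from the free abelian group on S to G has image U and its kernel is the
   subgroup generated by the relators. *)
Definition is_universal_group (U : pred G) : Prop :=
  (forall g, U g <-> exists x, eval_support x = g) /\
  (forall x, eval_support x = 0 <-> relator_subgroup x).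

End Universal.

Definition is_graded_division_algebra (G : zmodType) (D : falgType F)
    (E : G -> {vspace D}) : Prop :=
  [/\ direct_decomposition E,
      (forall g h a b, a \in E g -> b \in E h -> a * b \in E (g + h)) &
      (forall g a, a \in E g -> a != 0 -> a \is a GRing.unit)].

Definition is_graded_right_module (G : zmodType) (D : falgType F)
    (E : G -> {vspace D}) (U : vectType F) (act : U -> D -> U)
    (W : G -> {vspace U}) : Prop :=
  [/\ (forall c u v d, act (c *: u + v) d = c *: act u d + act v d),
      (forall c u d e, act u (c *: d + e) = c *: act u d + act u e),
      ((forall u, act u 1 = u) /\
       (forall u d e, act u (d * e) = act (act u d) e)),
      direct_decomposition W &
      (forall g h u d, u \in W g -> d \in E h -> act u d \in W (g + h))].

(* phi is an isomorphism of G-graded algebras from 'M[F]_m, graded by R, onto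
   End_D(U), in which f has degree g when f (U_h) is contained in U_(g + h)
   for all h. *)
Definition is_graded_iso_End (G : zmodType) (m : nat)
    (R : G -> {vspace 'M[F]_m}) (D : falgType F) (U : vectType F)
    (act : U -> D -> U) (W : G -> {vspace U})
    (phi : 'Hom('M[F]_m, 'End(U))) : Prop :=
  [/\ injective phi,
      (forall f : 'End(U),
         (exists a, phi a = f) <-> (forall u d, f (act u d) = act (f u) d)),
      (forall a b, phi (a *m b) = (phi a \o phi b)%VF) &
      (forall g a,
         a \in R g <-> forall h u, u \in W h -> phi a u \in W (g + h))].

(* D and U may be taken finite-dimensional over F: this is forced by
   End_D(U) being isomorphic to a matrix algebra, and then U has finite rank. *)
Definition is_odd_grading (m : nat) (A : 'Z_2 -> {vspace 'M[F]_m})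
    (G : zmodType) (E : G -> {vspace 'M[F]_m}) : Prop :=
  exists (D : falgType F) (DE : (G * 'Z_2)%type -> {vspace D})
         (U : vectType F) (act : U -> D -> U)
         (W : (G * 'Z_2)%type -> {vspace U})
         (phi : 'Hom('M[F]_m, 'End(U))),
    [/\ is_graded_division_algebra DE,
        is_graded_right_module DE act W,
        is_graded_iso_End
          (fun gi : (G * 'Z_2)%type => (E gi.1 :&: A gi.2)%VS) act W phi &
        exists gi, DE gi != 0%VS /\ gi.2 != 0].

Definition Mnn (n : nat) (i : 'Z_2) : {vspace 'M[F]_(n + n)} :=
  if i == 0 then (lker (linfun (@ursubmx F n n n n)) :&:
                  lker (linfun (@dlsubmx F n n n n)))%VS
  else (lker (linfun (@ulsubmx F n n n n)) :&:
        lker (linfun (@drsubmx F n n n n)))%VS.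

Lemma linfunE (U V : vectType F) (f : U -> V) :
  linear f -> forall u, linfun f u = f u.
Proof.
move=> f_lin u.
pose f_build := GRing.isLinear.Build F U V _ f f_lin.
pose f' : {linear U -> V} := HB.pack f f_build.
exact: (lfunE f' u).
Qed.

Lemma mem_Mnn_even n (a : 'M[F]_(n + n)) :
  (a \in @Mnn n 0) = (ursubmx a == 0) && (dlsubmx a == 0).
Proof.
by rewrite memv_cap !memv_ker !linfunE // => c x y;
   apply/matrixP => i j; rewrite !mxE.
Qed.

Lemma mem_Mnn_odd n (a : 'M[F]_(n + n)) :
  (a \in @Mnn n 1) = (ulsubmx a == 0) && (drsubmx a == 0).
Proof.
by rewrite memv_cap !memv_ker !linfunE // => c x y;
   apply/matrixP => i j; rewrite !mxE.
Qed.

End Gradings.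

Section Characters.

Variables (F : closedFieldType) (H : finZmodType).

Definition is_character (chi : {ffun H -> F}) : bool :=
  (chi 0 == 1) && [forall x, forall y, chi (x + y) == chi x * chi y].

Record dual := Dual { dual_fun :> {ffun H -> F}; _ : is_character dual_fun }.

HB.instance Definition _ := [isSub for dual_fun].
HB.instance Definition _ := [Choice of dual by <:].

Lemma dual0E (chi : dual) : chi 0 = 1.
Proof. by case: chi => f /= /andP[/eqP]. Qed.

Lemma dualDE (chi : dual) x y : chi (x + y) = chi x * chi y.
Proof. by case: chi => f /= /andP[_ /forallP /(_ x) /forallP /(_ y) /eqP]. Qed.

Lemma dual_neq0 (chi : dual) x : chi x != 0.
Proof.
apply/eqP => chix0; have /eqP := dualDE chi x (- x).
by rewrite subrr dual0E chix0 mul0r oner_eq0.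
Qed.

Lemma dual_one_subproof : is_character [ffun _ => 1].
Proof.
by rewrite /is_character ffunE eqxx; apply/'forall_'forall_eqP => x y;
   rewrite !ffunE mulr1.
Qed.

Lemma dual_mul_subproof (chi psi : dual) :
  is_character [ffun x => chi x * psi x].
Proof.
rewrite /is_character ffunE !dual0E mulr1 eqxx; apply/'forall_'forall_eqP => x y.
by rewrite !ffunE !dualDE mulrACA.
Qed.

Lemma dual_inv_subproof (chi : dual) : is_character [ffun x => (chi x)^-1].
Proof.
rewrite /is_character ffunE dual0E invr1 eqxx; apply/'forall_'forall_eqP => x y.
by rewrite !ffunE dualDE invfM.
Qed.

Definition dual_one := Dual dual_one_subproof.
Definition dual_mul chi psi := Dual (dual_mul_subproof chi psi).
Definition dual_inv chi := Dual (dual_inv_subproof chi).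

Lemma dual_mulA : associative dual_mul.
Proof. by move=> a b c; apply/val_inj/ffunP=> x; rewrite !ffunE mulrA. Qed.
Lemma dual_mulC : commutative dual_mul.
Proof. by move=> a b; apply/val_inj/ffunP=> x; rewrite !ffunE mulrC. Qed.
Lemma dual_mul1 : left_id dual_one dual_mul.
Proof. by move=> a; apply/val_inj/ffunP=> x; rewrite !ffunE mul1r. Qed.
Lemma dual_mulV : left_inverse dual_one dual_inv dual_mul.
Proof.
by move=> a; apply/val_inj/ffunP=> x; rewrite !ffunE mulVf ?dual_neq0.
Qed.

HB.instance Definition _ :=
  GRing.isZmodule.Build dual dual_mulA dual_mulC dual_mul1 dual_mulV.

(* The dual is a finite type: characters take values in the roots of unity of
   exponent #|H|. *)
Definition unity_roots : seq F :=
  sval (closed_field_poly_normal ('X^#|H| - 1 : {poly F})).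

Lemma dual_unity_root (chi : dual) x : chi x \in unity_roots.
Proof.
have cX k : chi (x *+ k) = chi x ^+ k.
  by elim: k => [|k IHk]; rewrite ?dual0E // mulrS exprS dualDE IHk.
have Hx : x *+ #|H| = 0.
  by rewrite -cardsT -FinRing.zmodXgE; apply: (expg_cardG (G := [set: H]%G)); rewrite inE.
have H_gt0 : (0 < #|H|)%N by apply/card_gt0P; exists 0.
rewrite -root_prod_XsubC /unity_roots.
case: closed_field_poly_normal => s /= def_p.
have : root ('X^#|H| - 1 : {poly F}) (chi x).
  by rewrite rootE !hornerE -cX Hx dual0E subrr.
by rewrite def_p lead_coefXnsubC // scale1r.
Qed.

Definition dual_code (chi : dual) : {ffun H -> seq_sub unity_roots} :=
  [ffun x => SeqSub (dual_unity_root chi x)].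

Definition dual_decode (f : {ffun H -> seq_sub unity_roots}) : option dual :=
  insub [ffun x => val (f x)].

Lemma dual_codeK : pcancel dual_code dual_decode.
Proof.
move=> chi; rewrite /dual_decode.
have -> : [ffun x => val (dual_code chi x)] = val chi.
  by apply/ffunP=> x; rewrite !ffunE.
by rewrite valK.
Qed.

HB.instance Definition _ : isCountable dual := PCanIsCountable dual_codeK.
HB.instance Definition _ : isFinite dual := PCanIsFinite dual_codeK.

End Characters.

Notation TH F H := (H * dual F H)%type.

Section Gamma.

Variables (F : closedFieldType) (H : finZmodType).

Local Notation T := (TH F H).

Definition beta (u v : T) : F := u.2 v.1 * (v.2 u.1)^-1.

(* The graded division algebra D, realized on the space of functions on H:
   X_(h, chi) sends the indicator function of b to chi b times that of b + h. *)
Definition XH (t : T) : 'M[F]_#|H| :=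
  \matrix_(a, b) (t.2 (enum_val b) *+ (enum_val a == enum_val b + t.1)).

Lemma XH_mul (u v : T) : XH u *m XH v = u.2 v.1 *: XH (u + v).
Proof.
apply/matrixP => a b; rewrite !mxE.
rewrite (bigD1 (enum_rank (enum_val b + v.1))) //= big1 => [|c nc].
  rewrite !mxE enum_rankK eqxx addr0 mulr1n dualDE ffunE -!addrA.
  rewrite [v.1 + u.1]addrC; case: (_ == _); rewrite ?mulr0n ?mul0r ?mulr0 //.
  by rewrite !mulr1n -mulrA [LHS]mulrCA.
rewrite !mxE; case: (enum_val c =P _) nc => [<-|_ _].
  by rewrite enum_valK eqxx.
by rewrite mulr0n mulr0.
Qed.

Lemma XH_comm (u v : T) : XH u *m XH v = beta u v *: (XH v *m XH u).
Proof.
by rewrite !XH_mul scalerA /beta -mulrA mulVf ?dual_neq0 // mulr1 addrC.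
Qed.

Definition in_Aut_beta (f : {additive T -> T}) : Prop :=
  bijective f /\ forall u v, beta (f u) (f v) = beta u v.

Definition has_order2 (t : T) : Prop := t <> 0 /\ t *+ 2 = 0.

Variables (t0 : T) (k : nat).

(* The parity p(t, x), which does not depend on x. *)
Definition parity (t : T) : 'Z_2 := if beta t0 t == 1 then 0 else 1.

Definition kron_superalgebra (i : 'Z_2) : {vspace 'M[F]_(k * #|H|)} :=
  (\sum_(t : T | parity t == i) \sum_(a < k) \sum_(b < k)
     <[delta_mx a b *t XH t]>)%VS.

(* The standard basis e_1, ..., e_k of Z^k is delta_mx 0 0, ..., and
   deg (E_ab (x) X_t) = e_a + t - e_b = (t, e_a - e_b). *)
Definition Gamma (g : T * 'rV[int]_k) : {vspace 'M[F]_(k * #|H|)} :=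
  (\sum_(ab : 'I_k * 'I_k | (delta_mx 0 ab.1 - delta_mx 0 ab.2 == g.2)%R)
     <[delta_mx ab.1 ab.2 *t XH g.1]>)%VS.

Definition GH : pred (T * 'rV[int]_k) :=
  fun g => \sum_(i < k) g.2 0 i == 0.

End Gamma.

Definition groups_isomorphic (H K : finZmodType) : Prop :=
  exists f : {additive H -> K}, bijective f.

Definition is_representative_set (m : nat) (Theta : finZmodType -> Prop)
    : Prop :=
  [/\ (forall H, Theta H -> #|H| = m),
      (forall K : finZmodType, #|K| = m ->
         exists H, Theta H /\ groups_isomorphic K H) &
      (forall H H', Theta H -> Theta H' -> groups_isomorphic H H' -> H = H')].

Definition Gamma_data (F : closedFieldType) (n : nat)
    (Theta : nat -> finZmodType -> Prop) (l : nat) (H : finZmodType)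
    (t0 : TH F H) : Prop :=
  [/\ (l %| n)%N, [pchar F]^'.-nat l, Theta (2 * l)%N H & has_order2 t0].

(* Main.v *)
(* An odd grading makes M(n,n) the graded endomorphism algebra of a graded
   module U over a graded division algebra D that is not purely even.  Over an
   algebraically closed field D has one-dimensional components, so it is a
   twisted group algebra of a finite abelian group T, and simplicity of
   M(n,n) makes its commutation factor b nondegenerate.  Splitting off
   hyperbolic pairs of maximal order gives T = H x H^ with b = beta_H, and the
   remaining symmetric cocycle is a coboundary.  A homogeneous D-basis of U,
   made even with an odd element of D, then yields matrix units for which
   Gamma(H, t0) refines the given grading; t0 is the element representing the
   parity character of T.  Conversely, in a refinement of Gamma(H, t0) the
   lines E_ab (x) X_t with a <> b stay homogeneous, which forces all
   E_aa (x) X_t with t fixed to have the same degree, so Gamma(H, t0) is fine.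
   An equivalence of two such gradings permutes the degrees (t, 0), because
   these are the torsion elements, and so induces an isometry T_H -> T_H'
   matching the parities; H is recovered from |m T_H| = |m H|^2. *)
From HB Require Import structures.
Require Import Defs.
From mathcomp Require Import all_boot all_algebra all_fingroup all_solvable all_field.
From mathcomp Require Import mxtens freeg zify ring.
From Stdlib Require Import FunctionalExtensionality.

Set Implicit Arguments.
Unset Strict Implicit.
Unset Printing Implicit Defensive.

Import GRing.Theory.
Local Open Scope ring_scope.

(** * Gradings given by homogeneous bases *)

(** All gradings compared here have a homogeneous basis Z_(a,b,t) with Z_(a,b,t) Z_(c,d,u) = [b = c]
    tau(t,u) Z_(a,d,t+u), so gradings, refinements and equivalences reduce to degree functions on a
    finite index set. Rescaling the basis changes the cocycle tau by a coboundary; what remains is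
    its commutation factor. Algebraic closure enters through eigenvectors: they give the characters,
    the coboundaries and the square root that makes X_t0 an involution. Characteristic different
    from 2 separates the eigenvalues 1 and -1 of that involution. The obstacle to fineness is the
    component of degree (t, 0), of dimension k; all other nonzero components are lines. H is not
    canonical inside T_H: a Lagrangian subgroup depends on choices and an isometry may move it, so
    uniqueness of H has to come from numerical invariants of T_H. *)

Section DirectDecomposition.

Variables (F : fieldType) (V : vectType F) (G : zmodType).
Implicit Types (E : G -> {vspace V}) (s : seq G).

Lemma memv_seq_sumP E s v : uniq s -> v \in (\sum_(g <- s) E g)%VS ->
  exists f : G -> V, (forall g, f g \in E g) /\ v = \sum_(g <- s) f g.
Proof.
elim: s v => [|g s IHs] v /=.
  rewrite big_nil memv0 => _ /eqP->; exists (fun=> 0).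
  by split; [move=> g; rewrite mem0v | rewrite big_nil].
case/andP=> gs us; rewrite big_cons => /memv_addP[u Eu [w /(IHs _ us)[f [fE ->]] ->]].
exists (fun h => if h == g then u else f h); split=> [h|]; first by case: eqP => [->|].
rewrite big_cons eqxx; congr (_ + _); apply: eq_big_seq => h hs.
by case: eqP => // eh; rewrite -eh hs in gs.
Qed.

(** A sum of subspaces has dimension at most the sum of the dimensions, so the count for the longer
    list is tight only if it is tight for [s] and the intersection is zero. *)
Lemma directv_seq_cons E h s : directv (\sum_(g <- h :: s) E g)%VS =
  directv (\sum_(g <- s) E g)%VS && (E h :&: \sum_(g <- s) E g == 0)%VS.
Proof.
rewrite !directvE /= !big_cons -dimv_eq0.
have := dimv_sum_cap (E h) (\sum_(g <- s) E g)%VS.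
have le_sum r : (\dim (\sum_(g <- r) E g)%VS <= \sum_(g <- r) \dim (E g))%N.
  elim: r => [|g r IHr]; first by rewrite !big_nil dimv0.
  by rewrite !big_cons (leq_trans (dimv_add_leqif _ _)) // leq_add2l.
have := le_sum s; move: (\dim _) (\dim _) (\dim _) (\dim _) (\sum_(_ <- _) _)%N => a b d e f.
move=> ba acde; apply/eqP/andP => [af|[/eqP <- /eqP d0]]; last by move: acde; rewrite d0 addn0.
by move: acde; rewrite af; split; apply/eqP; lia.
Qed.

(** Testing directness on families defined on all of [G] avoids dependent choices indexed by the
    members of [s]. *)
Lemma independentP E :
  (forall s, uniq s -> directv (\sum_(g <- s) E g)%VS) <->
  (forall s (f : G -> V), uniq s -> (forall g, f g \in E g) ->
     \sum_(g <- s) f g = 0 -> forall g, g \in s -> f g = 0).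
Proof.
split=> [dE s f|iE].
  elim: s => [|h s IHs] //= /andP[hs us] fE.
  rewrite big_cons => sum0.
  have := dE (h :: s); rewrite /= hs us => /(_ isT).
  rewrite directv_seq_cons => /andP[_ /eqP cap0].
  have fh0 : f h = 0.
    apply/eqP; rewrite -memv0 -cap0 memv_cap fE /=.
    have -> : f h = - \sum_(g <- s) f g by apply/eqP; rewrite -addr_eq0 sum0.
    rewrite rpredN; elim: (s) => [|g r IHr]; first by rewrite !big_nil mem0v.
    by rewrite !big_cons memv_add.
  move: sum0; rewrite fh0 add0r => sum0 g; rewrite inE => /predU1P[->|] //.
  exact: IHs us fE sum0 g.
elim=> [|h s IHs] /=; first by rewrite directvE /= !big_nil dimv0.
case/andP=> hs us; rewrite directv_seq_cons IHs //=.
apply/eqP/vspaceP=> v; rewrite memv0 memv_cap; apply/idP/eqP=> [/andP[vh]|->]; last by rewrite !mem0v.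
move=> /(memv_seq_sumP us)[f [fE vf]].
pose f' g := if g == h then - v else f g.
have := iE (h :: s) f' _ _ _ h; rewrite /f' eqxx /= hs us inE eqxx.
move=> /(_ isT) oppv0; apply/eqP; rewrite -oppr_eq0; apply/eqP/oppv0 => // [g|].
  by case: eqP => // ->; rewrite rpredN.
rewrite big_cons eqxx addrC vf; apply/eqP; rewrite subr_eq0; apply/eqP.
by apply: eq_big_seq => g gs; case: eqP => // eg; rewrite -eg gs in hs.
Qed.

Definition graded_projections E (p : G -> V -> V) : Prop :=
  [/\ forall g, linear (p g), forall g v, p g v \in E g,
      forall g v, v \in E g -> p g v = v &
      forall g h v, v \in E h -> g <> h -> p g v = 0].

Lemma projections_exist E : direct_decomposition E ->
  exists (p : G -> V -> V) s, graded_projections E p /\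
    forall v, v = \sum_(g <- s) p g v.
Proof.
case=> /independentP iE [s [us sE]].
pose q g := sumv_pi_for (erefl (\sum_(g <- s) E g)%VS) g.
have qE g v : q g v \in E g by exact: memv_sum_pi.
have sq v : \sum_(g <- s) q g v = v.
  apply: (sumv_pi_uniq_sum (erefl _)); first by rewrite filter_predT.
  by rewrite sE memvf.
(* A nonzero component outside [s] would contradict independence of [h :: s], since the parts of [v]
   over [s] already add up to [v]. *)
have Eout h v : v \in E h -> h \notin s -> v = 0.
  move=> vh hs; pose f g := if g == h then - v else q g v.
  have := iE (h :: s) f _ _ _ h; rewrite /f eqxx /= hs us inE eqxx.
  move=> /(_ isT) v0; apply/eqP; rewrite -oppr_eq0; apply/eqP/v0 => // [g|].
    by case: eqP => // ->; rewrite rpredN.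
  rewrite big_cons eqxx addrC -[X in _ - X]sq; apply/eqP; rewrite subr_eq0; apply/eqP.
  by apply: eq_big_seq => g gs; case: eqP => // eg; rewrite -eg gs in hs.
have qid h v g : v \in E h -> g \in s -> q g v = if g == h then v else 0.
  move=> vh gs; have [hs|/(Eout h v vh)->] := boolP (h \in s); last by rewrite linear0 if_same.
  pose f g := q g v - (if g == h then v else 0).
  apply: subr0_eq; apply: (iE s f us _ _ g gs) => [g'|].
    by rewrite rpredB //; case: eqP => [->|_]; rewrite ?mem0v.
  rewrite sumrB sq (bigD1_seq h) //= eqxx big1 ?addr0 ?subrr // => g' /negPf->.
  by [].
(* Outside the finite list [s] the projection is zero by convention, which [Eout] justifies. *)
exists (fun g v => if g \in s then q g v else 0), s; split; last first.
  by move=> v; rewrite -[LHS]sq; apply: eq_big_seq => g ->.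
split=> [g a u v|g v|g v vg|g h v vh gh].
- by case: ifP => _; [rewrite linearP | rewrite scaler0 addr0].
- by case: ifP; rewrite ?mem0v.
- by case: ifPn => [gs|/(Eout g v vg)->] //; rewrite (qid g) // eqxx.
- by case: ifP => // gs; rewrite (qid h) //; case: eqP.
Qed.

Lemma homog_inj E g h v : direct_decomposition E ->
  v \in E g -> v \in E h -> v != 0 -> g = h.
Proof.
move=> /projections_exist[p [s [[_ _ p1 p0] _]]] vg vh v0.
by apply/eqP/contraT => /eqP gh; rewrite -(p1 g v vg) (p0 _ _ _ vh gh) eqxx in v0.
Qed.

End DirectDecomposition.

Section DualBases.

Variables (F : fieldType) (V : vectType F) (I : finType).
Implicit Types (Z : I -> V) (c : I -> V -> F).

(** The coordinate forms are kept as plain functions over an arbitrary finite type, so that triples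
    (a, b, t) can index a basis directly. *)
Definition dual_bases Z c : Prop :=
  [/\ forall i, scalar (c i), forall i j, c i (Z j) = (i == j)%:R &
      forall v, v = \sum_i c i v *: Z i].

Lemma scalar_form0 (f : V -> F) : scalar f -> f 0 = 0.
Proof. by move=> fL; have := fL 1 0 0; rewrite scaler0 add0r mul1r -[LHS]addr0 => /addrI/esym. Qed.

Lemma scalar_form_sum (f : V -> F) (J : Type) (r : seq J) (P : pred J) (a : J -> F) (v : J -> V) :
  scalar f -> f (\sum_(j <- r | P j) a j *: v j) = \sum_(j <- r | P j) a j * f (v j).
Proof.
move=> fL; elim/big_rec2: _ => [|j x y _ <-]; first exact: scalar_form0.
by rewrite fL.
Qed.

Lemma scalar_form_sum1 (f : V -> F) (J : Type) (r : seq J) (P : pred J) (v : J -> V) :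
  scalar f -> f (\sum_(j <- r | P j) v j) = \sum_(j <- r | P j) f (v j).
Proof.
move=> fL; have := scalar_form_sum r P (fun=> 1) v fL.
rewrite (eq_bigr v) => [->|j _]; last by rewrite scale1r.
by apply: eq_bigr => j _; rewrite mul1r.
Qed.

Lemma scalar_formZ (f : V -> F) a v : scalar f -> f (a *: v) = a * f v.
Proof. by move=> fL; rewrite -[a *: v]addr0 fL scalar_form0 // addr0. Qed.

Lemma coord_sum Z c (a : I -> F) i : dual_bases Z c -> c i (\sum_j a j *: Z j) = a i.
Proof.
case=> cL cZ _; rewrite scalar_form_sum // (bigD1 i) //= cZ eqxx mulr1 big1 ?addr0 // => j ji.
by rewrite cZ eq_sym (negPf ji) mulr0.
Qed.

Lemma coord_eq Z c u v : dual_bases Z c -> (forall i, c i u = c i v) -> u = v.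
Proof.
by case=> _ _ cE uv; rewrite (cE u) (cE v); apply: eq_bigr => i _; rewrite uv.
Qed.

Lemma coord_eq0 Z c v : dual_bases Z c -> (forall i, c i v = 0) -> v = 0.
Proof.
by move=> dZ v0; apply: (coord_eq dZ) => i; case: dZ => cL _ _; rewrite v0 scalar_form0.
Qed.

Lemma basis_neq0 Z c i : dual_bases Z c -> Z i != 0.
Proof.
case=> cL cZ _; apply/eqP => Z0; have /eqP := cZ i i.
by rewrite Z0 scalar_form0 // eqxx eq_sym oner_eq0.
Qed.

Lemma dual_bases_exist Z :
  (forall a : I -> F, \sum_i a i *: Z i = 0 -> forall i, a i = 0) ->
  (forall v, exists a : I -> F, v = \sum_i a i *: Z i) ->
  exists c, dual_bases Z c.
Proof.
move=> fZ sZ; pose X := [tuple Z (enum_val i) | i < #|I|].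
have XE i : X`_(enum_rank i) = Z i by rewrite -tnth_nth tnth_mktuple enum_rankK.
have sumX (a : I -> F) : \sum_(i < #|I|) a (enum_val i) *: X`_i = \sum_i a i *: Z i.
  by rewrite (reindex_omap (@enum_rank I) (fun i => Some (enum_val i))) /= => [|i _];
     rewrite ?enum_valK //; apply: eq_big => i; rewrite enum_rankK ?eqxx // XE.
have frX : free X.
  apply/freeP => k k0 i.
  rewrite -(enum_valK i); apply: (fZ (fun j => k (enum_rank j))).
  by rewrite -sumX -[RHS]k0; apply: eq_bigr => j _; rewrite enum_valK.
exists (fun i v => coord X (enum_rank i) v); split=> [i a u v|i j|v].
- by rewrite linearP.
- by rewrite -XE coord_free // (inj_eq enum_rank_inj) eq_sym.
- rewrite -sumX; under eq_bigr do rewrite enum_valK.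
  apply: coord_span; have [a ->] := sZ v; rewrite -sumX.
  by apply: memv_suml => i _; rewrite memvZ ?memv_span ?mem_nth ?size_tuple.
Qed.

(** Forms biorthogonal to [Z] show that [Z] is free, and a free family of the right cardinality is a
    basis. *)
Lemma dual_bases_of_card Z c :
  (forall i, scalar (c i)) -> (forall i j, c i (Z j) = (i == j)%:R) ->
  #|I| = \dim {:V} -> dual_bases Z c.
Proof.
move=> cL cZ cardI; split=> // v.
pose X := [tuple Z (enum_val i) | i < #|I|].
have XE (i : 'I_#|I|) : X`_i = Z (enum_val i) by rewrite -tnth_nth tnth_mktuple.
have frX : free X.
  apply/freeP => k k0 i; have := congr1 (c (enum_val i)) k0.
  rewrite scalar_form_sum // scalar_form0 // (bigD1 i) //= XE cZ eqxx mulr1 big1 ?addr0 // => j ji.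
  by rewrite XE cZ (inj_eq enum_val_inj) eq_sym (negPf ji) mulr0.
have bX : basis_of fullv X by rewrite basisEfree frX subvf size_tuple cardI leqnn.
have := coord_basis bX (memvf v) => {1}->.
have vE : v = \sum_i coord X (enum_rank i) v *: Z i.
  rewrite {1}(coord_basis bX (memvf v)).
  rewrite (reindex_omap (@enum_rank I) (fun i => Some (enum_val i))) /= => [|i _];
     rewrite ?enum_valK //; apply: eq_big => i; rewrite enum_rankK ?eqxx // XE.
  by rewrite enum_rankK.
rewrite -(coord_basis bX (memvf v)) {1}vE; apply: eq_bigr => i _; congr (_ *: _).
rewrite [in RHS]vE scalar_form_sum // (bigD1 i) //= cZ eqxx mulr1 big1 ?addr0 // => j ji.
by rewrite cZ eq_sym (negPf ji) mulr0.
Qed.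

Lemma dual_bases_card Z c : dual_bases Z c -> #|I| = \dim {:V}.
Proof.
move=> dZ; pose X := [tuple Z (enum_val i) | i < #|I|].
have XE (i : 'I_#|I|) : X`_i = Z (enum_val i) by rewrite -tnth_nth tnth_mktuple.
have frX : free X.
  case: (dZ) => cL cZ _; apply/freeP => k k0 i; have := congr1 (c (enum_val i)) k0.
  rewrite scalar_form_sum // scalar_form0 // (bigD1 i) //= XE cZ eqxx mulr1 big1 ?addr0 // => j ji.
  by rewrite XE cZ (inj_eq enum_val_inj) eq_sym (negPf ji) mulr0.
have spX : <<X>>%VS = fullv.
  apply/eqP; rewrite eqEsubv subvf //; apply/subvP => v _.
  case: dZ => _ _ cE; rewrite (cE v); apply: memv_suml => i _; rewrite memvZ // memv_span //.
  by rewrite -[i]enum_rankK -XE mem_nth // size_tuple.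
by rewrite -spX (eqP frX) size_tuple.
Qed.

Section Degrees.

Variable G : zmodType.
Implicit Types (deg : I -> G) (E : G -> {vspace V}).

Definition span_deg deg Z (g : G) : {vspace V} :=
  (\sum_(i | deg i == g) <[Z i]>)%VS.

Lemma memv_span_deg deg Z i : Z i \in span_deg deg Z (deg i).
Proof. by apply: (subvP (sumv_sup i _ (subvv _))) => //; rewrite memv_line. Qed.

Lemma span_degP deg Z c g v : dual_bases Z c ->
  reflect (forall i, c i v != 0 -> deg i = g) (v \in span_deg deg Z g).
Proof.
move=> dZ; apply: (iffP idP) => [|vg].
  case/memv_sumP => w wE -> i; case: dZ => cL cZ _.
  rewrite scalar_form_sum1 // => /negP ci; apply/eqP/contraT => ig; case: ci.
  rewrite big1 // => j jg; have /vlineP[a ->] := wE j jg.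
  rewrite scalar_formZ // cZ; case: eqP => [ij|_]; last by rewrite mulr0.
  by rewrite ij jg in ig.
case: dZ => _ _ cE; rewrite (cE v); apply: memv_suml => i _.
have [->|/vg <-] := eqVneq (c i v) 0; first by rewrite scale0r mem0v.
by rewrite memvZ // memv_span_deg.
Qed.

Lemma span_deg_direct deg Z c : dual_bases Z c -> direct_decomposition (span_deg deg Z).
Proof.
move=> dZ; case: (dZ) => cL cZ cE; split.
  apply/independentP => s f us fE sum0 g gs; apply: (coord_eq0 dZ) => i.
  apply/eqP/contraT => ci; have dig := span_degP deg g (f g) dZ (fE g) i ci.
  have := congr1 (c i) sum0; rewrite scalar_form_sum1 // scalar_form0 // (bigD1_seq g) //= big1 ?addr0 => [|h hg].
    by move/eqP; rewrite (negPf ci).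
  apply/eqP/contraT => /(span_degP deg h (f h) dZ (fE h)) dih.
  by rewrite -dih dig eqxx in hg.
exists (undup [seq deg i | i <- enum I]); split; first exact: undup_uniq.
apply/eqP; rewrite eqEsubv subvf //; apply/subvP => v _.
rewrite (cE v); apply: memv_suml => i _; rewrite memvZ //.
have di : deg i \in undup [seq deg i | i <- enum I] by rewrite mem_undup map_f ?mem_enum.
by rewrite (big_rem _ di) /= (subvP (addvSl _ _)) // memv_span_deg.
Qed.

(** The projection onto [E g] keeps exactly the terms of degree [g] in the expansion along [Z], so a
    grading is determined by the degrees of a homogeneous basis. *)
Lemma homogeneous_basis deg Z c E : dual_bases Z c -> direct_decomposition E ->
  (forall i, Z i \in E (deg i)) -> E =1 span_deg deg Z.
Proof.
move=> dZ /projections_exist[p [s [[pL pE p1 p0] ps]]] ZE g; apply/vspaceP=> v.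
apply/idP/idP => [vg|/memv_sumP[w wE ->]]; last first.
  apply: memv_suml => i ig; have /vlineP[a ->] := wE i ig.
  by rewrite -(eqP ig) memvZ.
have sp (r : seq I) (a : I -> F) : p g (\sum_(i <- r) a i *: Z i) = \sum_(i <- r) a i *: p g (Z i).
  elim: r => [|i r IHr]; last by rewrite !big_cons pL IHr.
  rewrite !big_nil; have := pL g 1 0 0; rewrite scaler0 add0r scale1r.
  by rewrite -[LHS]addr0 => /addrI/esym.
rewrite -(p1 g v vg); case: dZ => _ _ cE; rewrite (cE v) sp; apply: memv_suml => i _.
rewrite memvZ //; have [<-|dg] := eqVneq (deg i) g; first by rewrite p1 // memv_span_deg.
by rewrite (p0 _ _ _ (ZE i)) ?mem0v // => dg'; rewrite dg' eqxx in dg.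
Qed.

Lemma span_deg_neq0P deg Z c g : dual_bases Z c ->
  reflect (exists i, deg i = g) (span_deg deg Z g != 0%VS).
Proof.
move=> dZ; apply: (iffP idP) => [nz|[i <-]].
  have vg := memv_pick (span_deg deg Z g); rewrite -vpick0 in nz.
  have [i ci] : exists i, c i (vpick (span_deg deg Z g)) != 0.
    apply/existsP/contraT; rewrite negb_exists => /forallP c0; case/eqP: nz.
    by apply: (coord_eq0 dZ) => i; have := c0 i; rewrite negbK => /eqP.
  by exists i; apply: (span_degP deg g _ dZ vg).
apply/eqP => E0; have := memv_span_deg deg Z i.
by rewrite E0 memv0 (negPf (basis_neq0 i dZ)).
Qed.

End Degrees.

End DualBases.

(** * Characters and symmetric cocycles *)

Lemma finzmod_mulrn_card (T : finZmodType) (t : T) : t *+ #|T| = 0.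
Proof.
by rewrite -cardsT -FinRing.zmodXgE; apply: (expg_cardG (G := [set: T]%G)); rewrite inE.
Qed.

Lemma eigenvector_in (F : closedFieldType) n (A V : 'M[F]_n) : V != 0 ->
  stablemx V A -> exists a, (V :&: eigenspace A a)%MS != 0.
Proof.
(* [B] is the matrix of [A] on the row space of [V] in the basis [R]; algebraic closure gives it an
   eigenvalue. *)
move=> V0 sVA; pose R := row_base V; pose B := R *m A *m pinvmx R.
have BR : B *m R = R *m A by rewrite mulmxKpV // (eqmxMr _ (eq_row_base _)) eq_row_base.
have rV : (0 < \rank V)%N by rewrite lt0n mxrank_eq0.
have /closed_rootP[a] : size (char_poly B) != 1%N by rewrite size_char_poly; case: (\rank V) rV.
rewrite -eigenvalue_root_char => /eigenvalueP[w wB w0]; exists a.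
have : w *m R != 0 by rewrite mulmx_free_eq0 ?row_base_free.
apply: contraNneq => cap0; rewrite -submx0 -cap0 sub_capmx.
rewrite -(eq_row_base V) submxMl /=.
by apply/eigenspaceP; rewrite -mulmxA -BR mulmxA wB scalemxAl.
Qed.

(** Commuting matrices preserve each other's eigenspaces, so [V] may be shrunk to an eigenspace of
    one matrix before the next is treated. *)
Lemma common_eigenvector (F : closedFieldType) n (As : seq 'M[F]_n) (V : 'M[F]_n) :
  V != 0 -> (forall A, A \in As -> stablemx V A) ->
  {in As &, forall A B, comm_mx A B} ->
  exists v : 'rV_n, [/\ v != 0, (v <= V)%MS &
    forall A, A \in As -> exists a, v *m A = a *: v].
Proof.
elim: As V => [|A As IHs] V V0 sV cAs.
  have /rowV0Pn[v vV v0] := V0; by exists v.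
have [a Wa0] := eigenvector_in V0 (sV A (mem_head _ _)).
have [||v [v0]] := IHs _ Wa0.
- move=> B BAs; rewrite sub_capmx.
  rewrite (submx_trans (submxMr _ (capmxSl _ _))) ?sV ?inE ?BAs ?orbT //=.
  rewrite (submx_trans (submxMr _ (capmxSr _ _))) //.
  by apply: comm_mx_stable_eigenspace; apply: cAs; rewrite inE ?eqxx ?BAs ?orbT.
- by move=> B C BAs CAs; apply: cAs; rewrite inE ?BAs ?CAs orbT.
rewrite sub_capmx => /andP[vV /eigenspaceP vA] vAs; exists v; split=> // B.
by rewrite inE => /predU1P[->|/vAs //]; exists a.
Qed.

Section TwistedTranslations.

Variables (F : closedFieldType) (T : finZmodType) (tau : T -> T -> F).
Hypothesis tau_cocycle : forall u v w, tau u v * tau (u + v) w = tau v w * tau u (v + w).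

(** Left multiplication by X_u on the twisted group algebra of [tau], sending e_i to tau(u,i)
    e_(u+i). Row vectors are acted on from the right, hence the reversed order in products. *)
Definition twisted_translation u : 'M[F]_#|T| :=
  \matrix_(i, j) (tau u (enum_val i) *+ (enum_val j == u + enum_val i)).

Lemma twisted_translationM u v :
  twisted_translation v *m twisted_translation u = tau u v *: twisted_translation (u + v).
Proof.
apply/matrixP => i j; rewrite !mxE (bigD1 (enum_rank (v + enum_val i))) //= big1 ?addr0.
  rewrite !mxE enum_rankK eqxx mulr1n addrA; case: eqP => _; last by rewrite !mulr0.
  by rewrite !mulr1n tau_cocycle.
move=> l nl; rewrite !mxE; case: eqP => [lv|_]; last by rewrite mul0r.
by case/eqP: nl; rewrite -lv enum_valK.
Qed.

Hypothesis tau_sym : forall u v, tau u v = tau v u.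

(** Symmetry of [tau] makes the translations commute. The invariant subspace [V] is left free
    because separating points by characters requires an eigenvector inside a prescribed image. *)
Lemma twisted_translation_eigenvector (V : 'M[F]_#|T|) : V != 0 ->
  (forall u, stablemx V (twisted_translation u)) ->
  exists (x : 'rV[F]_#|T|) (c : T -> F), [/\ x != 0, (x <= V)%MS,
    forall u, x *m twisted_translation u = c u *: x &
    forall u v, c u * c v = tau u v * c (u + v)].
Proof.
move=> V0 sV; have [||x [x0 xV xL]] := @common_eigenvector _ _ [seq twisted_translation u | u : T] V V0.
- by move=> A /mapP[u _ ->].
- move=> A B /mapP[u _ ->] /mapP[v _ ->]; rewrite /comm_mx.
  by rewrite !twisted_translationM tau_sym addrC.
have xL' u : {a | x *m twisted_translation u = a *: x}.
  have : exists a, x *m twisted_translation u == a *: x.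
    by have [|a ->] := xL (twisted_translation u); [apply/mapP; exists u; rewrite ?mem_enum | exists a].
  by move=> /sigW[a /eqP]; exists a.
exists x, (fun u => sval (xL' u)); split=> // [u|u v]; first exact: (svalP (xL' u)).
case: (xL' u) (xL' v) (xL' (u + v)) => [a ua] [b vb] [c uvc] /=.
have := congr1 (mulmx x) (twisted_translationM u v).
rewrite mulmxA vb -scalemxAl ua -scalemxAr uvc !scalerA mulrC => /eqP.
rewrite -subr_eq0 -scalerBl scaler_eq0 (negPf x0) orbF subr_eq0 => /eqP //.
Qed.

Hypothesis tau_neq0 : forall u v, tau u v != 0.

(* A common eigenvector of the twisted translations exhibits tau as a
   coboundary. *)
Lemma symmetric_cocycle_coboundary :
  exists c : T -> F, (forall u, c u != 0) /\ forall u v, c u * c v = tau u v * c (u + v).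
Proof.
have [||x [c [x0 _ xc cM]]] := @twisted_translation_eigenvector 1%:M.
- rewrite -mxrank_eq0 mxrank1 -lt0n; apply/card_gt0P; by exists 0.
- by move=> u; rewrite submx1.
exists c; split=> // u.
(* Since [tau 0 w] does not depend on [w], the translation by 0 is a nonzero scalar. This gives c(0)
   <> 0, and then c(u) c(-u) = tau(u,-u) c(0) rules out c(u) = 0. *)
have tau0 w : tau 0 w = tau 0 0.
  have := tau_cocycle 0 0 w; rewrite !add0r => /(mulIf (tau_neq0 _ _)) //.
have L0 : twisted_translation 0 = (tau 0 0)%:M.
  apply/matrixP=> i j; rewrite !mxE add0r tau0 (inj_eq enum_val_inj) eq_sym //.
have : c 0 != 0.
  apply: contra (tau_neq0 0 0) => /eqP c0; have := xc 0; rewrite c0 L0 mul_mx_scalar scale0r.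
  by move/eqP; rewrite scaler_eq0 (negPf x0) orbF.
apply: contraNneq => u0; move: (cM u (- u)); rewrite u0 mul0r subrr => /esym/eqP.
by rewrite mulf_eq0 (negPf (tau_neq0 _ _)).
Qed.

End TwistedTranslations.

Section Characters.

Variables (F : closedFieldType).

(** Shifting the summation variable by [y] multiplies the sum by [f y]. *)
Lemma sum_char0 (B : finZmodType) (K : {set B}) (f : B -> F) y :
  (forall x z, x \in K -> z \in K -> x - z \in K) ->
  (forall x z, x \in K -> z \in K -> f (x + z) = f x * f z) ->
  y \in K -> f y != 1 -> \sum_(x in K) f x = 0.
Proof.
move=> KB fD yK fy1; have K0 : 0 \in K by rewrite -(subrr y) KB.
have KD x : (x + y \in K) = (x \in K).
  apply/idP/idP => [/KB /(_ yK)|xK]; first by rewrite addrK.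
  by rewrite -[y]opprK KB // -sub0r KB.
have : f y * \sum_(x in K) f x = \sum_(x in K) f x.
  rewrite [RHS](reindex_inj (addIr y)) /= mulr_sumr.
  by apply: eq_big => [x|x xK]; rewrite ?KD // fD // mulrC.
move/eqP; rewrite -subr_eq0 -{2}[\sum_(_ in _) _]mul1r -mulrBl mulf_eq0 subr_eq0 (negPf fy1).
by move/eqP.
Qed.

Lemma sum_char0T (B : finZmodType) (f : B -> F) y :
  (forall x z, f (x + z) = f x * f z) -> f y != 1 -> \sum_x f x = 0.
Proof.
move=> fD fy1; transitivity (\sum_(x in [set: B]) f x).
  by apply: eq_bigl => x; rewrite inE.
by apply: sum_char0 fy1 => // x z; rewrite !inE.
Qed.

(** By orthogonality, the matrix of character values times the matrix of inverse values is |K| times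
    the identity, so its rank is #|I|. *)
Lemma card_chars_le (B : finZmodType) (K : {set B}) (I : finType) (ch : I -> B -> F) :
  (forall x z, x \in K -> z \in K -> x - z \in K) -> #|K|%:R != 0 :> F ->
  (forall i x z, x \in K -> z \in K -> ch i (x + z) = ch i x * ch i z) ->
  (forall i x, x \in K -> ch i x != 0) ->
  (forall i j, (forall x, x \in K -> ch i x = ch j x) -> i = j) ->
  (#|I| <= #|K|)%N.
Proof.
move=> KB K0 chD chN chI.
pose M : 'M[F]_(#|I|, #|K|) := \matrix_(i, x) ch (enum_val i) (enum_val x).
pose N : 'M[F]_(#|K|, #|I|) := \matrix_(x, i) (ch (enum_val i) (enum_val x))^-1.
have MN : M *m N = (#|K|%:R)%:M.
  apply/matrixP=> i j; rewrite !mxE.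
  transitivity (\sum_(x in K) ch (enum_val i) x * (ch (enum_val j) x)^-1).
    by rewrite [RHS]big_enum_val /=; apply: eq_bigr => x _; rewrite !mxE.
  have [->|ij] := eqVneq i j.
    rewrite mulr1n -sumr_const; apply: eq_bigr => x xK; by rewrite divff ?chN.
  rewrite mulr0n.
  have [x xK xij] : exists2 x, x \in K & ch (enum_val i) x != ch (enum_val j) x.
    apply/exists_inP/contraT; rewrite negb_exists_in => /forall_inP e.
    case/eqP: ij; apply/enum_val_inj/chI => x /e; by rewrite negbK => /eqP.
  apply: (@sum_char0 _ K (fun x => ch (enum_val i) x * (ch (enum_val j) x)^-1) x) => //.
    by move=> y z yK zK; rewrite !chD // invfM mulrACA.
  by apply: contra xij => /eqP e; apply/eqP; rewrite -[LHS](divfK (chN (enum_val j) x xK)) e mul1r.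
have : \rank (M *m N) = #|I|.
  rewrite MN -scalemx1 mxrank_scale_nz // mxrank1 //.
by move=> <-; rewrite (leq_trans (mxrankM_maxl _ _)) // rank_leq_col.
Qed.

Variables (H : finZmodType).
Hypothesis H_neq0 : #|H|%:R != 0 :> F.

Lemma dual_addE (chi psi : dual F H) x : (chi + psi) x = chi x * psi x.
Proof. by rewrite ffunE. Qed.

Lemma dual_oppE (chi : dual F H) x : (- chi) x = (chi x)^-1.
Proof. by rewrite ffunE. Qed.

Lemma dual_zeroE x : (0 : dual F H) x = 1.
Proof. by rewrite ffunE. Qed.

Lemma dual_eqP (chi psi : dual F H) : chi =1 psi -> chi = psi.
Proof. by move=> e; apply/val_inj/ffunP. Qed.

Lemma dual_exists (f : H -> F) : (forall x, f x != 0) -> (forall x y, f (x + y) = f x * f y) ->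
  exists chi : dual F H, chi =1 f.
Proof.
move=> f0 fD; have f1 : f 0 = 1.
  by apply: (mulfI (f0 0)); rewrite -fD addr0 mulr1.
have cf : is_character [ffun x => f x].
  rewrite /is_character ffunE f1 eqxx; apply/'forall_'forall_eqP => x y.
  by rewrite !ffunE fD.
by exists (Dual cf) => x; rewrite ffunE.
Qed.

(** With untwisted translations, take an eigenvector x = y (L h - 1) in the image of L h - 1. If its
    character were trivial at h, then y L(m h) = y + m x for all m, and m = #|H| would give #|H| x =
    0. *)
Lemma dual_separates (h : H) : h != 0 -> exists chi : dual F H, chi h != 1.
Proof.
move=> h0; pose tau (u v : H) : F := 1; pose L := twisted_translation tau.
have tauC u v w : tau u v * tau (u + v) w = tau v w * tau u (v + w) by [].
have LM u v : L v *m L u = L (u + v) by rewrite /L twisted_translationM // scale1r.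
have L0 : L 0 = 1%:M.
  by apply/matrixP=> i j; rewrite !mxE add0r (inj_eq enum_val_inj) eq_sym.
pose V := L h - 1%:M.
have [||x [c [x0 xV xc cM]]] := twisted_translation_eigenvector tauC (fun _ _ => erefl) (V := V).
- apply: contra h0; rewrite subr_eq0 => /eqP Lh.
  have := congr1 (fun M : 'M_#|H| => M (enum_rank 0) (enum_rank h)) Lh.
  rewrite !mxE !enum_rankK addr0 eqxx (inj_eq enum_rank_inj) eq_sym.
  by case: eqP => [->|_ /eqP]; rewrite ?oner_eq0.
- move=> u.
  have -> : V *m twisted_translation tau u = L u *m V.
    by rewrite -/(L u) /V mulmxBl mulmxBr mul1mx mulmx1 !LM [h + u]addrC.
  exact: submxMl.
have c0 u : c u != 0.
  have : c 0 * c 0 != 0.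
    rewrite mulf_eq0 orbb; apply: contra x0 => /eqP c0; have := xc 0.
    by rewrite c0 -/(L 0) L0 mulmx1 scale0r => ->.
  by rewrite cM mul1r addr0; apply: contraNneq => u0; have := cM u (- u);
     rewrite u0 mul0r mul1r subrr => <-.
have [chi chiE] := dual_exists c0 (fun u v => esym (etrans (cM u v) (mul1r _))).
exists chi; rewrite chiE; apply: contra x0 => /eqP ch1.
have /submxP[y xy] := xV.
have yL m : y *m L (h *+ m) = y + x *+ m.
  elim: m => [|m IHm]; first by rewrite L0 mulmx1 addr0.
  rewrite mulrS -LM mulmxA IHm mulmxDl -[x *+ m]scaler_nat -scalemxAl -/L (xc h) ch1 scale1r.
  have -> : y *m L h = y + x by rewrite xy mulmxBr mulmx1 addrCA subrr addr0.
  by rewrite scaler_nat mulrS addrA.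
have := yL #|H|; rewrite finzmod_mulrn_card L0 mulmx1 -[LHS]addr0 => /addrI/esym/eqP.
by rewrite -scaler_nat scaler_eq0 (negPf H_neq0).
Qed.

Lemma sum_dual (h : H) : \sum_(chi : dual F H) chi h = (#|{: dual F H}| * (h == 0))%:R.
Proof.
have [->|h0] := eqVneq h 0.
  rewrite (eq_bigr (fun=> 1)) => [|chi _]; first by rewrite sumr_const muln1.
  exact: dual0E.
have [psi psih] := dual_separates h0; rewrite muln0 mulr0n.
exact: (@sum_char0T _ (fun chi : dual F H => chi h) psi (fun _ _ => dual_addE _ _ _)).
Qed.

Lemma sum_dual_fun (chi : dual F H) : \sum_h chi h = (#|H| * (chi == 0))%:R.
Proof.
have [->|h0] := eqVneq chi 0.
  rewrite (eq_bigr (fun=> 1)) => [|h _]; first by rewrite sumr_const muln1.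
  exact: dual_zeroE.
have [h chih] : exists h, chi h != 1.
  apply/existsP/contraT; rewrite negb_exists => /forallP e; case/eqP: h0.
  by apply: dual_eqP => h; rewrite dual_zeroE; have := e h; rewrite negbK => /eqP.
rewrite muln0 mulr0n.
exact: sum_char0T (dualDE chi) chih.
Qed.

(** Summing chi(h) over both arguments compares the two cardinalities only in F. That suffices to
    make the order of the dual invertible, and [card_chars_le] then bounds each group by the
    other. *)
Lemma card_dual : #|{: dual F H}| = #|H|.
Proof.
have eF : #|{: dual F H}|%:R = #|H|%:R :> F.
  transitivity (\sum_(h : H) \sum_(chi : dual F H) chi h).
    rewrite (bigD1 0) //= sum_dual eqxx muln1 big1 ?addr0 // => h /negPf h0.
    by rewrite sum_dual h0 muln0.
  rewrite exchange_big (bigD1 (0 : dual F H)) // sum_dual_fun eqxx muln1 big1 ?/= ?addr0 // => h /negPf h0.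
  by rewrite sum_dual_fun h0 muln0.
apply/eqP; rewrite eqn_leq; apply/andP; split.
  rewrite -[X in (_ <= X)%N]cardsT.
  apply: (@card_chars_le _ setT (dual F H) (fun chi h => chi h)) => [x z||chi x z _ _|chi x _|chi psi e].
  - by rewrite !inE.
  - by rewrite cardsT.
  - exact: dualDE.
  - exact: dual_neq0.
  - by apply: dual_eqP => x; apply: e; rewrite inE.
have := @card_chars_le (dual F H) setT H (fun h chi => chi h).
rewrite cardsT eF; apply=> // [x z|h x z _ _|chi x _|h h' e].
- by rewrite !inE.
- exact: dual_addE.
- exact: dual_neq0.
- apply/eqP/contraT; rewrite -subr_eq0 => /dual_separates[chi] /eqP[].
  have := dualDE chi (h - h') h'; rewrite subrK (e chi) ?inE // => e'.
  by apply: (mulIf (dual_neq0 chi h')); rewrite -e' mul1r.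
Qed.

End Characters.

(** * The gradings Gamma(H, t0) *)

Lemma Z2P (i : 'Z_2) : i = 0 \/ i = 1.
Proof. by case: i => [[|[|[]]]] // ?; [left | right]; apply/val_inj. Qed.

Section BasisGrading.

Variables (F : fieldType) (m : nat) (I : finType) (Z : I -> 'M[F]_m) (c : I -> 'M[F]_m -> F).
Hypothesis dZ : dual_bases Z c.

Section Mul.
Variables (G : zmodType) (deg : I -> G).
Hypothesis degM : forall i j, Z i *m Z j \in span_deg deg Z (deg i + deg j).

Lemma span_deg_mul g h a b : a \in span_deg deg Z g -> b \in span_deg deg Z h ->
  a *m b \in span_deg deg Z (g + h).
Proof.
move=> /memv_sumP[u uE ->] /memv_sumP[w wE ->].
rewrite mulmx_suml; apply: memv_suml => i ig; rewrite mulmx_sumr.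
apply: memv_suml => j jh; rewrite -(eqP ig) -(eqP jh).
have /vlineP[x ->] := uE i ig; have /vlineP[y ->] := wE j jh.
by rewrite -scalemxAl -scalemxAr !memvZ.
Qed.

Lemma superalgebra_grading_of_basis (par : I -> 'Z_2) :
  is_superalgebra_grading (span_deg par Z) (span_deg deg Z).
Proof.
split; [exact: span_deg_direct dZ | exact: span_deg_mul | move=> g].
apply/eqP; rewrite eqEsubv; apply/andP; split; last first.
  by apply/subvP => v /memv_addP[u]; rewrite memv_cap => /andP[ug _] [w];
     rewrite memv_cap => /andP[wg _] ->; rewrite rpredD.
apply/subvP => v /memv_sumP[u uE ->]; apply: memv_suml => i ig.
have /vlineP[x ->] := uE i ig; rewrite memvZ //.
have Zig : Z i \in span_deg deg Z g by rewrite -(eqP ig) memv_span_deg.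
have := memv_span_deg par Z i; case: (Z2P (par i)) => -> Zi.
  by rewrite (subvP (addvSl _ _)) // memv_cap Zig.
by rewrite (subvP (addvSr _ _)) // memv_cap Zig.
Qed.

End Mul.

(** [Z i] alone spans its component. Some homogeneous part of [Z i] in the refinement has a nonzero
    coordinate at [i] and lies in that same component, so it is a multiple of [Z i]. *)
Lemma refined_line (G K : zmodType) (deg : I -> G) (E' : K -> {vspace 'M[F]_m}) i :
  direct_decomposition E' -> refines E' (span_deg deg Z) ->
  (forall j, deg j = deg i -> j = i) -> exists h, Z i \in E' h.
Proof.
move=> /projections_exist[p [s [[pL pE p1 p0] ps]]] refE uni.
case: (dZ) => cL cZ cE.
have [h ch] : exists h, c i (p h (Z i)) != 0.
  have : c i (Z i) != 0 by rewrite cZ eqxx oner_eq0.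
  rewrite {1}(ps (Z i)) scalar_form_sum1 //.
  elim: s {ps} => [|h s IHs]; first by rewrite big_nil eqxx.
  rewrite big_cons; have [->|ch] := eqVneq (c i (p h (Z i))) 0; last by exists h.
  by rewrite add0r.
have [g Eg] := refE h; exists h.
have pg := subvP Eg _ (pE h (Z i)).
have dig := span_degP deg g _ dZ pg i ch.
have pZ : p h (Z i) = c i (p h (Z i)) *: Z i.
  rewrite [LHS]cE (bigD1 i) //= big1 ?addr0 // => j ji.
  apply/eqP; rewrite scaler_eq0; apply/orP; left; apply: contraNT ji => cj.
  by apply/eqP/uni; rewrite dig; apply: (span_degP deg g _ dZ pg j cj).
have := pE h (Z i); rewrite pZ => /(memvZ (c i (p h (Z i)))^-1).
by rewrite scalerA mulVf // scale1r.
Qed.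

End BasisGrading.

Section Beta.

Variables (F : closedFieldType) (H : finZmodType).
Local Notation T := (TH F H).

Lemma betaDl (u v w : T) : beta (u + v) w = beta u w * beta v w.
Proof. by rewrite /beta /= dual_addE dualDE invfM mulrACA. Qed.

Lemma beta_neq0 (u v : T) : beta u v != 0.
Proof. by rewrite mulf_neq0 ?invr_eq0 ?dual_neq0. Qed.

Hypothesis H_neq0 : #|H|%:R != 0 :> F.

Lemma beta_nondegenerate (u : T) : (forall v, beta u v = 1) -> u = 0.
Proof.
case: u => h chi u1.
have -> : chi = 0.
  apply: dual_eqP => x; rewrite dual_zeroE -(u1 (x, 0)) /beta /= dual_zeroE.
  by rewrite invr1 mulr1.
apply/eqP/contraT => nz; have h0 : h != 0.
  by apply: contra nz => /eqP->; apply/eqP; congr pair; apply: dual_eqP => x; have := u1 (x, 0);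
     rewrite /beta /= !dual_zeroE invr1 mulr1.
have [psi] := dual_separates H_neq0 h0; have := u1 (0, psi).
rewrite /beta /= dual0E mul1r => /(congr1 GRing.inv).
by rewrite invrK invr1 => ->; rewrite eqxx.
Qed.

End Beta.

(** For a <> b the vector e_a - e_b has entry 1 only at a and entry -1 only at b. *)
Lemma root_inj k (a b a' b' : 'I_k) : a != b ->
  delta_mx 0 a - delta_mx 0 b = delta_mx 0 a' - delta_mx 0 b' :> 'rV[int]_k ->
  a' = a /\ b' = b.
Proof.
move=> ab e.
have := congr1 (fun M : 'rV[int]_k => M 0 a) e.
have := congr1 (fun M : 'rV[int]_k => M 0 b) e.
rewrite !mxE !eqxx /= (eq_sym b a) (negPf ab) /=.
have [<- _|_] := eqVneq b b'; last by case: (b == a').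
by rewrite (negPf ab); have [<-|_] := eqVneq a a'.
Qed.

Lemma root_eq0 k (a b : 'I_k) :
  (delta_mx 0 a - delta_mx 0 b == 0 :> 'rV[int]_k) = (a == b).
Proof.
have [->|ab] := eqVneq a b; first by rewrite subrr eqxx.
apply/eqP => e; have := congr1 (fun M : 'rV[int]_k => M 0 a) e.
by rewrite !mxE !eqxx (negPf ab).
Qed.

Section GammaBasis.

Variables (F : closedFieldType) (H : finZmodType) (t0 : TH F H) (k : nat).
Local Notation T := (TH F H).
Hypothesis H_neq0 : #|H|%:R != 0 :> F.

Definition Gidx := ('I_k * 'I_k * T)%type.

Definition GZ (x : Gidx) : 'M[F]_(k * #|H|) := delta_mx x.1.1 x.1.2 *t XH x.2.

(** Fourier inversion on H: in block (a, b), the entries of X_(h, chi) along the shift by h are the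
    values of chi, so a coefficient is an average against the inverse character. *)
Definition Gcoord (x : Gidx) (M : 'M[F]_(k * #|H|)) : F :=
  #|H|%:R^-1 * \sum_(h : H) (x.2.2 h)^-1 *
    M (mxtens_index (x.1.1, enum_rank (h + x.2.1))) (mxtens_index (x.1.2, enum_rank h)).

Definition Gdeg (x : Gidx) : T * 'rV[int]_k :=
  (x.2, delta_mx 0 x.1.1 - delta_mx 0 x.1.2).

Definition Gpar (x : Gidx) : 'Z_2 := parity t0 x.2.

Lemma GZM (x y : Gidx) : GZ x *m GZ y =
  ((x.1.2 == y.1.1)%:R * x.2.2 y.2.1) *: GZ (x.1.1, y.1.2, x.2 + y.2).
Proof.
rewrite /GZ tensmx_mul XH_mul mul_delta_mx_cond /=.
case: eqP => _; last by rewrite mulr0n mul0r scale0r tens0mx.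
by rewrite mulr1n mul1r; apply/matrixP=> i j; rewrite !mxE mulrCA.
Qed.

Lemma GZ_coord (x y : Gidx) : Gcoord x (GZ y) = (x == y)%:R.
Proof.
case: x y => [[a b] [h chi]] [[a' b'] [h' psi]]; rewrite /Gcoord /GZ /=.
under eq_bigr => z _ do rewrite tensmxE !mxE !enum_rankK (inj_eq (addrI z)).
have -> : ((a, b, (h, chi)) == (a', b', (h', psi))) =
          (a == a') && (b == b') && (h == h') && (chi == psi).
  by rewrite !xpair_eqE !andbA.
case: (_ && _) => /=; last by rewrite big1 ?mulr0 // => z _; rewrite mul0r mulr0.
case: (h == h') => /=; last by rewrite big1 ?mulr0 // => z _; rewrite mulr0n !mulr0.
under eq_bigr => z _ do rewrite mulr1n mul1r -dual_oppE -dual_addE.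
by rewrite sum_dual_fun // addrC subr_eq0 eq_sym natrM mulKf.
Qed.

(** Biorthogonality together with the count k^2 |H| |H^| = (k |H|)^2, where the order of the dual
    enters. *)
Lemma GZ_dual : dual_bases GZ Gcoord.
Proof.
apply: dual_bases_of_card; [|exact: GZ_coord|].
  move=> x a u v; rewrite /Gcoord [in RHS]mulrCA -mulrDr; congr (_ * _).
  rewrite mulr_sumr -big_split /=; apply: eq_bigr => h _; rewrite !mxE mulrDr.
  by rewrite [in LHS]mulrCA.
by rewrite !card_prod !card_ord (card_dual H_neq0) dimvf /dim /= mulnACA.
Qed.

Lemma Gamma_span : @Gamma F H k = span_deg Gdeg GZ.
Proof.
apply: functional_extensionality => -[t e]; apply/eqP; rewrite eqEsubv; apply/andP; split.
  apply/subv_sumP => -[a b] /eqP /= ab; rewrite -memvE.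
  by have := memv_span_deg Gdeg GZ (a, b, t); rewrite /Gdeg /= ab.
apply/subv_sumP => -[[a b] u] /eqP /= [-> <-]; rewrite /GZ /=.
by apply: (subv_trans _ (sumv_sup (a, b) _ (subvv _))).
Qed.

Lemma kron_span : kron_superalgebra t0 k = span_deg Gpar GZ.
Proof.
apply: functional_extensionality => i; apply/eqP; rewrite eqEsubv; apply/andP; split.
  apply/subv_sumP => t /eqP ti; apply/subv_sumP => a _; apply/subv_sumP => b _.
  by rewrite -memvE -ti; apply: (memv_span_deg Gpar GZ (a, b, t)).
apply/subv_sumP => -[[a b] u] ui; rewrite /GZ /=.
apply: (subv_trans _ (sumv_sup u ui (subvv _))).
apply: (subv_trans _ (sumv_sup a isT (subvv _))).
exact: (subv_trans _ (sumv_sup b isT (subvv _))).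
Qed.

Lemma GZ_degM i j : GZ i *m GZ j \in span_deg Gdeg GZ (Gdeg i + Gdeg j).
Proof.
rewrite GZM; case: eqP => [ij|_]; last by rewrite mul0r scale0r mem0v.
rewrite memvZ //.
have -> : Gdeg i + Gdeg j = Gdeg (i.1.1, j.1.2, i.2 + j.2); last exact: memv_span_deg.
by congr pair; rewrite /= ij addrA subrK.
Qed.

Lemma Gamma_grading :
  is_superalgebra_grading (kron_superalgebra t0 k) (@Gamma F H k).
Proof.
rewrite Gamma_span kron_span.
apply: superalgebra_grading_of_basis; [exact: GZ_dual | exact: GZ_degM].
Qed.

(** These are the only coincidences of degrees, hence the only components that a refinement could
    split. *)
Lemma Gdeg_diag a b t x : Gdeg x = Gdeg (a, b, t) ->
  x = (a, b, t) \/ (a = b /\ exists a', x = (a', a', t)).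
Proof.
case: x => [[a' b'] t'] [-> e]; have [ab|ab] := eqVneq a b.
  right; split=> //; exists a'; congr (_, _, _).
  apply/esym/eqP; rewrite -root_eq0 e /= ab subrr //.
by have [-> ->] := root_inj ab (esym e); left.
Qed.

Lemma Gamma_fine : is_fine (kron_superalgebra t0 k) (@Gamma F H k).
Proof.
rewrite Gamma_span kron_span => K E' [dE' mE' _] [refE [h [g [Eh0 Ehg Ehn]]]].
have line := refined_line GZ_dual dE' refE.
have homZ a b t : a != b -> exists h, GZ (a, b, t) \in E' h.
  move=> ab; apply: line => x /Gdeg_diag[//|[ab']]; by rewrite ab' eqxx in ab.
(* A product of composable basis elements is a basis element up to a nonzero scalar, which is
   divided out. *)
have scaleE x y d : GZ x *m GZ y \in E' d -> x.1.2 = y.1.1 ->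
    GZ (x.1.1, y.1.2, x.2 + y.2) \in E' d.
  move=> xy ij; rewrite GZM ij eqxx mul1r in xy.
  move: xy => /(memvZ (x.2.2 y.2.1)^-1); rewrite scalerA mulVf ?dual_neq0 // scale1r.
  by [].
(* It suffices to put the whole component of Gamma into one component of the refinement: it already
   contains [E' h], so uniqueness of degrees forces equality. *)
suff [d gd] : exists d, (span_deg Gdeg GZ g <= E' d)%VS.
  have vh := memv_pick (E' h); have v0 := Eh0; rewrite -vpick0 in v0.
  have dh : d = h.
    by apply: (homog_inj dE' (subvP gd _ (subvP Ehg _ vh)) vh v0).
  by case/eqP: Ehn; apply/eqP; rewrite eqEsubv Ehg -dh gd.
have /(span_deg_neq0P _ _ GZ_dual)[[[a b] t] dx] : span_deg Gdeg GZ g != 0%VS.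
  by apply: contra Eh0 => /eqP g0; rewrite -subv0 -g0.
suff [d Zd] : exists d, forall x, Gdeg x = Gdeg (a, b, t) -> GZ x \in E' d.
  by exists d; apply/subv_sumP => x /eqP xg; rewrite -memvE Zd // xg dx.
have [ab|ab] := eqVneq a b; last first.
  have [d Zd] := homZ a b t ab; exists d => x /Gdeg_diag[->//|[ab']].
  by rewrite ab' eqxx in ab.
rewrite -{b}ab in dx *.
(* If k = 1 there are no off-diagonal elements, but then the diagonal component is itself a line. *)
have [/existsP[b ba]|nb] := boolP [exists b, b != a]; last first.
  have uni x : Gdeg x = Gdeg (a, a, t) -> x = (a, a, t).
    case/Gdeg_diag => // -[_ [a' ->]].
    have -> // : a' = a.
    by apply/eqP; rewrite -[_ == _]negbK; apply: contra nb => na; apply/existsP; exists a'.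
  by have [d Zd] := line (a, a, t) uni; exists d => x /uni->.
(* E_aa (x) X_t is the product of E_ab (x) X_t and E_ba (x) 1, both already homogeneous. *)
have [d Zad] : exists d, GZ (a, a, t) \in E' d.
  have [p Zp] := homZ b a 0 ba; have ab : a != b by rewrite eq_sym.
  have [q Zq] := homZ a b t ab; exists (q + p).
  have := scaleE _ _ _ (mE' _ _ _ _ Zq Zp) erefl; rewrite /= addr0 //.
exists d => x /Gdeg_diag[->//|[_ [a' ->]]].
have [->//|aa] := eqVneq a' a.
have [p Zp] := homZ a' a 0 aa; have aa' : a != a' by rewrite eq_sym.
have [q Zq] := homZ a a' 0 aa'.
have Zaa := scaleE _ _ _ (mE' _ _ _ _ Zq Zp) erefl; rewrite /= addr0 in Zaa.
(* E_aa (x) 1 is a nonzero idempotent, so its degree q + p is 0; conjugation by E_a'a and E_aa' then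
   leaves the degree d unchanged. *)
have qp0 : q + p = 0.
  have Zaa2 := scaleE _ _ _ (mE' _ _ _ _ Zaa Zaa) erefl; rewrite /= addr0 in Zaa2.
  have := homog_inj dE' Zaa Zaa2 (basis_neq0 _ GZ_dual).
  by rewrite -[LHS]addr0 => /addrI/esym.
have := scaleE _ _ _ (mE' _ _ _ _ (scaleE _ _ _ (mE' _ _ _ _ Zp Zad) erefl) Zq) erefl.
by rewrite /= add0r addr0 addrAC [p + q]addrC qp0 add0r.
Qed.

End GammaBasis.

(** * The universal group *)

Section EvalSupport.

Variables (F : fieldType) (m : nat) (G : zmodType) (E : G -> {vspace 'M[F]_m}).

(** Sums and differences change the domain; evaluating over any larger list gives a common index
    set, which makes additivity visible. *)
Lemma eval_support_over (d : seq (Defs.support E)) x : uniq d -> {subset dom x <= d} ->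
  eval_support x = \sum_(s <- d) val s *~ coeff s x.
Proof.
move=> ud sd; rewrite [RHS](bigID (mem (dom x))) /= [X in _ + X]big1 ?addr0 => [|s]; last first.
  by move=> /coeff_outdom->; rewrite mulr0z.
rewrite -[RHS]big_filter; apply: perm_big; apply: uniq_perm; rewrite ?filter_uniq ?uniq_dom //.
by move=> s; rewrite mem_filter; case: (boolP (s \in dom x)) => //= /sd->.
Qed.

Fact eval_support_is_additive : zmod_morphism (@eval_support F m G E).
Proof.
move=> x y; pose d := undup (dom x ++ dom y).
rewrite !(@eval_support_over d) ?undup_uniq // => [||s|s].
- by rewrite -sumrB; apply: eq_bigr => s _; rewrite coeffB mulrzBr.
- by rewrite /d => s sy; rewrite mem_undup mem_cat sy orbT.
- by rewrite /d mem_undup mem_cat => ->.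
- by move=> /domB; rewrite mem_undup.
Qed.

HB.instance Definition _ :=
  GRing.isZmodMorphism.Build {freeg (Defs.support E)} G (@eval_support F m G E) eval_support_is_additive.

Lemma eval_support1 (s : Defs.support E) : eval_support [freeg [:: (1, s)]] = val s.
Proof. by rewrite /eval_support domU1 big_seq1 coeffU eqxx mulr1 mulr1z. Qed.

Lemma support_relationE (s1 s2 s3 : Defs.support E) : direct_decomposition E ->
  (forall g h a b, a \in E g -> b \in E h -> a *m b \in E (g + h)) ->
  support_relation s1 s2 s3 -> val s1 + val s2 = val s3.
Proof.
move=> dE mE [[a [b [aE bE ab]]] /(_ a b aE bE) abE].
exact: (homog_inj dE (mE _ _ _ _ aE bE) abE ab).
Qed.

Lemma relator_eval0 (x : {freeg (Defs.support E)}) : direct_decomposition E ->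
  (forall g h a b, a \in E g -> b \in E h -> a *m b \in E (g + h)) ->
  relator_subgroup x -> eval_support x = 0.
Proof.
move=> dE mE; elim=> [s1 s2 s3 /(support_relationE dE mE) s12||u v _ u0 _ v0].
- by rewrite raddfB raddfD /= !eval_support1 s12 subrr.
- by rewrite raddf0.
- by rewrite raddfB /= u0 v0 subrr.
Qed.

Local Notation R := (@relator_subgroup F m G E).

Lemma relatorN x : R x -> R (- x).
Proof. by move=> Rx; rewrite -sub0r; apply: relator_sub => //; apply: relator_zero. Qed.

Lemma relatorD x y : R x -> R y -> R (x + y).
Proof. by move=> Rx Ry; rewrite -[y]opprK; apply/relator_sub/relatorN. Qed.

(** Congruence modulo the relators replaces a quotient group: all computations below take place in
    the free group. *)
Definition relator_eq x y := R (x - y).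

Lemma relator_eq_refl x : relator_eq x x.
Proof. by rewrite /relator_eq subrr; apply: relator_zero. Qed.

Lemma relator_eq_sym x y : relator_eq x y -> relator_eq y x.
Proof. by move=> /relatorN; rewrite opprB. Qed.

Lemma relator_eq_trans y x z : relator_eq x y -> relator_eq y z -> relator_eq x z.
Proof. by move=> xy yz; have := relatorD xy yz; rewrite addrA subrK. Qed.

Lemma relator_eqD x y x' y' : relator_eq x y -> relator_eq x' y' -> relator_eq (x + x') (y + y').
Proof. by move=> xy xy'; rewrite /relator_eq opprD addrACA; apply: relatorD. Qed.

Lemma relator_eqN x y : relator_eq x y -> relator_eq (- x) (- y).
Proof. by move=> xy; rewrite /relator_eq -opprD; apply: relatorN. Qed.

Lemma relator_eqMz x y n : relator_eq x y -> relator_eq (x *~ n) (y *~ n).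
Proof.
move=> xy; have Rn p : relator_eq (x *+ p) (y *+ p).
  by elim: p => [|p IHp]; [apply: relator_eq_refl | rewrite !mulrS; apply: relator_eqD].
by case: n => p; [rewrite -!pmulrn | rewrite NegzE !mulrNz -!pmulrn; apply: relator_eqN].
Qed.

End EvalSupport.

Section UniversalGroup.

Variables (F : closedFieldType) (H : finZmodType) (k : nat).
Hypothesis H_neq0 : #|H|%:R != 0 :> F.
Local Notation T := (TH F H).
Local Notation E := (span_deg (@Gdeg F H k) (@GZ F H k)).
Local Notation S := {freeg (Defs.support E)}.
Local Notation "x ~ y" := (@relator_eq F _ _ E x y) (at level 70).

Let dZ := GZ_dual k H_neq0.

Lemma Gdeg_support x : E (Gdeg x) != 0%VS.
Proof. by apply/(span_deg_neq0P _ _ dZ); exists x. Qed.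

Definition Gsupp x : Defs.support E := Sub (Gdeg x) (Gdeg_support x).

Definition gen x : S := [freeg [:: (1, Gsupp x)]].

Lemma support_gen (s : Defs.support E) : exists x, s = Gsupp x.
Proof.
by have /(span_deg_neq0P _ _ dZ)[x xs] := valP s; exists x; apply/val_inj.
Qed.

(** One nonzero product is enough for a relation, and composable basis elements provide it. *)
Lemma gen_mul x y z : x.1.2 = y.1.1 -> Gdeg z = Gdeg x + Gdeg y ->
  gen x + gen y ~ gen z.
Proof.
move=> xy xyz; apply: relator_gen; split=> [|a b aE bE].
  exists (GZ x), (GZ y); rewrite !memv_span_deg GZM xy eqxx mul1r; split=> //.
  by rewrite scaler_eq0 negb_or dual_neq0 (basis_neq0 _ dZ).
by rewrite /= xyz; apply: (span_deg_mul (@GZ_degM F H k) aE bE).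
Qed.

Variable i0 : 'I_k.

(** A lift of g to the free group: t goes to the degree of E_(i0,i0) (x) X_t, and e_i to the degree
    e_i - e_i0. When the coordinates of g add up to 0, the e_i0 terms cancel and the lift has value
    g. *)
Definition normal_form (g : T * 'rV[int]_k) : S :=
  gen (i0, i0, g.1) + \sum_i gen (i, i0, 0) *~ g.2 0 i.

Lemma gen000 : gen (i0, i0, 0) ~ 0.
Proof.
have := @gen_mul (i0, i0, 0) (i0, i0, 0) (i0, i0, 0) erefl.
by rewrite /relator_eq addrK subr0; apply; congr pair; rewrite /= ?subrr addr0.
Qed.

(** E_ab (x) X_t factors as E_(a,i0) (x) 1, E_(i0,i0) (x) X_t, E_(i0,b) (x) 1, and the generator of
    E_(i0,b) is opposite to that of E_(b,i0). *)
Lemma normal_form_gen x : gen x ~ normal_form (Gdeg x).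
Proof.
case: x => [[a b] t]; rewrite /normal_form /=.
have -> : \sum_i gen (i, i0, 0) *~ (delta_mx 0 a - delta_mx 0 b : 'rV[int]_k) 0 i =
    gen (a, i0, 0) - gen (b, i0, 0).
  have dE c : \sum_i gen (i, i0, 0) *~ (delta_mx 0 c : 'rV[int]_k) 0 i = gen (c, i0, 0).
    rewrite (bigD1 c) //= mxE !eqxx mulr1z big1 ?addr0 // => i /negPf ic.
    by rewrite mxE ic andbF mulr0z.
  by rewrite -!dE -sumrB; apply: eq_bigr => i _; rewrite !mxE mulrzBr.
have r1 : gen (a, i0, 0) + gen (i0, b, t) ~ gen (a, b, t).
  by apply: gen_mul => //; congr pair; rewrite /= ?add0r // addrA subrK.
have r2 : gen (i0, i0, t) + gen (i0, b, 0) ~ gen (i0, b, t).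
  by apply: gen_mul => //; congr pair; rewrite /= ?addr0 // addrA subrK.
have r3 : gen (i0, b, 0) + gen (b, i0, 0) ~ gen (i0, i0, 0).
  by apply: gen_mul => //; congr pair; rewrite /= ?addr0 // addrA subrK.
have {}r3 : gen (i0, b, 0) ~ - gen (b, i0, 0).
  by have := relator_eq_trans r3 gen000; rewrite /relator_eq subr0 opprK.
apply: relator_eq_trans (relator_eq_sym r1) _; rewrite [X in _ ~ X]addrCA.
apply: relator_eqD (relator_eq_refl _) _.
apply: relator_eq_trans (relator_eq_sym r2) _.
exact: relator_eqD (relator_eq_refl _) _.
Qed.

Lemma normal_formD g h : normal_form (g + h) ~ normal_form g + normal_form h.
Proof.
rewrite /normal_form addrACA; apply: relator_eqD.
  apply: relator_eq_sym; apply: gen_mul => //.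
  by congr pair; rewrite /= subrr addr0.
rewrite -big_split /=.
under eq_bigr => i _ do rewrite mxE mulrzDr.
exact: relator_eq_refl.
Qed.

Lemma normal_form0 : normal_form 0 ~ 0.
Proof.
rewrite /normal_form big1 ?addr0 => [|i _]; first exact: gen000.
by rewrite mxE mulr0z.
Qed.

Lemma normal_formN g : normal_form (- g) ~ - normal_form g.
Proof.
have := relator_eq_trans (relator_eq_sym (normal_formD (- g) g)).
by rewrite addNr => /(_ _ normal_form0); rewrite /relator_eq subr0 opprK.
Qed.

Lemma normal_form_mulrz g n : normal_form (g *~ n) ~ normal_form g *~ n.
Proof.
have nat p : normal_form (g *+ p) ~ normal_form g *+ p.
  elim: p => [|p IHp]; first by rewrite !mulr0n; apply: normal_form0.
  rewrite !mulrS; apply: relator_eq_trans (normal_formD _ _) _.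
  exact: relator_eqD (relator_eq_refl _) _.
case: n => p; first by rewrite -!pmulrn.
rewrite NegzE !mulrNz -!pmulrn; apply: relator_eq_trans (normal_formN _) _.
exact: relator_eqN.
Qed.

(** Modulo relators an element is determined by its value in the grading group; this puts elements
    of value 0 among the relators. *)
Lemma normal_form_eval x : x ~ normal_form (eval_support x).
Proof.
rewrite /eval_support -{1}(freeg_sumE x).
elim: (dom x) => [|s d IHd]; first by rewrite !big_nil; apply/relator_eq_sym/normal_form0.
rewrite !big_cons; apply: relator_eq_trans (relator_eq_sym (normal_formD _ _)).
apply: relator_eqD IHd; have [y ->] := support_gen s.
apply: relator_eq_trans (relator_eq_sym (normal_form_mulrz _ _)).
by rewrite -[X in << X *g _ >>]intz -freegU_mulz; apply/relator_eqMz/normal_form_gen.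
Qed.

Lemma span_deg_universal : is_universal_group E (@GH F H k).
Proof.
have [dE mE _] := superalgebra_grading_of_basis dZ (@GZ_degM F H k) (fun=> 0).
split=> [g|x]; last first.
  split=> [x0|]; last exact: relator_eval0.
  have := relator_eq_trans (normal_form_eval x); rewrite x0 => /(_ _ normal_form0).
  by rewrite /relator_eq subr0.
pose sumc (g : T * 'rV[int]_k) := \sum_i g.2 0 i.
have sumcB u v : sumc (u - v) = sumc u - sumc v.
  by rewrite /sumc -sumrB; apply: eq_bigr => i _; rewrite !mxE.
have sumc_delta c : \sum_i (delta_mx 0 c : 'rV[int]_k) 0 i = 1.
  by rewrite (bigD1 c) //= mxE !eqxx big1 ?addr0 // => i /negPf ic; rewrite mxE ic andbF.
split=> [/eqP g0|[x <-]].
  exists (normal_form g); rewrite /normal_form raddfD raddf_sum /= eval_support1.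
  under eq_bigr => i _ do rewrite raddfMz /= eval_support1.
  case: g g0 => t v v0; apply/eqP; rewrite xpair_eqE; apply/andP; split.
    rewrite /= (raddf_sum (@fst _ _)) big1 ?addr0 // => i _.
    by rewrite (raddfMz (@fst _ _)) mul0rz.
  rewrite /= (raddf_sum (@snd _ _)) subrr add0r; apply/eqP/rowP => j.
  rewrite summxE /=; under eq_bigr => i _.
    rewrite (raddfMz (@snd _ _)) /= -scaler_int mxE [in X in _ * X]mxE [in X in _ * (_ + X)]mxE mulrDr mulrN intz.
    over.
  rewrite sumrB -mulr_suml v0 mul0r subr0 (bigD1 j) //= mxE !eqxx mulr1 big1 ?addr0 // => i ij.
  by rewrite mxE eq_sym (negPf ij) mulr0.
rewrite /GH /eval_support (raddf_sum (@snd _ _)) /=.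
under eq_bigr => i _ do rewrite summxE.
rewrite exchange_big big1 //= => s _.
have [[[a b] t] ->] := support_gen s.
under eq_bigr => i _ do rewrite (raddfMz (@snd _ _)) /= -scaler_int mxE.
rewrite -mulr_sumr.
under eq_bigr => i _ do rewrite mxE [X in _ + X]mxE.
by rewrite big_split /= sumrN !sumc_delta subrr mulr0.
Qed.

End UniversalGroup.

(** * The superalgebra structure *)

Lemma sqr1_neq1 (F : fieldType) (x : F) : x * x = 1 -> x != 1 -> x = -1.
Proof.
move=> xx x1; apply/eqP; have : (x - 1) * (x + 1) == 0.
  have -> : (x - 1) * (x + 1) = x * x - 1 by ring.
  by rewrite xx subrr.
by rewrite mulf_eq0 subr_eq0 (negPf x1) addr_eq0.
Qed.

Lemma char2_neq0 (F : fieldType) : 2%N \notin [pchar F] -> (2%:R : F) != 0.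
Proof. by move=> c2; apply: contra c2 => e; rewrite inE. Qed.

Section Diag.

Variables (F : closedFieldType) (H : finZmodType) (k : nat).
Local Notation T := (TH F H).

(** The copy of D inside M_k(D): invertible elements of degree (t, 0), through which the torsion
    part of the grading group can be followed. *)
Definition Ydiag (t : T) : 'M[F]_(k * #|H|) := 1%:M *t XH t.

Lemma tensZr m n p q (a : F) (A : 'M[F]_(m, n)) (B : 'M[F]_(p, q)) :
  A *t (a *: B) = a *: (A *t B).
Proof. by apply/matrixP=> i j; rewrite !mxE mulrCA. Qed.

Lemma Ydiag_sum t : Ydiag t = \sum_a GZ (a, a, t).
Proof.
rewrite /Ydiag /GZ /= mx1_sum_delta; apply/matrixP => i j; rewrite mxE !summxE mulr_suml.
by apply: eq_bigr => a _; rewrite !mxE.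
Qed.

Lemma YdiagM u v : Ydiag u *m Ydiag v = u.2 v.1 *: Ydiag (u + v).
Proof. by rewrite tensmx_mul XH_mul mulmx1 tensZr. Qed.

Lemma Ydiag0 : Ydiag 0 = 1%:M.
Proof.
apply/matrixP=> i j; case: (mxtens_indexP i) (mxtens_indexP j) => i1 i2 [j1 j2].
rewrite tensmxE !mxE dual_zeroE addr0 (inj_eq enum_val_inj).
by rewrite (can_eq (@mxtens_indexK _ _)) xpair_eqE -natrM mulnb.
Qed.

Lemma Ydiag_comm t x : Ydiag t *m GZ x = beta t x.2 *: (GZ x *m Ydiag t).
Proof. by rewrite !tensmx_mul XH_comm mul1mx mulmx1 tensZr. Qed.

Lemma YdiagK t : Ydiag t *m Ydiag (- t) = (t.2 (- t.1))%:M.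
Proof. by rewrite YdiagM subrr Ydiag0 scalemx1. Qed.

Lemma Ydiag_unit t : Ydiag t \in unitmx.
Proof.
have /mulmx1_unit[] // : Ydiag t *m ((t.2 (- t.1))^-1 *: Ydiag (- t)) = 1%:M.
by rewrite -scalemxAr YdiagK scale_scalar_mx mulVf ?dual_neq0.
Qed.

Lemma mem_Ydiag t : Ydiag t \in span_deg (@Gdeg F H k) (@GZ F H k) (t, 0).
Proof.
rewrite Ydiag_sum; apply: memv_suml => a _.
have := memv_span_deg (@Gdeg F H k) (@GZ F H k) (a, a, t).
by rewrite /Gdeg /= subrr.
Qed.

Lemma mem_Ydiag_par t0 t : Ydiag t \in span_deg (@Gpar F H t0 k) (@GZ F H k) (parity t0 t).
Proof.
rewrite Ydiag_sum; apply: memv_suml => a _.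
exact: (memv_span_deg (@Gpar F H t0 k) (@GZ F H k) (a, a, t)).
Qed.

End Diag.

Lemma row_base_exists (F : fieldType) N n (Q : 'M[F]_N) : \rank Q = n ->
  exists P : 'M[F]_(n, N), row_free P /\ (P <= Q)%MS.
Proof. by move=> <-; exists (row_base Q); rewrite row_base_free eq_row_base. Qed.

Section KronMnn.

Variables (F : closedFieldType) (H : finZmodType) (t0 : TH F H) (k n : nat).
Hypotheses (c2 : 2%N \notin [pchar F]) (H_neq0 : #|H|%:R != 0 :> F).
Hypotheses (t0_order : has_order2 t0) (sizeE : (k * #|H| = n + n)%N).
Local Notation N := (k * #|H|)%N.

Lemma beta_t0_sq t : beta t0 t * beta t0 t = 1.
Proof.
case: t0_order => _ t02; rewrite -betaDl -mulr2n t02 /beta /= dual_zeroE dual0E.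
by rewrite invr1 mulr1.
Qed.

(** Parity is inner: conjugation by 1 (x) X_t0 multiplies the part of degree u by beta(t0, u). In a
    basis of eigenvectors of a rescaled involution J, commuting with J means block-diagonal and
    anticommuting means block-off-diagonal. *)
Lemma kron_Mnn_isomorphic : superalgebras_isomorphic (kron_superalgebra t0 k) (@Mnn F n).
Proof.
have dZ := GZ_dual k H_neq0.
have two0 := char2_neq0 c2.
(* X_t0 squares to the scalar [t0.2 t0.1], so dividing by a square root of it yields an
   involution. *)
have [r r2] : exists r : F, r ^+ 2 = t0.2 t0.1.
  have /closed_rootP[r] : size ('X^2 - (t0.2 t0.1)%:P : {poly F}) != 1%N by rewrite size_XnsubC.
  by rewrite rootE !hornerE subr_eq0 => /eqP; exists r.
have r0 : r != 0.
  by have := dual_neq0 t0.2 t0.1; rewrite -r2; apply: contra => /eqP->; rewrite expr0n.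
pose J : 'M[F]_N := r^-1 *: Ydiag k t0.
have JJ : J *m J = 1%:M.
  rewrite /J -scalemxAl -scalemxAr YdiagM.
  by case: t0_order => _; rewrite mulr2n => ->; rewrite Ydiag0 !scalerA -r2 (_ : _ * _ = 1) ?scale1r //; field.
have JZ x : J *m GZ x = beta t0 x.2 *: (GZ x *m J).
  by rewrite /J -scalemxAl Ydiag_comm -scalemxAr !scalerA mulrC.
(* Nondegeneracy gives an invertible element that anticommutes with [J]; it exchanges the two
   eigenspaces, which therefore have equal dimension n. *)
have [t bt] : exists t, beta t0 t != 1.
  apply/existsP/contraT; rewrite negb_exists => /forallP b1; case: t0_order => [[]].
  by apply: (beta_nondegenerate H_neq0) => v; have := b1 v; rewrite negbK => /eqP.
have {}bt : beta t0 t = -1 by apply: sqr1_neq1 bt; apply: beta_t0_sq.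
pose S := Ydiag k t.
have JS : J *m S = - (S *m J).
  rewrite /S Ydiag_sum mulmx_sumr mulmx_suml -sumrN; apply: eq_bigr => a _.
  by rewrite JZ /= bt scaleN1r.
pose Qp := 1%:M + J; pose Qm := 1%:M - J.
have QS : Qp *m S = S *m Qm by rewrite /Qp /Qm mulmxDl mulmxBr JS mul1mx mulmx1.
have rkpm : \rank Qp = \rank Qm.
  have uS : S \in unitmx := Ydiag_unit k t.
  rewrite -(mxrankMfree Qp (_ : row_free S)) ?row_free_unit // QS.
  by rewrite -mxrank_tr trmx_mul mxrankMfree ?mxrank_tr // row_free_unit unitmx_tr.
have rk : \rank Qp = n.
  have le1 : (\rank Qp + \rank Qm <= N)%N.
    apply: mulmx0_rank_max; rewrite mulmxDl !mulmxBr !mul1mx JJ mulmx1.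
    by rewrite addrA subrK subrr.
  have le2 : (N <= \rank Qp + \rank Qm)%N.
    rewrite -[X in (X <= _)%N](mxrank1 F) -(mxrank_scale_nz (1%:M) two0).
    have -> : 2%:R *: 1%:M = Qp + Qm by rewrite /Qp /Qm addrACA subrr addr0 scaler_nat mulr2n.
    exact: mxrank_add.
  by move: le1 le2 sizeE; rewrite -rkpm; move: (\rank Qp) => ?; lia.
have [P1 [fP1 /submxP[U1 P1E]]] := row_base_exists rk.
have [P2 [fP2 /submxP[U2 P2E]]] := row_base_exists (etrans (esym rkpm) rk).
have P1J : P1 *m J = P1 by rewrite P1E -mulmxA mulmxDl mul1mx JJ addrC.
have P2J : P2 *m J = - P2 by rewrite P2E -mulmxA mulmxBl mul1mx JJ -mulmxN opprB.
pose P := col_mx P1 P2; pose D : 'M[F]_(n + n) := block_mx 1%:M 0 0 (- 1%:M).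
have PJ : P *m J = D *m P.
  by rewrite mul_col_mx P1J P2J /D mul_block_col !mul0mx addr0 add0r mulNmx !mul1mx.
have fP : row_free P.
  apply: inj_row_free => v; rewrite -[v]hsubmxK; set v1 := lsubmx v; set v2 := rsubmx v.
  rewrite mul_row_col => e; have := congr1 (mulmx^~ J) e.
  rewrite mulmxDl -!mulmxA P1J P2J mul0mx mulmxN => e2.
  have z1 : v1 = 0.
    have : v1 *m P1 == 0.
      have : (v1 *m P1 + v2 *m P2) + (v1 *m P1 - v2 *m P2) = 0 by rewrite e e2 addr0.
      rewrite addrACA subrr addr0 -mulr2n -scaler_nat => /eqP.
      by rewrite scaler_eq0 (negPf two0).
    by rewrite mulmx_free_eq0 // => /eqP.
  have z2 : v2 = 0.
    by move/eqP: e; rewrite z1 mul0mx add0r mulmx_free_eq0 // => /eqP.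
  by rewrite z1 z2 row_mx0.
have rP : row_full P by rewrite /row_full (eqP fP) sizeE.
have [Pi [PPi PiP]] : exists Pi, P *m Pi = 1%:M /\ Pi *m P = 1%:M.
  by exists (pinvmx P); rewrite mulmxVp // mulVpmx.
have phiL : linear (fun M : 'M[F]_N => P *m M *m Pi).
  by move=> a A B; rewrite mulmxDr mulmxDl -scalemxAr -scalemxAl.
have phiE := linfunE phiL; set phi := linfun _ in phiE.
have phiK : cancel phi (fun M => Pi *m M *m P).
  by move=> M; rewrite /= phiE !mulmxA PiP mul1mx -mulmxA PiP mulmx1.
have phiK' : cancel (fun M => Pi *m M *m P) phi.
  by move=> M; rewrite /= phiE !mulmxA PPi mul1mx -mulmxA PPi mulmx1.
have dE : direct_decomposition (kron_superalgebra t0 k).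
  by rewrite kron_span; apply: (span_deg_direct _ dZ).
have sub i a : a \in kron_superalgebra t0 k i -> phi a \in @Mnn F n i.
  move=> ai.
  have PiJ : Pi *m D = J *m Pi.
    by rewrite -[LHS]mulmx1 -PPi -!mulmxA [D *m _]mulmxA -PJ !mulmxA PiP mul1mx.
  pose M := phi a.
  have ME : M = block_mx (ulsubmx M) (ursubmx M) (dlsubmx M) (drsubmx M) by rewrite submxK.
  have DM : J *m a = a *m J -> D *m M = M *m D.
    move=> Ja; rewrite /M phiE -!mulmxA PiJ [D *m _]mulmxA -PJ -!mulmxA.
    by congr (_ *m _); rewrite !mulmxA Ja.
  have DM' : J *m a = - (a *m J) -> D *m M = - (M *m D).
    move=> Ja; rewrite /M phiE -!mulmxA PiJ [D *m _]mulmxA -PJ -!mulmxA -mulmxN.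
    by congr (_ *m _); rewrite !mulmxA Ja mulNmx.
  have half m m' (B : 'M[F]_(m, m')) : B = - B -> B == 0.
    move=> /eqP; rewrite -addr_eq0 -mulr2n -scaler_nat scaler_eq0 (negPf two0) //.
  have Ja : J *m a = if i == 0 then a *m J else - (a *m J).
    move: ai; rewrite kron_span => /memv_sumP[w wE ->].
    rewrite mulmx_sumr mulmx_suml -sumrN; case: ifP => i0; apply: eq_bigr => x xi;
      have /vlineP[b ->] := wE x xi; move: xi; rewrite /Gpar /parity.
      case: ifP => [/eqP b1 _|_ /eqP xi]; last by rewrite -xi in i0.
      by rewrite -scalemxAr JZ b1 scale1r scalemxAl.
    case: ifP => [_ /eqP xi|b1 _]; first by rewrite -xi in i0.
    rewrite -scalemxAr JZ (sqr1_neq1 (beta_t0_sq _)) ?b1 //.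
    by rewrite scaleN1r scalerN scalemxAl.
  case: (Z2P i) => i0; rewrite i0 /= in Ja *.
    rewrite mem_Mnn_even -/M; move: (DM Ja); rewrite {1 2}ME /D !mulmx_block !mul0mx !mulmx0 !mulNmx !mulmxN.
    rewrite !mul1mx !mulmx1 ?(add0r, addr0, oppr0) => /eq_block_mx[_ e1 /esym e2 _].
    by rewrite !half.
  rewrite mem_Mnn_odd -/M; move: (DM' Ja); rewrite {1 2}ME /D !mulmx_block !mul0mx !mulmx0 !mulNmx !mulmxN.
  rewrite !mul1mx !mulmx1 ?(add0r, addr0, oppr0) opp_block_mx => /eq_block_mx[e1 _ _ e2].
  by rewrite !half // -[LHS]opprK -e2.
exists phi; split; first by exists (fun M => Pi *m M *m P).
  by move=> a b; rewrite !phiE -!mulmxA [Pi *m (P *m _)]mulmxA PiP mul1mx.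
(* Each part is mapped into the matching part. As the two parts of [Mnn] meet in 0, the preimage of
   an even matrix has no odd component, and conversely; this gives surjectivity on each part. *)
have cap v : v \in @Mnn F n 0 -> v \in @Mnn F n 1 -> v = 0.
  rewrite mem_Mnn_even mem_Mnn_odd => /andP[/eqP u /eqP d] /andP[/eqP u' /eqP d'].
  by rewrite -[v]submxK u d u' d' block_mx0.
have full a : exists a0 a1, [/\ a0 \in kron_superalgebra t0 k 0,
    a1 \in kron_superalgebra t0 k 1 & a = a0 + a1].
  case: dZ => _ _ aE.
  exists (\sum_(x | parity t0 x.2 == 0) Gcoord x a *: GZ x),
    (\sum_(x | parity t0 x.2 != 0) Gcoord x a *: GZ x).
  rewrite kron_span; split=> [||]; last first.
  - by rewrite [LHS]aE (bigID (fun x : Gidx F H k => parity t0 x.2 == 0)).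
  - apply: memv_suml => x xi; rewrite memvZ //.
    have := memv_span_deg (@Gpar F H t0 k) (@GZ F H k) x.
    by rewrite /Gpar; case: (Z2P (parity t0 x.2)) xi => ->.
  apply: memv_suml => x /eqP xi; rewrite memvZ // -xi.
  exact: (memv_span_deg (@Gpar F H t0 k) (@GZ F H k) x).
move=> i; apply/eqP; rewrite eqEsubv; apply/andP; split.
  by apply/subvP => _ /memv_imgP[a ai ->]; apply: sub.
apply/subvP => b bi; rewrite -[b]phiK'; apply: memv_img.
have [a0 [a1 [A0 A1 aE]]] := full (Pi *m b *m P).
have bE : b = phi a0 + phi a1 by rewrite -linearD -aE; apply/esym/phiK'.
have := sub _ _ A0; have := sub _ _ A1 => b1 b0.
have inj0 a : phi a = 0 -> a = 0 by move=> e; rewrite -[a]phiK e mulmx0 mul0mx.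
case: (Z2P i) => i0; rewrite i0 in bi *.
  rewrite aE (inj0 a1) ?addr0 //; apply: cap => //.
  have -> : phi a1 = b - phi a0 by rewrite bE addrC addrA addNr add0r.
  exact: rpredB.
rewrite aE (inj0 a0) ?add0r //; apply: cap => //.
have -> : phi a0 = b - phi a1 by rewrite bE addrK.
exact: rpredB.
Qed.

End KronMnn.

(** * Equivalences *)

HB.saturate prod.

Section Images.

Variables (F : fieldType) (V W : vectType F) (phi : 'Hom(V, W)).
Hypothesis phiI : injective phi.

Lemma memv_img_inj U v : (phi v \in (phi @: U)%VS) = (v \in U).
Proof. by apply/memv_imgP/idP => [[u uU /phiI->]|vU]; [| exists v]. Qed.

Lemma limg_inj U U' : (phi @: U = phi @: U')%VS -> U = U'.
Proof. by move=> e; apply/vspaceP=> v; rewrite -!memv_img_inj e. Qed.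

Lemma limg_eq0_inj U : ((phi @: U)%VS == 0%VS) = (U == 0%VS).
Proof. by apply/eqP/eqP => [|->]; rewrite -{1}(limg0 phi) //; apply: limg_inj. Qed.

End Images.

Lemma component_inj (F : fieldType) (V : vectType F) (G : zmodType) (E : G -> {vspace V}) g h :
  direct_decomposition E -> E g != 0%VS -> E g = E h -> g = h.
Proof.
move=> dE Eg0 e; have := memv_pick (E g) => vg; have vh := vg; rewrite {2}e in vh.
by apply: homog_inj dE vg vh _; rewrite vpick0.
Qed.

(** The bijection of supports is obtained by choice; it is invertible because a nonzero component
    determines its degree. *)
Lemma gradings_equivalent_of_iso (F : fieldType) m m' (A : 'Z_2 -> {vspace 'M[F]_m})
    (G : zmodType) (E : G -> {vspace 'M[F]_m}) (B : 'Z_2 -> {vspace 'M[F]_m'})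
    (K : zmodType) (E' : K -> {vspace 'M[F]_m'}) phi :
  is_superalgebra_iso A B phi -> direct_decomposition E -> direct_decomposition E' ->
  (forall g, E g != 0%VS -> exists h, (phi @: E g)%VS = E' h) ->
  (forall h, E' h != 0%VS -> exists g, (phi @: E g)%VS = E' h) ->
  gradings_equivalent A E B E'.
Proof.
move=> isoP dE dE' fwd bwd; case: (isoP) => [/bij_inj phiI _ _].
have ex1 (s : Defs.support E) : exists h, (phi @: E (val s) == E' h)%VS.
  by have [h e] := fwd _ (valP s); exists h; rewrite e.
have ex2 (s : Defs.support E') : exists g, (phi @: E g == E' (val s))%VS.
  by have [g e] := bwd _ (valP s); exists g; rewrite e.
have nz1 s : E' (xchoose (ex1 s)) != 0%VS.
  by rewrite -(eqP (xchooseP (ex1 s))) limg_eq0_inj // (valP s).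
have nz2 s : E (xchoose (ex2 s)) != 0%VS.
  by rewrite -(limg_eq0_inj phiI) (eqP (xchooseP (ex2 s))) (valP s).
pose alpha s : Defs.support E' := exist (fun h => E' h != 0%VS) _ (nz1 s).
pose gamma s : Defs.support E := exist (fun g => E g != 0%VS) _ (nz2 s).
have alphaP s : (phi @: E (val s))%VS = E' (val (alpha s)) := eqP (xchooseP (ex1 s)).
have gammaP s : (phi @: E (val (gamma s)))%VS = E' (val s) := eqP (xchooseP (ex2 s)).
exists phi, alpha; split=> //; exists gamma => s; apply: val_inj.
  apply: (component_inj dE (valP (gamma _))); apply: (limg_inj phiI).
  by rewrite gammaP alphaP.
apply: (component_inj dE' (valP (alpha _))).
by rewrite -alphaP gammaP.
Qed.

Lemma dual_bases_rescale (F : fieldType) (V : vectType F) (I J : finType) (Z : I -> V) c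
    (e : J -> I) (w : J -> F) : dual_bases Z c -> bijective e -> (forall j, w j != 0) ->
  dual_bases (fun j => w j *: Z (e j)) (fun j v => (w j)^-1 * c (e j) v).
Proof.
move=> [cL cZ cE] be w0; split=> [j a u v|i j|v].
- by rewrite cL mulrDr mulrCA.
- rewrite /= scalar_formZ // cZ (inj_eq (bij_inj be)); case: eqP => [->|_].
    by rewrite mulr1 mulVf.
  by rewrite !mulr0.
- rewrite {1}(cE v) (reindex e) /=; last exact: onW_bij.
  by apply: eq_bigr => j _; rewrite scalerA mulrAC mulVf // mul1r.
Qed.

Section BasisIso.

Variables (F : fieldType) (m m' : nat) (I : finType).
Variables (Z : I -> 'M[F]_m) (c : I -> 'M[F]_m -> F).
Variables (Z' : I -> 'M[F]_m') (c' : I -> 'M[F]_m' -> F).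
Hypotheses (dZ : dual_bases Z c) (dZ' : dual_bases Z' c').

Lemma basis_iso (s : I -> I -> F) (mu : I -> I -> I) :
  (forall i j, Z i *m Z j = s i j *: Z (mu i j)) ->
  (forall i j, Z' i *m Z' j = s i j *: Z' (mu i j)) ->
  exists phi : 'Hom('M[F]_m, 'M[F]_m'), [/\ bijective phi,
    forall a b, phi (a *m b) = phi a *m phi b & forall i, phi (Z i) = Z' i].
Proof.
move=> ZM ZM'; case: (dZ) (dZ') => cL cZ cE [cL' cZ' cE'].
pose f (v : 'M[F]_m) : 'M[F]_m' := \sum_i c i v *: Z' i.
pose f' (v : 'M[F]_m') : 'M[F]_m := \sum_i c' i v *: Z i.
have fL : linear f.
  move=> a u v; rewrite /f scaler_sumr -big_split; apply: eq_bigr => i _ /=.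
  by rewrite cL scalerDl scalerA.
have [phi fE] : exists phi : 'Hom('M[F]_m, 'M[F]_m'), forall u, phi u = f u.
  by exists (linfun f) => u; apply: (linfunE fL).
have fZ i : phi (Z i) = Z' i.
  rewrite fE /f (bigD1 i) //= cZ eqxx scale1r big1 ?addr0 // => j ji.
  by rewrite cZ (negPf ji) scale0r.
exists phi; split=> //.
  exists f' => v; rewrite fE /f /f'.
    by rewrite [RHS]cE; apply: eq_bigr => i _; rewrite (coord_sum _ _ dZ').
  by rewrite [RHS]cE'; apply: eq_bigr => i _; rewrite (coord_sum _ _ dZ).
move=> a b; rewrite {1}(cE a) mulmx_suml linear_sum (fE a) /f mulmx_suml.
apply: eq_bigr => i _; rewrite {1}(cE b) mulmx_sumr linear_sum (fE b) /f mulmx_sumr.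
apply: eq_bigr => j _; rewrite -!scalemxAl -!scalemxAr !linearZ.
by rewrite ZM linearZ /= !fZ ZM' !scalerA [c i a * _]mulrC.
Qed.

End BasisIso.

Lemma limg_span_deg (F : fieldType) (V W : vectType F) (I J : finType) (G K : zmodType)
    (phi : 'Hom(V, W)) (Z : I -> V) (Z' : J -> W) (e : I -> J) (deg : I -> G) (deg' : J -> K) g h :
  bijective e -> (forall i, exists2 w : F, w != 0 & phi (Z i) = w *: Z' (e i)) ->
  (forall i, deg i = g <-> deg' (e i) = h) ->
  (phi @: span_deg deg Z g)%VS = span_deg deg' Z' h.
Proof.
move=> [e' eK e'K] phiZ degE; apply/eqP; rewrite eqEsubv limg_sum; apply/andP; split.
  apply/subv_sumP => i /eqP/degE ig; rewrite limg_line -memvE.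
  by have [w _ ->] := phiZ i; rewrite memvZ // -ig memv_span_deg.
apply/subv_sumP => j /eqP jh; have ig : deg (e' j) = g by apply/degE; rewrite e'K.
apply: subv_trans (sumv_sup (e' j) (introT eqP ig) (subvv _)).
rewrite limg_line -memvE; have [w w0 e1] := phiZ (e' j).
have -> : Z' j = w^-1 *: phi (Z (e' j)) by rewrite e1 e'K scalerA mulVf // scale1r.
by rewrite memvZ // memv_line.
Qed.

Section ToGamma.

Variables (F : closedFieldType) (T H : finZmodType) (tau : T -> T -> F) (f : T -> TH F H).
Hypotheses (tau0 : forall u v, tau u v != 0)
  (tauC : forall u v w, tau u v * tau (u + v) w = tau v w * tau u (v + w))
  (fD : forall u v, f (u + v) = f u + f v)
  (fbeta : forall u v, tau u v = beta (f u) (f v) * tau v u).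

(** [tau] and the cocycle (f u).2 (f v).1 of the X_(f u) have the same commutation factor, so their
    quotient is symmetric, hence a coboundary. *)
Lemma twist_exists : exists c : T -> F, (forall u, c u != 0) /\
  forall u v, c u * c v * ((f u).2 (f v).1) = tau u v * c (u + v).
Proof.
pose sg (u v : T) := (f u).2 (f v).1.
have sg0 u v : sg u v != 0 by apply: dual_neq0.
have sgC u v w : sg u v * sg (u + v) w = sg v w * sg u (v + w).
  by rewrite /sg !fD /= dual_addE dualDE; ring.
have sgbeta u v : sg u v = beta (f u) (f v) * sg v u.
  by rewrite /beta /sg -mulrA mulVf ?mulr1 // dual_neq0.
have [u v w|u v|u v|c [c0 cM]] := @symmetric_cocycle_coboundary F T (fun u v => tau u v / sg u v).
- rewrite ![_ / _ * (_ / _)]mulrACA -!invfM tauC sgC //.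
- by rewrite fbeta sgbeta -mulf_div divff ?mul1r // beta_neq0.
- by rewrite mulf_neq0 ?invr_eq0.
by exists c; split=> // u v; rewrite cM -/(sg u v) mulrAC divfK.
Qed.

Variables (m k : nat) (Z : 'I_k * 'I_k * T -> 'M[F]_m) (c : 'I_k * 'I_k * T -> 'M[F]_m -> F).
Hypotheses (H_neq0 : #|H|%:R != 0 :> F) (f_bij : bijective f) (dZ : dual_bases Z c).
Hypothesis ZM : forall x y, Z x *m Z y =
  ((x.1.2 == y.1.1)%:R * tau x.2 y.2) *: Z (x.1.1, y.1.2, x.2 + y.2).

Lemma iso_to_Gamma : exists phi : 'Hom('M[F]_m, 'M[F]_(k * #|H|)),
  [/\ bijective phi, forall a b, phi (a *m b) = phi a *m phi b &
      forall x, exists2 w : F, w != 0 & phi (Z x) = w *: GZ (x.1, f x.2)].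
Proof.
have [w [w0 wM]] := twist_exists.
pose e (x : 'I_k * 'I_k * T) : Gidx F H k := (x.1, f x.2).
have be : bijective e.
  by case: f_bij => g fK gK; exists (fun x => (x.1, g x.2)) => -[x y]; rewrite /e /= ?fK ?gK.
have dZ' := dual_bases_rescale (GZ_dual k H_neq0) be (fun x => w0 x.2).
have [|phi [bphi phiM phiZ]] := basis_iso dZ dZ' ZM.
  move=> x y; rewrite -scalemxAl -scalemxAr GZM /e /= !scalerA fD; congr (_ *: _).
  by have := wM x.2 y.2; case: (_ == _) => // e1; rewrite ?mul0r ?mulr0 // !mul1r.
by exists phi; split=> // x; exists (w x.2) => //; rewrite phiZ.
Qed.

End ToGamma.

Section EquivalentConverse.

Variables (F : closedFieldType) (H : finZmodType) (t0 : TH F H) (k : nat).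
Hypotheses (H_neq0 : #|H|%:R != 0 :> F).
Local Notation T := (TH F H).

(** The X_u and the X_(f u) have the same commutation factor, so X_u can be sent to a multiple of
    X_(f u); parity is respected since beta(f t0, f u) = beta(t0, u). *)
Lemma Gamma_equivalent_orbit (f : {additive T -> T}) : in_Aut_beta f ->
  gradings_equivalent (kron_superalgebra t0 k) (@Gamma F H k)
    (kron_superalgebra (f t0) k) (@Gamma F H k).
Proof.
move=> [f_bij fbeta]; have dZ := GZ_dual k H_neq0.
pose sg (u v : T) := u.2 v.1.
have sg0 u v : sg u v != 0 by apply: dual_neq0.
have sgC u v w : sg u v * sg (u + v) w = sg v w * sg u (v + w).
  by rewrite /sg /= dual_addE dualDE; ring.
have sgbeta u v : sg u v = beta (f u) (f v) * sg v u.
  by rewrite fbeta /beta /sg -mulrA mulVf ?mulr1 // dual_neq0.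
have [phi [bphi phiM phiZ]] :=
  iso_to_Gamma sg0 sgC (raddfD f) sgbeta H_neq0 f_bij dZ (@GZM F H k).
pose e (x : Gidx F H k) : Gidx F H k := (x.1, f x.2).
have [g fK gK] := f_bij.
have be : bijective e by exists (fun x => (x.1, g x.2)) => -[x y]; rewrite /e /= ?fK ?gK.
have phiG t x : (phi @: @Gamma F H k (t, x))%VS = @Gamma F H k (f t, x).
  rewrite Gamma_span; apply: (limg_span_deg be phiZ) => -[[a b] u].
  by rewrite /Gdeg /=; split=> [[-> ->]|[/(bij_inj f_bij)-> ->]].
apply: (gradings_equivalent_of_iso (phi := phi)).
- split=> // i; rewrite !kron_span; apply: (limg_span_deg be phiZ) => x.
  by rewrite /Gpar /parity /= fbeta.
- by rewrite Gamma_span; apply: (span_deg_direct _ dZ).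
- by rewrite Gamma_span; apply: (span_deg_direct _ dZ).
- by move=> [t x] _; exists (f t, x).
- by move=> [t x] _; exists (g t, x); rewrite phiG gK.
Qed.

End EquivalentConverse.

Lemma int_rV_torsionfree n (p : nat) (x : 'rV[int]_n) : (0 < p)%N -> x *+ p = 0 -> x = 0.
Proof.
move=> p0 e; apply/rowP => j; have := congr1 (fun M : 'rV[int]_n => M 0 j) e.
by rewrite mulmxnE !mxE => /eqP; rewrite Num.Theory.mulrn_eq0 eqn0Ngt p0 => /eqP.
Qed.

(** * What an equivalence between two gradings Gamma(H, t0) preserves *)

Section EquivalentOrbit.

Variables (F : closedFieldType) (H H' : finZmodType) (t0 : TH F H) (t0' : TH F H') (k k' : nat).
Hypotheses (H_neq0 : #|H|%:R != 0 :> F) (H'_neq0 : #|H'|%:R != 0 :> F).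
Hypotheses (k_gt0 : (0 < k)%N) (k'_gt0 : (0 < k')%N).
Hypotheses (t0_order : has_order2 t0) (t0'_order : has_order2 t0').
Local Notation E := (span_deg (@Gdeg F H k) (@GZ F H k)).
Local Notation E' := (span_deg (@Gdeg F H' k') (@GZ F H' k')).
Let dZ := GZ_dual k H_neq0.
Let dZ' := GZ_dual k' H'_neq0.

(** Elements of degree (p, 0) are combinations of the E_aa (x) X_p, and diagonal units commute; so
    beta can be read off from any nonzero product of such elements. *)
Lemma neutral_comm (p q : TH F H') a b : a \in E' (p, 0) -> b \in E' (q, 0) ->
  a *m b = beta p q *: (b *m a).
Proof.
move=> /memv_sumP[u uE ->] /memv_sumP[w wE ->].
rewrite mulmx_suml mulmx_sumr scaler_sumr; apply: eq_bigr => i ip.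
rewrite mulmx_suml mulmx_sumr scaler_sumr; apply: eq_bigr => j jq.
have /vlineP[x ->] := uE i ip; have /vlineP[y ->] := wE j jq.
have ZZ : GZ i *m GZ j = beta p q *: (GZ j *m GZ i).
  move: i j ip jq {x y uE wE u w a b} => [[a b] s] [[c d] r] /eqP[-> /eqP]; rewrite root_eq0.
  move=> /eqP<- /eqP[-> /eqP]; rewrite root_eq0 => /eqP<-.
  rewrite !GZM /= eq_sym; case: eqP => [->|_]; last by rewrite !mul0r !scale0r scaler0.
  by rewrite !mul1r scalerA addrC /beta -mulrA mulVf ?mulr1 // dual_neq0.
by rewrite -!scalemxAl -!scalemxAr ZZ !scalerA; congr (_ *: _); ring.
Qed.

Lemma Ydiag_neq0 (K : finZmodType) n (t : TH F K) : (0 < n)%N -> Ydiag n t != 0.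
Proof.
move=> n0; apply/eqP => Y0; have /matrixP := YdiagK n t; rewrite Y0 mul0mx.
have N0 : (0 < n * #|K|)%N by rewrite muln_gt0 n0; apply/card_gt0P; exists 0.
move=> /(_ (Ordinal N0) (Ordinal N0)); rewrite !mxE eqxx => /esym/eqP.
by rewrite mulr1n (negPf (dual_neq0 _ _)).
Qed.

Lemma equivalent_orbit :
  gradings_equivalent (kron_superalgebra t0 k) (@Gamma F H k)
    (kron_superalgebra t0' k') (@Gamma F H' k') ->
  exists f : TH F H -> TH F H', [/\ bijective f, forall u v, f (u + v) = f u + f v,
    forall u v, beta (f u) (f v) = beta u v & f t0 = t0'].
Proof.
rewrite !Gamma_span !kron_span => -[phi [alpha [[bphi phiM phiA] balpha phiE]]].
have phiI := bij_inj bphi.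
have [dE mE _] := superalgebra_grading_of_basis dZ (@GZ_degM F H k) (fun=> 0).
have [dE' mE' _] := superalgebra_grading_of_basis dZ' (@GZ_degM F H' k') (fun=> 0).
have phi1 : phi 1%:M = 1%:M.
  case: bphi => psi _ psiK; rewrite -[LHS]mulmx1 -{1}[1%:M in RHS]psiK -[X in _ *m X]psiK.
  by rewrite -phiM mul1mx psiK.
have Yne : 1%:M != 0 :> 'M[F]_(k' * #|H'|).
  by rewrite -Ydiag0 Ydiag_neq0.
have suppY (t : TH F H) : E (t, 0) != 0%VS.
  apply: contraTneq (mem_Ydiag k t) => ->; by rewrite memv0 Ydiag_neq0.
pose s (t : TH F H) : Defs.support E := exist (fun g => E g != 0%VS) (t, 0) (suppY t).
(* [f t] is the T-part of the degree matched with (t, 0); [deg0] shows that the rest of that degree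
   vanishes. *)
pose f t := (val (alpha (s t))).1.
have phiY0 t : phi (Ydiag k t) \in E' (val (alpha (s t))).
  by rewrite -phiE memv_img_inj // mem_Ydiag.
have one0 : 1%:M \in E' 0 by rewrite -Ydiag0 mem_Ydiag.
(* A power of 1 (x) X_t is a nonzero scalar, so a positive multiple of its degree is 0, and Z^k has
   no torsion. *)
have deg0 t : (val (alpha (s t))).2 = 0.
  have pow m : phi (Ydiag k (t *+ m)) \in E' (val (alpha (s t)) *+ m).
    elim: m => [|m IHm]; first by rewrite !mulr0n Ydiag0 phi1.
    rewrite !mulrS; have := mE' _ _ _ _ (phiY0 t) IHm; rewrite -phiM YdiagM linearZ /=.
    by move/(memvZ (t.2 (t *+ m).1)^-1); rewrite scalerA mulVf ?dual_neq0 // scale1r.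
  have := pow #|{: TH F H}|; rewrite finzmod_mulrn_card Ydiag0 phi1 => one1.
  have := homog_inj dE' one1 one0 Yne => /(congr1 snd) /=.
  rewrite (raddfMn (@snd _ _)) => /int_rV_torsionfree; apply; by apply/card_gt0P; exists 0.
have valE t : val (alpha (s t)) = (f t, 0).
  by rewrite [LHS]surjective_pairing deg0.
have phiY t : phi (Ydiag k t) \in E' (f t, 0) by rewrite -valE.
have Yphi t : phi (Ydiag k t) != 0.
  by apply: contra (Ydiag_neq0 t k_gt0) => /eqP e; rewrite -(inj_eq phiI) e linear0.
have YY u v : phi (Ydiag k u) *m phi (Ydiag k v) = u.2 v.1 *: phi (Ydiag k (u + v)).
  by rewrite -phiM YdiagM linearZ.
have YYne u v : phi (Ydiag k u) *m phi (Ydiag k v) != 0.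
  by rewrite YY scaler_eq0 negb_or dual_neq0 Yphi.
have fD u v : f (u + v) = f u + f v.
  have e1 := mE' _ _ _ _ (phiY u) (phiY v); rewrite YY in e1.
  have := homog_inj dE' e1 (memvZ _ (phiY (u + v))); rewrite -YY => /(_ (YYne u v)).
  by case=> <-.
have fbeta u v : beta (f u) (f v) = beta u v.
  have e1 := neutral_comm (phiY u) (phiY v).
  have e2 : phi (Ydiag k u) *m phi (Ydiag k v) = beta u v *: (phi (Ydiag k v) *m phi (Ydiag k u)).
    by rewrite !YY scalerA addrC /beta -mulrA mulVf ?mulr1 // dual_neq0.
  move: e1; rewrite e2 => /eqP; rewrite -subr_eq0 -scalerBl scaler_eq0 (negPf (YYne v u)) orbF.
  by rewrite subr_eq0 => /eqP.
have f0 : f 0 = 0 by apply: (addrI (f 0)); rewrite -fD !addr0.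
have fN u : f (- u) = - f u by apply: (addrI (f u)); rewrite -fD !subrr.
have fI : injective f.
  move=> u v uv; apply/eqP; rewrite -subr_eq0; apply/eqP; apply: (beta_nondegenerate H_neq0) => w.
  by rewrite -fbeta fD fN uv subrr /beta /= dual_zeroE dual0E invr1 mulr1.
(* The same torsion argument, applied to a preimage of 1 (x) X_t', shows that the degree (t', 0)
   comes from some (t, 0). *)
have fS t' : exists t, f t = t'.
  have supp' : E' (t', 0) != 0%VS.
    by apply: contraTneq (mem_Ydiag k' t') => ->; rewrite memv0 Ydiag_neq0.
  case: balpha => gamma _ gammaK.
  pose s' : Defs.support E' := exist (fun g => E' g != 0%VS) (t', 0) supp'.
  have := phiE (gamma s'); rewrite gammaK /=; set sg := gamma s' => phis.
  have := mem_Ydiag k' t'; rewrite -phis => /memv_imgP[y ys yE].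
  have pow m : exists2 z, z \in E (val sg *+ m) & phi z = Ydiag k' (t' *+ m).
    elim: m => [|m [z zs zE]].
      by exists 1%:M; rewrite ?phi1 mulr0n ?Ydiag0 // -(Ydiag0 F H k) mem_Ydiag.
    exists ((t'.2 (t' *+ m).1)^-1 *: (y *m z)).
      by rewrite memvZ // mulrS mE.
    by rewrite linearZ /= phiM -yE zE YdiagM scalerA mulVf ?dual_neq0 // scale1r mulrS.
  have [z] := pow #|{: TH F H'}|; rewrite finzmod_mulrn_card Ydiag0 -phi1 => zs /phiI z1.
  have one_E0 : 1%:M \in E 0 by rewrite -Ydiag0 mem_Ydiag.
  have onene : 1%:M != 0 :> 'M[F]_(k * #|H|) by rewrite -Ydiag0 Ydiag_neq0.
  rewrite z1 in zs; have /(congr1 snd) := homog_inj dE zs one_E0 onene.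
  rewrite /= (raddfMn (@snd _ _)) => /int_rV_torsionfree sg0.
  have {}sg0 : (val sg).2 = 0 by apply: sg0; apply/card_gt0P; exists 0.
  exists (val sg).1.
  have sgE : sg = s (val sg).1.
    by apply: val_inj; rewrite /= [LHS]surjective_pairing sg0.
  by rewrite /f -sgE gammaK.
have f_bij : bijective f.
  apply: inj_card_bij => //; rewrite -(card_codom fI) ; apply/subset_leq_card/subsetP => t' _.
  by have [t <-] := fS t'; apply: codom_f.
(* [phi] preserves parity and maps 1 (x) X_t into degree (f t, 0), whose elements all have the
   parity of f t. *)
have parE t : parity t0' (f t) = parity t0 t.
  have dk' : direct_decomposition (span_deg (@Gpar F H' t0' k') (@GZ F H' k')).
    exact: span_deg_direct dZ'.
  apply: (homog_inj dk' (v := phi (Ydiag k t))) => //; last first.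
    by rewrite -phiA memv_img_inj // mem_Ydiag_par.
  have /memv_sumP[w wE ->] := phiY t; apply: memv_suml => x /[dup] /eqP xt.
  move=> /wE/vlineP[b ->]; rewrite memvZ //.
  by have := memv_span_deg (@Gpar F H' t0' k') (@GZ F H' k') x; case: xt => <-.
(* All values of beta(t0, .) and beta(t0', .) are 1 or -1, so equal parities make f t0 - t0'
   orthogonal to everything. *)
exists f; split=> //; apply/eqP; rewrite -subr_eq0; apply/eqP.
apply: (beta_nondegenerate H'_neq0) => t'; have [t <-] := fS t'.
have bN (u v : TH F H') : beta (- u) v = (beta u v)^-1.
  by apply: (mulIf (beta_neq0 u v)); rewrite -betaDl addNr mulVf ?beta_neq0 // /beta /=
     dual_zeroE dual0E invr1 mulr1.
rewrite betaDl bN fbeta.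
have := parE t; rewrite /parity.
have [->|b1] := eqVneq (beta t0' (f t)) 1; have [->|b2] := eqVneq (beta t0 t) 1;
  rewrite ?divff ?oner_eq0 // => _.
rewrite (sqr1_neq1 (beta_t0_sq t0_order _) b2) (sqr1_neq1 (beta_t0_sq t0'_order _) b1).
by rewrite divff // oppr_eq0 oner_eq0.
Qed.

End EquivalentOrbit.

(** * Recovering H from T_H *)

Section Powers.

Import GroupScope.
Local Open Scope group_scope.

Definition powers (gT : finGroupType) (m : nat) (A : {set gT}) : {set gT} :=
  [set x ^+ m | x in A].

Lemma mem_powers (gT : finGroupType) m (A : {set gT}) x : x \in A -> x ^+ m \in powers m A.
Proof. exact: imset_f. Qed.

Lemma powers_cycle (gT : finGroupType) m (x : gT) : powers m <[x]> = <[x ^+ m]>.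
Proof.
apply/setP=> y; apply/imsetP/cycleP => [[_ /cycleP[i ->] ->]|[i ->]].
  by exists i; rewrite -!expgM mulnC.
by exists (x ^+ i); rewrite ?mem_cycle // -!expgM mulnC.
Qed.

Lemma card_powers_dprod (gT : finGroupType) m (A B G : {group gT}) :
  A \x B = G -> #|powers m G| = (#|powers m A| * #|powers m B|)%N.
Proof.
case/dprodP=> _ defG cAB tiAB; rewrite -cardsX.
have powAB a b : a \in A -> b \in B -> (a * b) ^+ m = a ^+ m * b ^+ m.
  by move=> aA bB; rewrite expgMn //; apply/esym/(centsP cAB).
have -> : powers m G = [set p.1 * p.2 | p in setX (powers m A) (powers m B)].
  apply/setP=> y; apply/imsetP/imsetP => [[x]|[[u v]]].
    rewrite -defG => /mulsgP[a b aA bB ->] ->; exists (a ^+ m, b ^+ m); last exact: powAB.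
    by rewrite inE /= !mem_powers.
  rewrite inE => /andP[/= /imsetP[a aA ->] /imsetP[b bB ->]] ->.
  by exists (a * b); rewrite ?powAB // -defG mem_mulg.
rewrite card_in_imset // => -[u v] [u' v']; rewrite !inE /=.
move=> /andP[/imsetP[a aA ->] /imsetP[b bB ->]] /andP[/imsetP[a' aA' ->] /imsetP[b' bB' ->]] e.
have e1 : (a' ^+ m)^-1 * a ^+ m = b' ^+ m * (b ^+ m)^-1.
  by apply: (mulIg (b ^+ m)); rewrite mulgKV -mulgA e mulKg.
have : (a' ^+ m)^-1 * a ^+ m \in A :&: B.
  by rewrite inE {2}e1 !groupM ?groupV ?groupX.
rewrite tiAB inE => /eqP e2; rewrite e2 in e1.
congr (_, _); first by apply: (mulgI (a' ^+ m)^-1); rewrite e2 mulVg.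
by apply: (mulIg (b ^+ m)^-1); rewrite mulgV e1.
Qed.

Lemma card_powers_eq1 (gT : finGroupType) m (G : {group gT}) :
  (#|powers m G| == 1%N) = (exponent G %| m)%N.
Proof.
have one : 1 \in powers m G by apply/imsetP; exists 1; rewrite ?expg1n.
apply/cards1P/exponentP => [[x xE] y yG|e1].
  move: one; rewrite xE inE => /eqP x1.
  have : y ^+ m \in powers m G by apply: mem_powers.
  by rewrite xE inE -x1 => /eqP.
exists 1; apply/setP=> y; rewrite inE; apply/imsetP/eqP => [[x xG ->]|->].
  exact: e1.
by exists 1; rewrite ?expg1n.
Qed.

(* Split off a cyclic factor whose order is the exponent. *)
Lemma isog_of_card_powers (gT rT : finGroupType) (G : {group gT}) (K : {group rT}) :
  abelian G -> abelian K -> (forall m, #|powers m G| = #|powers m K|) -> G \isog K.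
Proof.
have [n] := ubnP #|G|; elim: n => // n IHn in G K * => ltGn abG abK eqGK.
(* The exponent is visible in the counts: there is a single m-th power exactly when the exponent
   divides m. *)
have eqe : exponent G = exponent K.
  by apply/eqP; rewrite eqn_dvd -card_powers_eq1 eqGK card_powers_eq1 dvdnn
    -card_powers_eq1 -eqGK card_powers_eq1 dvdnn.
have powers1 (hT : finGroupType) (A : {group hT}) : powers 1 A = A.
  by apply/setP=> y; apply/imsetP/idP => [[x xA ->]|yA]; [rewrite expg1 | exists y].
have cardGK : #|G| = #|K| by have := eqGK 1%N; rewrite !powers1.
have [x xG ox] := exponent_witness (abelian_nil abG).
have [y yK oy] := exponent_witness (abelian_nil abK).
have [G1|G1] := eqVneq (#|G|) 1%N.
  have K1 : #|K| = 1%N by rewrite -cardGK.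
  have cG : cyclic G by rewrite (card1_trivg G1) cyclic1.
  by rewrite (isog_cyclic_card _ cG) (card1_trivg K1) cyclic1 cards1 G1.
have split_dprod (hT : finGroupType) (A : {group hT}) z : abelian A -> z \in A ->
    exponent A = #[z] -> exists B : {group hT}, <[z]> \x B = A.
  move=> abA zA oz; have /splitsP[B /complP[tiB defA]] := abelian_splits zA (esym oz) abA.
  exists B; rewrite dprodE //; apply: sub_abelian_cent2 abA _ _; rewrite -defA ?mulG_subl //.
  exact: mulG_subr.
have [A defG] := split_dprod _ _ _ abG xG ox.
have [B defK] := split_dprod _ _ _ abK yK oy.
have sAG : A \subset G by case/dprodP: defG => _ <- _ _; apply: mulG_subr.
have sBK : B \subset K by case/dprodP: defK => _ <- _ _; apply: mulG_subr.
have oxy : #[x] = #[y] by rewrite -ox eqe.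
have exG1 : (1 < #[x])%N.
  rewrite -ox ltn_neqAle exponent_gt0 andbT eq_sym; apply: contra G1 => /eqP e1.
  by rewrite -trivg_card1 trivg_exponent e1.
apply: (isog_dprod defG defK).
  by rewrite isog_cyclic_card ?cycle_cyclic //= -/(#[x]) -/(#[y]) oxy.
apply: IHn; [|exact: abelianS abG|exact: abelianS abK|move=> m].
  rewrite -(dprod_card defG) in ltGn; rewrite -ltnS; apply: leq_trans ltGn; rewrite ltnS.
  by rewrite -[X in (X < _)%N]mul1n ltn_pmul2r ?cardG_gt0.
(* The cyclic factors have equal nonzero counts, so these cancel and the complements satisfy the
   hypothesis again. *)
have := eqGK m; rewrite (card_powers_dprod m defG) (card_powers_dprod m defK).
rewrite !powers_cycle -!orderE !orderXgcd oxy => /eqP.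
rewrite eqn_pmul2l => [/eqP //|]; rewrite divn_gt0 ?gcdn_gt0 ?order_gt0 //.
by rewrite dvdn_leq ?order_gt0 // dvdn_gcdl.
Qed.

End Powers.

Definition multiples (T : finZmodType) (m : nat) : {set T} := [set x *+ m | x : T].

Lemma mem_multiples (T : finZmodType) m (x : T) : x *+ m \in multiples T m.
Proof. exact: imset_f. Qed.

Lemma powers_multiples (T : finZmodType) m : powers m [set: T] = multiples T m.
Proof.
apply/setP=> y; apply/imsetP/imsetP => -[x _ ->]; exists x; rewrite ?inE //.
Qed.

Lemma multiples_sub (T : finZmodType) m x y :
  x \in multiples T m -> y \in multiples T m -> x - y \in multiples T m.
Proof. by move=> /imsetP[a _ ->] /imsetP[b _ ->]; rewrite -mulrnBl mem_multiples. Qed.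

Lemma card_multiples_dvd (T : finZmodType) m : (#|multiples T m| %| #|T|)%N.
Proof.
have gM : group_set (multiples T m).
  apply/group_setP; split; first by apply/imsetP; exists 0; rewrite ?mul0rn.
  move=> x y xm ym; have := multiples_sub xm (multiples_sub (multiples_sub xm xm) ym).
  by rewrite subrr sub0r opprK.
by rewrite -cardsT; apply: (cardSg (subsetT (Group gM))).
Qed.

Lemma card_multiples_neq0 (F : fieldType) (T : finZmodType) m :
  #|T|%:R != 0 :> F -> #|multiples T m|%:R != 0 :> F.
Proof.
by apply: contraNneq => e; have /dvdnP[q ->] := card_multiples_dvd T m; rewrite natrM e mulr0.
Qed.

Section CardMultiples.

Variables (F : closedFieldType).

(* A pairing separating the points of both arguments identifies the
   multiples [psi *+ m] with distinct characters of [multiples A m]. *)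
Lemma card_multiples_pairing_le (A B : finZmodType) (p : A -> B -> F) m :
  #|A|%:R != 0 :> F -> (forall a b, p a b != 0) ->
  (forall a a' b, p (a + a') b = p a b * p a' b) ->
  (forall a b b', p a (b + b') = p a b * p a b') ->
  (forall b b', (forall a, p a b = p a b') -> b = b') ->
  (#|multiples B m| <= #|multiples A m|)%N.
Proof.
move=> A0 p0 pDl pDr pI.
(* Multiples move across the pairing, so the character attached to b, restricted to the m-th
   multiples in A, depends only on [b *+ m]. *)
have pn a b n : p (a *+ n) b = p a (b *+ n).
  elim: n => [|n IHn]; last by rewrite !mulrS pDl pDr IHn.
  by rewrite !mulr0n; apply: (mulfI (p0 a b)); apply: (mulfI (p0 0 b));
     rewrite -pDr addr0 mulrA -[in LHS]pDl add0r [LHS]mulrC -pDl !add0r.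
have rep (z : {x | x \in multiples B m}) : exists b, val z == b *+ m.
  by have /imsetP[b _ e] := valP z; exists b; apply/eqP.
have repP z : val z = xchoose (rep z) *+ m := eqP (xchooseP (rep z)).
rewrite -[X in (X <= _)%N]card_sig.
apply: (@card_chars_le F A (multiples A m) _ (fun z a => p a (xchoose (rep z)))) => //.
- exact: multiples_sub.
- exact: card_multiples_neq0.
- move=> i j e; apply: val_inj; rewrite (repP i) (repP j); apply: pI => a.
  by rewrite -!pn; apply: e; apply: mem_multiples.
Qed.

Lemma card_multiples_dual (H : finZmodType) m : #|H|%:R != 0 :> F ->
  #|multiples (dual F H) m| = #|multiples H m|.
Proof.
move=> H0; apply/eqP; rewrite eqn_leq; apply/andP; split.
  apply: (@card_multiples_pairing_le H (dual F H) (fun x chi => chi x)) => // [a b|a a' b|a b b'|b b' e].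
  - exact: dual_neq0.
  - exact: dualDE.
  - exact: dual_addE.
  - exact: dual_eqP.
apply: (@card_multiples_pairing_le (dual F H) H (fun chi x => chi x)) => [|a b|a a' b|a b b'|b b' e].
- by rewrite card_dual.
- exact: dual_neq0.
- exact: dual_addE.
- exact: dualDE.
- apply/eqP/contraT; rewrite -subr_eq0 => /(dual_separates H0)[chi] /eqP[].
  have := dualDE chi (b - b') b'; rewrite subrK e => e'.
  by apply: (mulIf (dual_neq0 chi b')); rewrite -e' mul1r.
Qed.

(** An isomorphism of T_H onto T_H' need not respect the factors H and H', so the argument passes
    through counts that determine a finite abelian group up to isomorphism. *)
Lemma groups_isomorphic_of_TH (H H' : finZmodType) (f : TH F H -> TH F H') :
  #|H|%:R != 0 :> F -> #|H'|%:R != 0 :> F -> bijective f ->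
  (forall u v, f (u + v) = f u + f v) -> groups_isomorphic H H'.
Proof.
move=> H0 H'0 f_bij fD.
have fn u n : f (u *+ n) = f u *+ n.
  by elim: n => [|n IHn]; [apply: (addrI (f 0)); rewrite -fD !addr0 | rewrite !mulrS fD IHn].
have cardTH (K : finZmodType) m : #|K|%:R != 0 :> F ->
    #|multiples (TH F K) m| = (#|multiples K m| ^ 2)%N.
  move=> K0; rewrite expnS expn1 -{2}(card_multiples_dual m K0) -cardsX.
  apply: eq_card => -[x chi]; rewrite inE /=; apply/imsetP/andP => [[[y psi] _ e]|].
    have -> : x = y *+ m by rewrite -[x]/((x, chi).1) e (raddfMn (@fst _ _)).
    have -> : chi = psi *+ m by rewrite -[chi]/((x, chi).2) e (raddfMn (@snd _ _)).
    by rewrite !mem_multiples.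
  case=> /imsetP[y _ ->] /imsetP[psi _ ->]; exists (y, psi) => //.
  by rewrite [RHS]surjective_pairing (raddfMn (@fst _ _)) (raddfMn (@snd _ _)).
have eqm m : #|multiples H m| = #|multiples H' m|.
  have : #|multiples (TH F H) m| = #|multiples (TH F H') m|.
    rewrite -(card_imset _ (bij_inj f_bij)); apply: eq_card => y.
    case: f_bij => g fK gK; apply/imsetP/imsetP => [[_ /imsetP[x _ ->] ->]|[x _ ->]].
      by exists (f x).
    by exists (g x *+ m); rewrite ?mem_multiples // fn gK.
  by rewrite !cardTH // => /eqP; rewrite eqn_exp2r // => /eqP.
have abT (T : finZmodType) : abelian [set: T].
  by apply/centsP => x _ y _; apply: addrC.
have /isogP[g gI gE] : [set: H]%G \isog [set: H']%G.
  by apply: isog_of_card_powers => [||m]; [apply: abT | apply: abT | rewrite !powers_multiples eqm].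
have gD : {morph g : x y / x + y}.
  by move=> x y; have := morphM g (in_setT x) (in_setT y).
have g0 : g 0 = 0 by apply: (addrI (g 0)); rewrite -gD !addr0.
pose gA : {additive H -> H'} := HB.pack (fun x => g x) (GRing.isNmodMorphism.Build H H' (fun x => g x) (conj g0 gD)).
exists gA; apply: inj_card_bij.
  by move=> x y /=; apply: (injmP gI); rewrite inE.
have mul1 (T : finZmodType) : multiples T 1 = setT.
  by apply/setP=> x; rewrite inE; apply/imsetP; exists x.
by have := eqm 1%N; rewrite !mul1 !cardsT => ->.
Qed.

End CardMultiples.

(** * Symplectic decomposition of finite abelian groups *)

Section SubFinZmod.

Variables (G : zmodType) (s : seq G).

(** The closure proofs are arguments so that the additive structure can be attached to this type. *)
Definition sub_zmod of 0 \in s & (forall x y, x \in s -> y \in s -> x - y \in s) := seq_sub s.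

Hypotheses (s0 : 0 \in s) (sB : forall x y, x \in s -> y \in s -> x - y \in s).
Local Notation S := (sub_zmod s0 sB).

HB.instance Definition _ := Finite.on S.
HB.instance Definition _ := SubType.on S.

Let sN x : x \in s -> - x \in s.
Proof. by rewrite -sub0r; apply: sB. Qed.
Let sD x y : x \in s -> y \in s -> x + y \in s.
Proof. by move=> xs ys; rewrite -[y]opprK; apply/sB/sN. Qed.

Let zero : S := SeqSub s0.
Let opp (x : S) : S := SeqSub (sN (valP x)).
Let add (x y : S) : S := SeqSub (sD (valP x) (valP y)).

Fact sub_addA : associative add. Proof. by move=> x y z; apply/val_inj/addrA. Qed.
Fact sub_addC : commutative add. Proof. by move=> x y; apply/val_inj/addrC. Qed.
Fact sub_add0 : left_id zero add. Proof. by move=> x; apply/val_inj/add0r. Qed.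
Fact sub_addN : left_inverse zero opp add. Proof. by move=> x; apply/val_inj/addNr. Qed.

HB.instance Definition _ := GRing.isZmodule.Build S sub_addA sub_addC sub_add0 sub_addN.

End SubFinZmod.

Lemma finzmod_of_seq (G : zmodType) (s : seq G) : 0 \in s ->
  (forall x y, x \in s -> y \in s -> x - y \in s) ->
  exists (T : finZmodType) (i : T -> G), [/\ injective i,
    forall x y, i (x + y) = i x + i y & forall x, x \in s <-> exists t, i t = x].
Proof.
move=> s0 sB; exists (sub_zmod s0 sB), val; split=> // [|x]; first exact: val_inj.
by split=> [xs|[t <-]]; [exists (SeqSub xs) | apply: valP].
Qed.

Definition subgroup_closed (T : finZmodType) (A : {set T}) : Prop :=
  0 \in A /\ forall x y, x \in A -> y \in A -> x - y \in A.

Section SubgroupClosed.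

Variables (T : finZmodType) (A : {set T}).
Hypothesis cA : subgroup_closed A.

Lemma subgroup_closedN x : x \in A -> - x \in A.
Proof. by move=> xA; rewrite -sub0r; apply: cA.2 xA; apply: cA.1. Qed.

Lemma subgroup_closedD x y : x \in A -> y \in A -> x + y \in A.
Proof. by move=> xA yA; rewrite -[y]opprK; apply: cA.2 xA _; apply: subgroup_closedN. Qed.

Lemma subgroup_closedMn x n : x \in A -> x *+ n \in A.
Proof.
by move=> xA; elim: n => [|n IHn]; [apply: cA.1 | rewrite mulrS; apply: subgroup_closedD].
Qed.

Lemma subgroup_closed_group : group_set A.
Proof. by apply/group_setP; split; [apply: cA.1 | apply: subgroup_closedD]. Qed.

Lemma card_subgroup_dvd : (#|A| %| #|T|)%N.
Proof. by rewrite -cardsT; apply: (cardSg (subsetT (Group subgroup_closed_group))). Qed.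

Lemma add_multiples_closed a : exists B : {set T}, subgroup_closed B /\
  forall x, x \in B <-> exists2 u, u \in A & exists n : nat, x = u + a *+ n.
Proof.
pose B := [set p.1 + p.2 | p in setX A [set a *+ (i : nat) | i : 'I_#|T|]].
have T0 : (0 < #|T|)%N by apply/card_gt0P; exists 0.
have modT n : a *+ n = a *+ (n %% #|T|).
  by rewrite {1}(divn_eq n #|T|) mulrnDr mulnC mulrnA finzmod_mulrn_card mul0rn add0r.
have memB x : x \in B <-> exists2 u, u \in A & exists n : nat, x = u + a *+ n.
  split=> [/imsetP[[u v]]|[u uA [n ->]]].
    by rewrite inE => /andP[/= uA /imsetP[i _ ->]] ->; exists u => //; exists i.
  have ltn : (n %% #|T| < #|T|)%N by rewrite ltn_mod.
  apply/imsetP; exists (u, a *+ n) => //; rewrite inE uA /=.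
  by apply/imsetP; exists (Ordinal ltn); rewrite //= modT.
exists B; split=> //; split=> [|x y].
  by apply/memB; exists 0; [apply: cA.1 | exists 0%N; rewrite addr0].
move=> /memB[u uA [n ->]] /memB[v vA [m ->]]; apply/memB; exists (u - v); first exact: cA.2.
(* Here - m a is written as m (#|T| - 1) a, which keeps the multiplier a natural number. *)
exists (n + m * #|T|.-1)%N; rewrite opprD addrACA; congr (_ + _).
rewrite mulrnDr; congr (_ + _); apply/eqP; rewrite eq_sym -addr_eq0 -mulrnDr.
have -> : ((m * #|T|.-1) + m = #|T| * m)%N by rewrite addnC -mulnS prednK // mulnC.
by rewrite mulrnA finzmod_mulrn_card mul0rn.
Qed.

End SubgroupClosed.

(** * Alternating bicharacters, hyperbolic pairs and Lagrangian subgroups *)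

Section Symplectic.

Variables (F : closedFieldType) (T : finZmodType) (b : T -> T -> F).
Hypotheses (b_neq0 : forall x y, b x y != 0) (bDl : forall x y z, b (x + y) z = b x z * b y z)
  (bDr : forall x y z, b x (y + z) = b x y * b x z) (b_alt : forall x, b x x = 1).

Lemma bichar0l y : b 0 y = 1.
Proof. by apply: (mulfI (b_neq0 0 y)); rewrite -bDl addr0 mulr1. Qed.

Lemma bichar0r x : b x 0 = 1.
Proof. by apply: (mulfI (b_neq0 x 0)); rewrite -bDr addr0 mulr1. Qed.

Lemma bicharC x y : b x y * b y x = 1.
Proof. by have := b_alt (x + y); rewrite bDl !bDr !b_alt mul1r mulr1. Qed.

Lemma bicharV x y : b y x = (b x y)^-1.
Proof. by apply: (mulfI (b_neq0 x y)); rewrite bicharC divff. Qed.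

Lemma bicharNl x y : b (- x) y = (b x y)^-1.
Proof. by apply: (mulfI (b_neq0 x y)); rewrite -bDl subrr bichar0l divff. Qed.

Lemma bicharNr x y : b x (- y) = (b x y)^-1.
Proof. by apply: (mulfI (b_neq0 x y)); rewrite -bDr subrr bichar0r divff. Qed.

Lemma bicharMl x y n : b (x *+ n) y = b x y ^+ n.
Proof. by elim: n => [|n IHn]; [apply: bichar0l | rewrite mulrS exprS bDl IHn]. Qed.

Lemma bicharMr x y n : b x (y *+ n) = b x y ^+ n.
Proof. by elim: n => [|n IHn]; [apply: bichar0r | rewrite mulrS exprS bDr IHn]. Qed.

Definition nondegenerate_on (Q : {set T}) :=
  forall x, x \in Q -> (forall y, y \in Q -> b x y = 1) -> x = 0.

(** Take a of maximal order in Q and z whose class has maximal order m modulo the kernel of b(a, .).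
    All b(a, w) are m-th roots of unity, so m a = 0 by nondegeneracy; hence m is a multiple of the
    exponent of Q and kills z as well. *)
Lemma hyperbolic_pair (Q : {set T}) : subgroup_closed Q -> nondegenerate_on Q ->
  (exists2 x, x \in Q & x != 0) -> exists a z m, [/\ a \in Q, z \in Q, (1 < m)%N,
    m.-primitive_root (b a z) & forall w, w \in Q -> b a w ^+ m = 1 /\ b w z ^+ m = 1].
Proof.
move=> cQ nQ [x0 x0Q x00]; pose G := Group (subgroup_closed_group cQ).
have abG : abelian G by apply/centsP => x _ y _; apply: addrC.
have [a aG ea] := exponent_witness (abelian_nil abG).
have gK : group_set [set w in Q | b a w == 1].
  apply/group_setP; split; first by rewrite inE cQ.1 bichar0r eqxx.
  move=> u v; rewrite !inE => /andP[uQ /eqP bu] /andP[vQ /eqP bv].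
  by rewrite (subgroup_closedD cQ) //= bDr bu bv mulr1.
pose K := Group gK.
have nKG : G \subset 'N(K)%g.
  by apply: sub_abelian_norm abG _; apply/subsetP => w; rewrite inE => /andP[].
have abGK : abelian (G / K)%g by apply: quotient_abelian.
have [zb zbG ez] := exponent_witness (abelian_nil abGK).
case/morphimP: zbG ez => z zN zG -> ez.
pose m := #[coset K z]%g.
have powK w n : w \in Q -> (coset K w ^+ n == 1)%g = (b a w ^+ n == 1).
  move=> wQ; have wN : w \in 'N(K)%g by apply: (subsetP nKG).
  rewrite -morphX //= -bicharMr.
  have wnN : (w ^+ n \in 'N(K))%g by rewrite groupX.
  apply/eqP/eqP => [/(coset_idr wnN)|e]; first by rewrite inE => /andP[_ /eqP].
  by apply: coset_id; rewrite inE (subgroup_closedMn cQ) //=; apply/eqP.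
have bm w : w \in Q -> b a w ^+ m = 1.
  move=> wQ; apply/eqP; rewrite -powK //.
  have : (exponent (G / K) %| m)%N by rewrite ez.
  by move/exponentP => -> //; apply: mem_quotient.
have am0 : a *+ m = 0.
  by apply: nQ => [|y yQ]; rewrite ?(subgroup_closedMn cQ) // bicharMl bm.
have em : (#[a]%g %| m)%N by rewrite order_dvdn -[(a ^+ m)%g]/(a *+ m) am0.
have zm0 : z *+ m = 0.
  have : (exponent G %| m)%N by rewrite ea.
  by move/exponentP => /(_ z zG).
have m0 : (0 < m)%N by apply: order_gt0.
have pr : m.-primitive_root (b a z).
  have [p pr pm] := prim_order_exists m0 (bm z zG).
  have /eqP : b a z ^+ p = 1 by apply: prim_expr_order pr.
  rewrite -powK // -order_dvdn -/m => mp.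
  by rewrite (_ : m = p) //; apply/eqP; rewrite eqn_dvd mp pm.
exists a, z, m; split=> //.
  rewrite ltn_neqAle m0 andbT; apply: contra x00 => /eqP m1.
  have : (exponent G %| 1)%N by rewrite ea m1.
  by move/exponentP => /(_ x0 x0Q)/eqP; rewrite expg1.
by move=> w wQ; rewrite bm // -bicharMr zm0 bichar0r.
Qed.

Definition isotropic_subgroup (Q A : {set T}) :=
  [/\ subgroup_closed A, A \subset Q & forall x y, x \in A -> y \in A -> b x y = 1].

(* Split off hyperbolic pairs of maximal order one after the other. *)
Lemma lagrangian_decomposition (Q : {set T}) : subgroup_closed Q -> nondegenerate_on Q ->
  exists A B : {set T}, [/\ isotropic_subgroup Q A, isotropic_subgroup Q B &
    forall x, x \in Q -> exists2 u, u \in A & exists2 v, v \in B & x = u + v].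
Proof.
have [n] := ubnP #|Q|; elim: n => // n IHn in Q * => ltQn cQ nQ.
have [[x0 x0Q x00]|triv] : (exists2 x, x \in Q & x != 0) \/ (forall x, x \in Q -> x = 0).
  have [/exists_inP[x xQ x0]|/exists_inPn e] := boolP [exists x in Q, x != 0].
    by left; exists x.
  by right=> x /e; rewrite negbK => /eqP.
  2: {
  have i0 : isotropic_subgroup Q [set 0].
    split; last by move=> x y; rewrite !inE => /eqP-> /eqP->; rewrite bichar0l.
      by split=> [|x y]; rewrite !inE // => /eqP-> /eqP->; rewrite subr0.
    by rewrite sub1set cQ.1.
  exists [set 0], [set 0]; split=> // x /triv->.
  by exists 0; rewrite ?inE //; exists 0; rewrite ?inE ?addr0. }
have [|a [z [m [aQ zQ m1 pr bm]]]] := hyperbolic_pair cQ nQ; first by exists x0.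
pose Q' := [set w in Q | (b a w == 1) && (b w z == 1)].
have az1 : b a z != 1.
  apply: contraL m1 => /eqP e; have := prim_order_dvd pr 1; rewrite expr1 e eqxx.
  by rewrite dvdn1 => /eqP->.
have cQ' : subgroup_closed Q'.
  split=> [|x y]; rewrite !inE ?bichar0l ?bichar0r ?eqxx ?cQ.1 //.
  move=> /and3P[xQ /eqP x1 /eqP x2] /and3P[yQ /eqP y1 /eqP y2].
  by rewrite cQ.2 // bDl bDr bicharNl bicharNr x1 x2 y1 y2 invr1 mulr1 eqxx.
(* b(a, z) is a primitive m-th root of unity, so b(a, w) and b(w, z) are powers of it; subtracting
   the matching multiples of z and a lands in the orthogonal complement [Q']. *)
have dec w : w \in Q -> exists i j : nat, exists2 w', w' \in Q' & w = w' + (a *+ i + z *+ j).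
  move=> wQ; have [ba bz] := bm w wQ.
  have [j ej] := prim_rootP pr ba; have [i ei] := prim_rootP pr bz.
  exists i, j, (w - (a *+ i + z *+ j)); last by rewrite subrK.
  rewrite !inE cQ.2 ?(subgroup_closedD cQ) ?(subgroup_closedMn cQ) //=.
  rewrite bDr bDl bicharNl bicharNr bDr bDl !bicharMr !bicharMl !b_alt !expr1n mul1r mulr1.
  by rewrite ej ei !divff ?expf_neq0 ?eqxx.
have ltQ' : (#|Q'| < #|Q|)%N.
  apply: proper_card; apply/properP; split; first by apply/subsetP => w; rewrite inE => /andP[].
  by exists a; rewrite // !inE aQ b_alt eqxx.
have nQ' : nondegenerate_on Q'.
  move=> x; rewrite inE => /and3P[xQ /eqP xa /eqP xz] x1; apply: nQ => // y /dec[i [j [y' y'Q ->]]].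
  by rewrite !bDr x1 // !bicharMr xz bicharV xa invr1 !expr1n !mulr1.
have [A' [B' [[cA' sA' iA'] [cB' sB' iB'] AB']]] := IHn Q' (leq_trans ltQ' ltQn) cQ' nQ'.
have [A [cA memA]] := add_multiples_closed cA' a.
have [B [cB memB]] := add_multiples_closed cB' z.
exists A, B; split.
- split=> // [|x y]; first apply/subsetP => x.
    case/memA => u /(subsetP sA'); rewrite inE => /andP[uQ _] [i ->].
    by rewrite (subgroup_closedD cQ) ?(subgroup_closedMn cQ).
  case/memA => u uA [i ->] /memA[v vA [j ->]].
  have := subsetP sA' _ uA; rewrite inE => /and3P[_ /eqP au _].
  have := subsetP sA' _ vA; rewrite inE => /and3P[_ /eqP av _].
  by rewrite !bDl !bDr !(bicharMl, bicharMr) b_alt av (bicharV a u) au iA' // invr1 !expr1n !mulr1.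
- split=> // [|x y]; first apply/subsetP => x.
    case/memB => u /(subsetP sB'); rewrite inE => /andP[uQ _] [i ->].
    by rewrite (subgroup_closedD cQ) ?(subgroup_closedMn cQ).
  case/memB => u uA [i ->] /memB[v vA [j ->]].
  have := subsetP sB' _ uA; rewrite inE => /and3P[_ _ /eqP au].
  have := subsetP sB' _ vA; rewrite inE => /and3P[_ _ /eqP av].
  by rewrite !bDl !bDr !(bicharMl, bicharMr) b_alt au (bicharV v z) av iB' // invr1 !expr1n !mulr1.
move=> x /dec[i [j [w /AB'[u uA [v vB ->]] ->]]].
exists (u + a *+ i); first by apply/memA; exists u => //; exists i.
exists (v + z *+ j); first by apply/memB; exists v => //; exists j.
by rewrite addrACA.
Qed.

Hypothesis b_nondeg : forall x, (forall y, b x y = 1) -> x = 0.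

(** An element x of order p = char F would satisfy b(x, y)^p = 1, and injectivity of the Frobenius
    map gives b(x, y) = 1 for all y. *)
Lemma nondegenerate_card_neq0 : #|T|%:R != 0 :> F.
Proof.
rewrite natf_neq0_pchar; apply/pnatP => [|p pr_p pT]; first by apply/card_gt0P; exists 0.
rewrite inE /=; apply/negP => pF.
have [x _ xp] : {x | x \in [set: T] & #[x]%g = p} by apply: Cauchy => //; rewrite cardsT.
have x0 : x = 0.
  apply: b_nondeg => y; apply: (fmorph_inj (pFrobenius_aut pF)).
  rewrite /= !pFrobenius_autE expr1n -bicharMl -xp.
  have e : x *+ #[x]%g = 0 by apply: expg_order.
  by rewrite e bichar0l.
by have := prime_gt1 pr_p; rewrite -xp x0; have -> : #[0 : T]%g = 1%N by apply: order1.
Qed.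

(* Coordinates in [T = A + B], with [A] Lagrangian and [B] acting on it by characters. *)
Lemma symplectic_classification : exists K : finZmodType,
  [/\ #|K|%:R != 0 :> F, #|T| = (#|K| ^ 2)%N &
  forall H : finZmodType, groups_isomorphic K H -> exists f : T -> TH F H,
   [/\ bijective f, forall u v, f (u + v) = f u + f v &
      forall u v, beta (f u) (f v) = b u v]].
Proof.
have cT : subgroup_closed [set: T] by split=> [|x y]; rewrite !inE.
have nT : nondegenerate_on [set: T] by move=> x _ x1; apply: b_nondeg => y; apply: x1; rewrite inE.
have [A [B [[cA _ iA] [cB _ iB] AB]]] := lagrangian_decomposition cT nT.
have decT x : exists2 u, u \in A & exists2 v, v \in B & x = u + v by apply: AB; rewrite inE.
have orthA x : x \in A -> (forall y, y \in B -> b x y = 1) -> x = 0.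
  move=> xA x1; apply: b_nondeg => y; have [u uA [v vB ->]] := decT y.
  by rewrite bDr iA // x1 // mulr1.
have orthB x : x \in B -> (forall y, y \in A -> b x y = 1) -> x = 0.
  move=> xB x1; apply: b_nondeg => y; have [u uA [v vB ->]] := decT y.
  by rewrite bDr x1 // iB // mulr1.
have neq0 (C : {set T}) : subgroup_closed C -> #|C|%:R != 0 :> F.
  move=> cC; have := nondegenerate_card_neq0; have /dvdnP[q ->] := card_subgroup_dvd cC.
  by rewrite natrM mulf_eq0 negb_or => /andP[].
(* A is isotropic and A + B is everything, so B separates the points of A, and the rank bound for
   characters compares the orders. *)
have leAB : (#|A| <= #|B|)%N.
  rewrite -[X in (X <= _)%N]card_sig.
  apply: (@card_chars_le F T B _ (fun z y => b (val z) y)) => //; [exact: cB.2 | exact: neq0 |].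
  move=> i j e; apply/val_inj/eqP; rewrite -subr_eq0; apply/eqP/orthA.
    by apply: cA.2; apply: valP.
  by move=> y yB; rewrite bDl bicharNl e // divff.
have leT : (#|A| * #|B| <= #|T|)%N.
  rewrite -cardsX -(card_in_imset (f := fun p => p.1 + p.2)) ?max_card //.
  move=> [u v] [u' v'] /setXP[/= uA vB] /setXP[/= uA' vB'] e.
  have e1 : u - u' = v' - v by apply/eqP; rewrite subr_eq addrAC eq_sym subr_eq addrC e addrC.
  have u0 : u - u' = 0.
    apply: b_nondeg => y; have [a aA [c cB' ->]] := decT y.
    by rewrite bDr iA ?cA.2 // e1 iB ?cB.2 // mulr1.
  have v0 : v' - v = 0 by rewrite -e1.
  by congr pair; apply/eqP; rewrite -subr_eq0 ?u0 // -opprB v0 oppr0.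
have [||K [i [iI iD iP]]] := @finzmod_of_seq T (enum A).
- by rewrite mem_enum; apply: cA.1.
- by move=> x y; rewrite !mem_enum; apply: cA.2.
have iA' x : i x \in A by rewrite -mem_enum; apply/iP; exists x.
have cardK : #|K| = #|A|.
  rewrite -(card_imset _ iI); apply: eq_card => x; apply/imsetP/idP => [[y _ ->]//|].
  by rewrite -mem_enum => /iP[y <-]; exists y.
have K0 : #|K|%:R != 0 :> F by rewrite cardK neq0.
(* The target is an arbitrary H isomorphic to K, because the final answer must use the chosen
   representative of the isomorphism class. *)
have main (H : finZmodType) : groups_isomorphic K H -> exists f : T -> TH F H,
   [/\ bijective f, forall u v, f (u + v) = f u + f v &
      forall u v, beta (f u) (f v) = b u v].
  case=> h [h' hK h'K].
  have h'D u v : h' (u + v) = h' u + h' v by rewrite -[u]h'K -[v]h'K -raddfD !hK.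
  have cardH : #|K| = #|H|.
    by apply: bij_eq_card; exists h'.
  have H0 : #|H|%:R != 0 :> F by rewrite -cardH.
  pose j x := i (h' x).
  have jD u v : j (u + v) = j u + j v by rewrite /j h'D iD.
  have jA x : j x \in A by apply: iA'.
  (* Write x = u + v with u in A and v in B: u gives the first coordinate, and v acts on A through
     the character b(v, .). *)
  have ex x : exists p : TH F H * T,
      [&& p.2 \in B, x == j p.1.1 + p.2 & [forall y, p.1.2 y == b p.2 (j y)]].
    have [u uA [v vB ->]] := decT x.
    have [y yE] : exists y, i y = u by apply/iP; rewrite mem_enum.
    have [chi chiE] := dual_exists (fun y => b_neq0 v (j y))
      (fun y y' => etrans (congr1 (b v) (jD y y')) (bDr v (j y) (j y'))).
    exists (h y, chi, v); rewrite vB /j /= hK yE eqxx /=.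
    by apply/forallP => y'; rewrite chiE.
  pose f x := (xchoose (ex x)).1; pose w x := (xchoose (ex x)).2.
  have wB x : w x \in B by have /and3P[] := xchooseP (ex x).
  have xE x : x = j (f x).1 + w x by have /and3P[_ /eqP] := xchooseP (ex x).
  have chE x y : (f x).2 y = b (w x) (j y).
    by have /and3P[_ _ /forallP/(_ y)/eqP] := xchooseP (ex x).
  have fbeta u v : beta (f u) (f v) = b u v.
    rewrite /beta !chE [in RHS](xE u) [in RHS](xE v) bDl !bDr (iA _ _ (jA _) (jA _)) (iB _ _ (wB _) (wB _)) mul1r mulr1 mulrC.
    by rewrite (bicharV (w v) (j _)).
  have uniq_dec x y v : v \in B -> x = j y + v -> y = (f x).1 /\ v = w x.
    move=> vB e.
    have e1 : j y - j (f x).1 = w x - v.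
      by apply/eqP; rewrite subr_eq addrAC eq_sym subr_eq addrC -xE addrC e addrC.
    have j0 : j y - j (f x).1 = 0.
      apply: b_nondeg => t; have [a aA [c cB' ->]] := decT t.
      by rewrite bDr iA ?cA.2 // e1 iB ?cB.2 // mulr1.
    split; last by apply/eqP; rewrite eq_sym -subr_eq0 -e1 j0.
    by apply: (can_inj h'K); apply: iI; apply/eqP; rewrite -subr_eq0; apply/eqP.
  have fD u v : f (u + v) = f u + f v.
    have [|e1 e2] := uniq_dec (u + v) ((f u).1 + (f v).1) (w u + w v) (subgroup_closedD cB (wB u) (wB v)).
      by rewrite jD addrACA -!xE.
    rewrite [LHS]surjective_pairing [RHS]surjective_pairing -e1; congr pair.
    by apply: dual_eqP => y; rewrite chE -e2 dual_addE !chE bDl.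
  (* Injectivity comes from nondegeneracy; bijectivity then follows from #|T_H| = #|A|^2 <= #|A|
     #|B| <= #|T|. *)
  exists f; split=> //; apply: inj_card_bij.
    move=> u v e; apply/eqP; rewrite -subr_eq0; apply/eqP/b_nondeg => t.
    by rewrite bDl bicharNl -!fbeta e divff // beta_neq0.
  rewrite card_prod card_dual // -cardH cardK; apply: leq_trans leT.
  by rewrite leq_mul2l leAB orbT.
exists K; split=> //.
have [|f [f_bij _ _]] := main K; first by exists idfun; exists id.
by rewrite (bij_eq_card f_bij) card_prod card_dual // expnS expn1.
Qed.

End Symplectic.

(** * Graded division algebras and their modules *)

Section ProjectionsLinear.

Variables (F : fieldType) (V V' : vectType F) (G : zmodType).
Variables (E : G -> {vspace V}) (E' : G -> {vspace V'}) (p : G -> V -> V) (p' : G -> V' -> V').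
Hypotheses (pP : graded_projections E p) (pP' : graded_projections E' p').
Variable (s : seq G).
Hypothesis pE : forall v, v = \sum_(g <- s) p g v.

(** A homogeneous map of degree g shifts the projections by g; this serves both multiplication in D
    and the action on U. *)
Lemma homogeneous_map_proj (L : V -> V') (g h : G) v : linear L ->
  (forall k u, u \in E k -> L u \in E' (g + k)) -> p' h (L v) = L (p (h - g) v).
Proof.
move=> lL LE; case: pP pP' => pL pin p1 p0 [pL' _ p1' p0'].
have l0 (A B : vectType F) (f : A -> B) : linear f -> f 0 = 0.
  by move=> fl; have := fl 1 0 0; rewrite scaler0 add0r scale1r -[LHS]addr0 => /addrI/esym.
have lD (A B : vectType F) (f : A -> B) x y : linear f -> f (x + y) = f x + f y.
  by move=> fl; have := fl 1 x y; rewrite !scale1r.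
rewrite (pE v); elim: s => [|k r IHr]; first by rewrite !big_nil !l0.
rewrite !big_cons !(lD _ _ _ _ _ lL) !lD // IHr; congr (_ + _).
have [<-|hk] := eqVneq (g + k) h; last first.
  rewrite (p0' h (g + k)); [|exact/LE/pin|by move=> e; rewrite e eqxx in hk].
  rewrite (p0 _ k) ?l0 // => e; case/eqP: hk; by rewrite -e addrC subrK.
rewrite p1'; last exact/LE/pin.
by rewrite [g + k - g]addrAC subrr add0r (p1 k (p k v)).
Qed.

End ProjectionsLinear.

Import VectorInternalTheory.

Section GradedDivision.

Variables (F : closedFieldType) (G : zmodType) (D : falgType F) (DE : G -> {vspace D}).
Hypothesis hD : is_graded_division_algebra DE.

Let dD : direct_decomposition DE. Proof. by case: hD. Qed.
Let mD g h a b : a \in DE g -> b \in DE h -> a * b \in DE (g + h).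
Proof. by case: hD => _ + _; apply. Qed.
Let uD g a : a \in DE g -> a != 0 -> a \is a GRing.unit.
Proof. by case: hD => _ _; apply. Qed.

Lemma graded_division_proj_mul p s g h a v : graded_projections DE p ->
  (forall v, v = \sum_(g <- s) p g v) -> a \in DE g -> p h (a * v) = a * p (h - g) v.
Proof.
move=> pP ps ag; apply: (homogeneous_map_proj pP pP ps) => [c x y|k x xk]; last exact: mD.
by rewrite mulrDr scalerAr.
Qed.

(** Let a be a nonzero homogeneous part of 1, of degree g. The part of degree g of a 1 is a p_0(1),
    so a = a p_0(1), and a can be cancelled. *)
Lemma graded_division_one : 1 \in DE 0.
Proof.
have [p [s [pP ps]]] := projections_exist dD; case: (pP) => _ pin p1 _.
have [g ag] : exists g, p g 1 != 0.
  have : 1 != 0 :> D by apply: oner_neq0.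
  rewrite {1}(ps 1); elim: (s) => [|h r IHr]; first by rewrite big_nil eqxx.
  rewrite big_cons; have [->|nz] := eqVneq (p h 1) 0; last by exists h.
  by rewrite add0r.
set a := p g 1 in ag; have aE : a \in DE g := pin g 1.
have := graded_division_proj_mul g 1 pP ps aE; rewrite mulr1 p1 // subrr => e.
have -> : 1 = p 0 1 by apply: (mulrI (uD aE ag)); rewrite mulr1.
exact: pin.
Qed.

Lemma graded_division_inv g a : a \in DE g -> a != 0 -> a^-1 \in DE (- g).
Proof.
move=> ag a0; have [p [s [pP ps]]] := projections_exist dD; case: (pP) => _ pin p1 _.
have := graded_division_proj_mul 0 a^-1 pP ps ag.
rewrite divrr ?(uD ag) // p1 ?graded_division_one // sub0r => e.
have -> : a^-1 = p (- g) a^-1 by apply: (mulrI (uD ag a0)); rewrite divrr ?(uD ag).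
exact: pin.
Qed.

(** Left multiplication by a has an eigenvalue l, so a - l kills a nonzero vector and is not
    invertible; being homogeneous, it is 0. *)
Lemma graded_division_neutral a : a \in DE 0 -> exists l : F, a = l%:A.
Proof.
move=> a0; pose A := lin1_mx (v2r \o amull a \o r2v).
have [||l] := @eigenvector_in F _ A 1%:M.
- rewrite -mxrank_eq0 mxrank1 -lt0n.
  have : (0 < \dim {:D})%N.
    by rewrite lt0n dimv_eq0; apply/eqP => e; have := memvf (1 : D); rewrite e memv0 oner_eq0.
  by rewrite dimvf.
- exact: submx1.
rewrite cap1mx => /rowV0Pn[w /eigenspaceP wA w0]; exists l.
have e : a * r2v w = l *: r2v w.
  by apply: (can_inj v2rK); rewrite linearZ /= r2vK -wA mul_rV_lin1 /= lfunE.
apply/eqP; rewrite -subr_eq0; apply/negPn/negP => nz.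
have la : a - l%:A \in DE 0 by rewrite rpredB // memvZ // graded_division_one.
have /mulrI := uD la nz => /(_ (r2v w) 0); rewrite mulr0 mulrBl mulr_algl e subrr => /(_ erefl) rw0.
by case/eqP: w0; rewrite -[w]r2vK rw0 linear0.
Qed.

Lemma graded_division_line g a b : a \in DE g -> a != 0 -> b \in DE g -> exists l : F, b = l *: a.
Proof.
move=> ag a0 bg; have := mD (graded_division_inv ag a0) bg; rewrite addNr.
move=> /graded_division_neutral[l e]; exists l.
by rewrite -[b](mulVKr (uD ag a0)) e mulr_algr.
Qed.

Record division_basis (T : finZmodType) (i : T -> G) (X : T -> D) (tau : T -> T -> F) : Prop :=
  DivisionBasis {
    db_inj : injective i;
    db_add : forall u v, i (u + v) = i u + i v;
    db_supp : forall g, DE g != 0%VS -> exists t, i t = g;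
    db_mem : forall t, X t \in DE (i t);
    db_neq0 : forall t, X t != 0;
    db_mul : forall u v, X u * X v = tau u v *: X (u + v);
    db_tau : forall u v, tau u v != 0;
    db_span : forall d, exists c : T -> F, d = \sum_t c t *: X t;
    db_free : forall c : T -> F, \sum_t c t *: X t = 0 -> forall t, c t = 0 }.

Lemma division_basis_exists : exists (T : finZmodType) i X tau, @division_basis T i X tau.
Proof.
have [p [s [pP ps]]] := projections_exist dD; case: (pP) => _ pin p1 p0.
(* The support is finite and closed under subtraction, since quotients of nonzero homogeneous
   elements are nonzero; it becomes the group T. *)
pose S := [seq g <- undup s | DE g != 0%VS].
have memS g : (g \in S) = (DE g != 0%VS).
  rewrite mem_filter mem_undup; apply/andP/idP => [[]//|g0]; split=> //.
  apply/contraT => gs; move: g0; rewrite -vpick0; set v := vpick _.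
  have vg : v \in DE g := memv_pick _.
  rewrite {1}(ps v) big_seq big1 ?eqxx // => h hs; apply: (p0 h g) => // e.
  by rewrite e (negPf gs) in hs.
have pickP g : g \in S -> vpick (DE g) != 0 by rewrite memS vpick0.
have [||T [i [iI iD iP]]] := @finzmod_of_seq G S.
- rewrite memS; apply/eqP => e; have := graded_division_one.
  by rewrite e memv0 oner_eq0.
- move=> g h gS hS; rewrite memS; apply/eqP => e.
  have := mD (memv_pick (DE g)) (graded_division_inv (memv_pick (DE h)) (pickP _ hS)).
  rewrite e memv0 => /eqP /(congr1 (fun x => x * vpick (DE h))).
  rewrite mul0r -mulrA mulVr ?mulr1; last by apply: uD (memv_pick _) (pickP _ hS).
  by move/eqP; rewrite (negPf (pickP _ gS)).
have iS t : i t \in S by apply/iP; exists t.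
pose X t := vpick (DE (i t)).
have Xm t : X t \in DE (i t) := memv_pick _.
have X0 t : X t != 0 := pickP _ (iS t).
have XM u v : exists c, X u * X v == c *: X (u + v).
  have := mD (Xm u) (Xm v); rewrite -iD => /(graded_division_line (Xm _) (X0 _))[c ->].
  by exists c.
exists T, i, X, (fun u v => xchoose (XM u v)); split=> //.
- by move=> g; rewrite -memS => /iP.
- by move=> u v; apply/eqP/(xchooseP (XM u v)).
- move=> u v; apply/eqP => e; have /eqP := xchooseP (XM u v); rewrite e scale0r => /eqP.
  have uX := uD (Xm u) (X0 u).
  by apply/negP; rewrite -(mulr0 (X u)) (inj_eq (mulrI uX)) X0.
- move=> d; have ex g t : exists c, (i t == g) ==> (p g d == c *: X t).
    have [<-|_] := eqVneq (i t) g; last by exists 0.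
    by have [c ->] := graded_division_line (Xm t) (X0 t) (pin (i t) d); exists c; rewrite eqxx.
  pose c g t := if i t == g then xchoose (ex g t) else 0.
  exists (fun t => \sum_(g <- s) c g t).
  under eq_bigr => t _ do rewrite scaler_suml.
  rewrite {1}(ps d) exchange_big /=; apply: eq_bigr => g _.
  have [|gS] := boolP (g \in S).
    case/iP=> t tg; rewrite (bigD1 t) //= big1 ?addr0 => [|t' t't].
      by have := xchooseP (ex g t); rewrite /c; move: (xchoose _) => cc; rewrite tg eqxx => /eqP.
    rewrite /c; move: (xchoose _) => cc; case: eqP => [t'g|_]; last by rewrite scale0r.
    by case/eqP: t't; apply: iI; rewrite t'g tg.
  rewrite big1 => [|t _]; last first.
    rewrite /c; move: (xchoose _) => cc; case: eqP => [tg|_]; last by rewrite scale0r.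
    by case/negP: gS; rewrite -tg.
  by move: gS; rewrite memS negbK => /eqP e; apply/eqP; rewrite -memv0 -e pin.
- move=> c e t; have := congr1 (p (i t)) e; have pL := let: And4 h _ _ _ := pP in h (i t).
  have sp (r : seq T) : p (i t) (\sum_(u <- r) c u *: X u) = \sum_(u <- r) c u *: p (i t) (X u).
    elim: r => [|u r IHr]; last by rewrite !big_cons pL IHr.
    by rewrite !big_nil; have := pL 1 0 0; rewrite scaler0 add0r scale1r -[LHS]addr0 => /addrI/esym.
  have pz : p (i t) 0 = 0 by have := sp [::]; rewrite !big_nil.
  rewrite sp pz (bigD1 t) //= p1 // big1 ?addr0 => [|u ut].
    by move/eqP; rewrite scaler_eq0 (negPf (X0 t)) orbF => /eqP.
  rewrite (p0 _ (i u)) ?scaler0 // => iut; by case/eqP: ut; apply: iI.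
Qed.

End GradedDivision.

Section CommutationFactor.

Variables (F : fieldType) (T : zmodType) (tau : T -> T -> F).
Hypotheses (tau0 : forall u v, tau u v != 0)
  (tauC : forall u v w, tau u v * tau (u + v) w = tau v w * tau u (v + w)).

Definition commutation_factor u v := tau u v / tau v u.
Local Notation b := commutation_factor.

Lemma commutation_factor_neq0 u v : b u v != 0.
Proof. by rewrite mulf_neq0 ?invr_eq0. Qed.

Lemma commutation_factor_alt u : b u u = 1.
Proof. exact: divff. Qed.

Lemma commutation_factorV u v : b u v = (b v u)^-1.
Proof. by rewrite invfM invrK mulrC. Qed.

Lemma commutation_factorE u v : tau u v = b u v * tau v u.
Proof. by rewrite divfK. Qed.

Lemma commutation_factorDl u v w : b (u + v) w = b u w * b v w.
Proof.
have c1 := tauC u v w; have c2 := tauC w u v; have c3 := tauC u w v.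
rewrite [u + w]addrC [w + v]addrC in c3.
rewrite /b mulf_div; apply/eqP; rewrite eqr_div ?mulf_neq0 //; apply/eqP.
(* Multiplying both sides by a nonzero factor lets three instances of the cocycle identity finish
   the computation. *)
apply: (mulfI (mulf_neq0 (tau0 u v) (tau0 (w + u) v))).
transitivity (tau u v * tau (u + v) w * (tau w u * tau w v) * tau (w + u) v); first by ring.
rewrite c1.
transitivity (tau u w * tau (w + u) v * tau v w * (tau u v * tau w (u + v))); last by ring.
by rewrite -c2 c3; ring.
Qed.

Lemma commutation_factorDr u v w : b u (v + w) = b u v * b u w.
Proof. by rewrite commutation_factorV commutation_factorDl invfM -!commutation_factorV. Qed.

End CommutationFactor.

(** * Homogeneous bases of graded modules over D *)

Section GradedModule.

Variables (F : closedFieldType) (G : zmodType) (D : falgType F) (DE : G -> {vspace D}).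
Variables (U : vectType F) (act : U -> D -> U) (W : G -> {vspace U}).
Hypotheses (hD : is_graded_division_algebra DE) (hU : is_graded_right_module DE act W).
Variables (T : finZmodType) (i : T -> G) (X : T -> D) (tau : T -> T -> F).
Hypothesis dbX : division_basis DE i X tau.

Let actLl c u v d : act (c *: u + v) d = c *: act u d + act v d.
Proof. by case: hU. Qed.
Let actLr c u d e : act u (c *: d + e) = c *: act u d + act u e.
Proof. by case: hU. Qed.
Let act1 u : act u 1 = u.
Proof. by case: hU => _ _ []. Qed.
Let actM u d e : act u (d * e) = act (act u d) e.
Proof. by case: hU => _ _ []. Qed.
Let dW : direct_decomposition W.
Proof. by case: hU. Qed.
Let actW g h u d : u \in W g -> d \in DE h -> act u d \in W (g + h).
Proof. by case: hU => _ _ _ _; apply. Qed.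

Let act0r u : act u 0 = 0.
Proof. by have := actLr 1 u 0 0; rewrite scaler0 add0r scale1r -[LHS]addr0 => /addrI/esym. Qed.
Let act0l d : act 0 d = 0.
Proof. by have := actLl 1 0 0 d; rewrite scaler0 add0r scale1r -[LHS]addr0 => /addrI/esym. Qed.
Let actDr u d e : act u (d + e) = act u d + act u e.
Proof. by have := actLr 1 u d e; rewrite !scale1r. Qed.
Let actDl u v d : act (u + v) d = act u d + act v d.
Proof. by have := actLl 1 u v d; rewrite !scale1r. Qed.
Let actZr c u d : act u (c *: d) = c *: act u d.
Proof. by have := actLr c u d 0; rewrite !addr0 act0r addr0. Qed.
Let actZl c u d : act (c *: u) d = c *: act u d.
Proof. by have := actLl c u 0 d; rewrite !addr0 act0l addr0. Qed.
Let act_sumr u (J : finType) (f : J -> D) : act u (\sum_j f j) = \sum_j act u (f j).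
Proof. by elim/big_rec2: _ => [|j x y _ <-]; rewrite ?act0r ?actDr. Qed.
Let act_suml (J : finType) (f : J -> U) d : act (\sum_j f j) d = \sum_j act (f j) d.
Proof. by elim/big_rec2: _ => [|j x y _ <-]; rewrite ?act0l ?actDl. Qed.

Let uX t : X t \is a GRing.unit.
Proof. by case: hD => _ _; apply; [apply: (db_mem dbX) | apply: (db_neq0 dbX)]. Qed.

Definition module_free k (u : 'I_k -> U) :=
  forall d : 'I_k -> D, \sum_j act (u j) (d j) = 0 -> forall j, d j = 0.

Definition module_span k (u : 'I_k -> U) v := exists d : 'I_k -> D, v = \sum_j act (u j) (d j).

Lemma module_span_act k (u : 'I_k -> U) v e : module_span u v -> module_span u (act v e).
Proof.
by case=> d ->; exists (fun j => d j * e); rewrite act_suml; apply: eq_bigr => j _; rewrite actM.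
Qed.

(** As an F-subspace, spanned by the u_j X_t, the D-span acquires decidable membership. *)
Lemma module_span_vspace k (u : 'I_k -> U) : exists N : {vspace U},
  forall v, v \in N <-> module_span u v.
Proof.
exists (\sum_j \sum_t <[act (u j) (X t)]>)%VS => v; split=> [/memv_sumP[w wE ->]|[d ->]].
  have dP j : exists d, w j == act (u j) d.
    have /memv_sumP[x xE ->] := wE j isT.
    have cP t : exists c, x t == c *: act (u j) (X t).
      by have /vlineP[c ->] := xE t isT; exists c.
    exists (\sum_t xchoose (cP t) *: X t); rewrite act_sumr; apply/eqP; apply: eq_bigr => t _.
    by rewrite actZr; apply/eqP/(xchooseP (cP t)).
  exists (fun j => xchoose (dP j)); apply: eq_bigr => j _; exact/eqP/(xchooseP (dP j)).
apply: memv_suml => j _; have [c ->] := db_span dbX (d j).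
rewrite act_sumr; apply: memv_suml => t _; rewrite actZr memvZ //.
apply: (subvP (sumv_sup j isT (subvv _))); apply: (subvP (sumv_sup t isT (subvv _))).
exact: memv_line.
Qed.

Lemma module_free_le_dim k (u : 'I_k -> U) : module_free u -> (k <= \dim {:U})%N.
Proof.
move=> fu; pose Y := [tuple u j | j < k].
have frY : free Y.
  apply/freeP => c c0 j.
  have e : \sum_j act (u j) (c j *: 1) = 0.
    by rewrite -[RHS]c0; apply: eq_bigr => l _; rewrite actZr act1 -tnth_nth tnth_mktuple.
  have /eqP := fu _ e j; rewrite scaler_eq0 oner_eq0 orbF => /eqP //.
by have := dimvS (subvf <<Y>>); rewrite (eqP frY) size_tuple.
Qed.

(** [P] restricts the degrees allowed in the basis; it will be evenness, which an odd X_t can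
    restore. *)
Variable P : G -> Prop.
Hypothesis adjust : forall g, exists t, P (g + i t).

(** If a vector is outside the span, so is one of its homogeneous parts, and some X_t moves that to
    an allowed degree. In a relation, a nonzero homogeneous part of the new coefficient would be
    invertible and would put the new vector in the span. *)
Lemma module_free_extend k (u : 'I_k -> U) (g : 'I_k -> G) :
  (forall j, u j \in W (g j)) -> (forall j, P (g j)) -> module_free u ->
  (forall v, module_span u v) \/
  exists (u' : 'I_k.+1 -> U) (g' : 'I_k.+1 -> G),
    [/\ forall j, u' j \in W (g' j), forall j, P (g' j) & module_free u'].
Proof.
move=> uW gP fu; have [N memN] := module_span_vspace u.
have [/subvP full|/subvPn[v _ vN]] := boolP (fullv <= N)%VS.
  by left=> v; apply/memN/full/memvf.
right.
have [p [s [pP ps]]] := projections_exist dW; case: (pP) => _ pin _ _.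
have [h wN] : exists h, p h v \notin N.
  have [/hasP[h _ hN]|/hasPn all] := boolP (has (fun h => p h v \notin N) s); first by exists h.
  case/negP: vN; rewrite (ps v) big_seq; apply: rpred_sum => h /all.
  by rewrite negbK.
have [t Pt] := adjust h; pose w := act (p h v) (X t).
have wW : w \in W (h + i t) by apply: actW (pin h v) (db_mem dbX t).
have {}wN : ~ module_span u w.
  move=> /(module_span_act (X t)^-1); rewrite /w -actM divrr // act1 => /memN.
  by rewrite (negPf wN).
pose u' (j : 'I_k.+1) := oapp u w (unlift ord0 j).
pose g' (j : 'I_k.+1) := oapp g (h + i t) (unlift ord0 j).
have ulift (j : 'I_k) : unlift ord0 (fintype.lift ord0 j) = Some j by apply: liftK.
exists u', g'; split=> [j|j|d].
- by rewrite /u' /g'; case: (unliftP ord0 j) => [l _|_] /=.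
- by rewrite /g'; case: (unliftP ord0 j) => [l _|_] /=.
rewrite big_ord_recl /u' unlift_none /=.
under eq_bigr => j _ do rewrite ulift /=.
move=> e.
have [q [r [qP qr]]] := projections_exist (let: And3 h _ _ := hD in h).
have d0 : d ord0 = 0.
  apply/eqP/contraT => nz.
  have [k0 k0nz] : exists k0, q k0 (d ord0) != 0.
    have [/hasP[k0 _ hN]|/hasPn all] := boolP (has (fun h => q h (d ord0) != 0) r); first by exists k0.
    case/eqP: nz; rewrite (qr (d ord0)) big_seq big1 // => k0 /all; by rewrite negbK => /eqP.
  set c := q k0 (d ord0) in k0nz; have cD : c \in DE k0 by case: qP => _ qin _ _; apply: qin.
  have uc : c \is a GRing.unit by case: hD => _ _; apply; [apply: cD | apply: k0nz].
  have pa (z : U) a (y : D) b : z \in W a -> p b (act z y) = act z (q (b - a) y).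
    move=> za; apply: (homogeneous_map_proj qP pP qr) => [x y1 y2|b' y' yb'].
      by rewrite actLr.
    exact: actW.
  have pL : linear (p (h + i t + k0)) by case: pP.
  have pD x y : p (h + i t + k0) (x + y) = p (h + i t + k0) x + p (h + i t + k0) y.
    by have := pL 1 x y; rewrite !scale1r.
  have p0' : p (h + i t + k0) 0 = 0.
    by have := pL 1 0 0; rewrite scaler0 add0r scale1r -[LHS]addr0 => /addrI/esym.
  (* Projecting the relation to one degree isolates a single homogeneous part of every
     coefficient. *)
  have := congr1 (p (h + i t + k0)) e; rewrite pD p0' (pa _ _ _ _ wW) [h + i t + k0 - _]addrAC.
  rewrite subrr add0r -/c.
  have -> : p (h + i t + k0) (\sum_j act (u j) (d (fintype.lift ord0 j))) =
      \sum_j act (u j) (q (h + i t + k0 - g j) (d (fintype.lift ord0 j))).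
    elim/big_rec2: _ => [|j x y _ <-] //; by rewrite pD (pa _ _ _ _ (uW j)).
  move=> e2; case: wN.
  have -> : w = act (act w c) c^-1 by rewrite -actM divrr // act1.
  apply: module_span_act; exists (fun j => - q (h + i t + k0 - g j) (d (fintype.lift ord0 j))).
  move/eqP: e2; rewrite addr_eq0 => /eqP->; rewrite -sumrN; apply: eq_bigr => j _.
  by rewrite -scaleN1r -actZr scaleN1r.
move: e; rewrite d0 act0r add0r => /fu dl j.
by case: (unliftP ord0 j) => [l ->|->].
Qed.

Lemma module_basis_exists : exists k (u : 'I_k -> U) (g : 'I_k -> G),
  [/\ forall j, u j \in W (g j), forall j, P (g j), module_free u & forall v, module_span u v].
Proof.
(* The counter n bounds the number of further extensions, since k never exceeds dim U. *)
have [n] : exists n, (n + 0 = (\dim {:U}).+1)%N by exists (\dim {:U}).+1; rewrite addn0.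
have : exists (u : 'I_0 -> U) (g : 'I_0 -> G),
    [/\ forall j, u j \in W (g j), forall j, P (g j) & module_free u].
  by exists (fun=> 0), (fun=> 0); split=> [[]|[]|d _ []].
move: 0%N => k; elim: n k => [|n IHn] k [u [g [uW gP fu]]] nk.
  by have := module_free_le_dim fu; rewrite add0n in nk; rewrite nk ltnn.
have [full|ext] := module_free_extend uW gP fu; first by exists k, u, g.
by apply: IHn ext _; rewrite addnS -addSn.
Qed.

End GradedModule.

(** * The centre of End_D(U) and its homogeneous matrix units *)

Section GradedEnd.

Variables (F : closedFieldType) (G : zmodType) (D : falgType F) (DE : G -> {vspace D}).
Variables (U : vectType F) (act : U -> D -> U) (W : G -> {vspace U}).
Hypotheses (hD : is_graded_division_algebra DE) (hU : is_graded_right_module DE act W).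
Variables (T : finZmodType) (i : T -> G) (X : T -> D) (tau : T -> T -> F).
Hypothesis dbX : division_basis DE i X tau.

Let actLl c u v d : act (c *: u + v) d = c *: act u d + act v d.
Proof. by case: hU. Qed.
Let actLr c u d e : act u (c *: d + e) = c *: act u d + act u e.
Proof. by case: hU. Qed.
Let act1 u : act u 1 = u.
Proof. by case: hU => _ _ []. Qed.
Let actM u d e : act u (d * e) = act (act u d) e.
Proof. by case: hU => _ _ []. Qed.
Let dW : direct_decomposition W.
Proof. by case: hU. Qed.
Let actW g h u d : u \in W g -> d \in DE h -> act u d \in W (g + h).
Proof. by case: hU => _ _ _ _; apply. Qed.

Let act0r u : act u 0 = 0.
Proof. by have := actLr 1 u 0 0; rewrite scaler0 add0r scale1r -[LHS]addr0 => /addrI/esym. Qed.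
Let act0l d : act 0 d = 0.
Proof. by have := actLl 1 0 0 d; rewrite scaler0 add0r scale1r -[LHS]addr0 => /addrI/esym. Qed.
Let actDr u d e : act u (d + e) = act u d + act u e.
Proof. by have := actLr 1 u d e; rewrite !scale1r. Qed.
Let actDl u v d : act (u + v) d = act u d + act v d.
Proof. by have := actLl 1 u v d; rewrite !scale1r. Qed.
Let actZr c u d : act u (c *: d) = c *: act u d.
Proof. by have := actLr c u d 0; rewrite !addr0 act0r addr0. Qed.
Let actZl c u d : act (c *: u) d = c *: act u d.
Proof. by have := actLl c u 0 d; rewrite !addr0 act0l addr0. Qed.
Let act_sumr u (J : finType) (f : J -> D) : act u (\sum_j f j) = \sum_j act u (f j).
Proof. by elim/big_rec2: _ => [|j x y _ <-]; rewrite ?act0r ?actDr. Qed.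
Let act_suml (J : finType) (f : J -> U) d : act (\sum_j f j) d = \sum_j act (f j) d.
Proof. by elim/big_rec2: _ => [|j x y _ <-]; rewrite ?act0l ?actDl. Qed.

Let uX t : X t \is a GRing.unit.
Proof. by case: hD => _ _; apply; [apply: (db_mem dbX) | apply: (db_neq0 dbX)]. Qed.


Variables (m : nat) (R : G -> {vspace 'M[F]_m}) (phi : 'Hom('M[F]_m, 'End(U))).
Hypotheses (m_gt0 : (0 < m)%N) (hphi : is_graded_iso_End R act W phi).

Let phiI : injective phi.
Proof. by case: hphi. Qed.
Let phi_ex (f : 'End(U)) : (forall u d, f (act u d) = act (f u) d) -> exists a, phi a = f.
Proof. by case: hphi => _ + _ _ => /(_ f)[_]; apply. Qed.
Let phi_lin a u d : phi a (act u d) = act (phi a u) d.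
Proof. by case: hphi => _ + _ _ => /(_ (phi a))[+ _]; apply; exists a. Qed.
Let phiM a b v : phi (a *m b) v = phi a (phi b v).
Proof. by case: hphi => _ _ -> _; rewrite comp_lfunE. Qed.
Let phiR g a : (forall h u, u \in W h -> phi a u \in W (g + h)) -> a \in R g.
Proof. by case: hphi => _ _ _ /(_ g a)[_]; apply. Qed.

Let phi1 : phi 1%:M = \1%VF.
Proof.
have [|a ea] := phi_ex (f := \1%VF); first by move=> u d; rewrite !id_lfunE.
apply/lfunP => v; have := phiM a 1%:M v; by rewrite mulmx1 ea !id_lfunE.
Qed.

(** If X_t commutes with all of D, its action on U is D-linear and is given by a central matrix, so
    it is a nonzero scalar. It also shifts degrees by i(t), hence i(t) = 0. *)
Lemma graded_center t : (forall v, commutation_factor tau t v = 1) -> t = 0.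
Proof.
move=> t1; pose f := linfun (fun u => act u (X t)).
have fE u : f u = act u (X t) by apply: linfunE => c x y; apply: actLl.
have comX v : X t * X v = X v * X t.
  rewrite !(db_mul dbX) addrC; congr (_ *: _); have /eqP := t1 v.
  rewrite /commutation_factor; have := db_tau dbX v t => nz /eqP e.
  by rewrite -[LHS](divfK nz) e mul1r.
have comD d : X t * d = d * X t.
  have [c ->] := db_span dbX d; rewrite mulr_sumr mulr_suml; apply: eq_bigr => v _.
  by rewrite -scalerAr -scalerAl comX.
have [a ea] : exists a, phi a = f.
  by apply: phi_ex => u d; rewrite !fE -!actM comD.
have com b : a *m b = b *m a.
  apply: phiI; apply/lfunP => v; rewrite !phiM ea !fE phi_lin //.
have [c ec] : exists c, a = c%:M.
  pose j0 := Ordinal m_gt0; exists (a j0 j0); apply/matrixP => x y.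
  have := congr1 (fun M : 'M_m => M j0 y) (com (delta_mx j0 x)).
  rewrite !mxE (bigD1 j0) //= big1 => [|l lj]; last by rewrite !mxE (negPf lj) mulr0.
  rewrite (bigD1 x) //= big1 => [|l lx]; last by rewrite !mxE (negPf lx) andbF mul0r.
  by rewrite !mxE !eqxx !addr0 /= mul1r eq_sym mulr_natr => <-.
have fc u : f u = c *: u.
  by rewrite -ea ec -scalemx1 linearZ /= phi1 lfunE /= id_lfunE.
have [p [s [pP ps]]] := projections_exist dW; case: (pP) => _ pin _ _.
have [v v0] : exists v : U, v != 0.
  have nz : phi 1%:M != 0.
    apply/eqP => e; have /matrixP : 1%:M = 0 :> 'M[F]_m by apply: phiI; rewrite e linear0.
    by move=> /(_ (Ordinal m_gt0) (Ordinal m_gt0)); rewrite !mxE eqxx => /eqP; rewrite oner_eq0.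
  exists (vpick (limg (phi 1%:M))); rewrite vpick0; apply: contra nz => /eqP e.
  apply/eqP/lfunP => v; rewrite zero_lfunE; apply/eqP; rewrite -memv0 -e.
  exact/memv_img/memvf.
have [h nzh] : exists h, p h v != 0.
  have [/hasP[h _ hN]|/hasPn all] := boolP (has (fun h => p h v != 0) s); first by exists h.
  by case/eqP: v0; rewrite (ps v) big_seq big1 // => h /all; rewrite negbK => /eqP.
have c0 : c != 0.
  apply: contra nzh => /eqP c0; rewrite -[p h v]act1 -(divrr (uX t)) actM -fE fc c0 scale0r.
  by rewrite act0l.
have e1 : act (p h v) (X t) \in W (h + i t) by apply: actW (pin h v) (db_mem dbX t).
have e2 : act (p h v) (X t) \in W h by rewrite -fE fc memvZ.
have := homog_inj dW e1 e2; rewrite -fE fc scaler_eq0 negb_or c0 nzh => /(_ isT).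
have i0 : i 0 = 0 by apply: (addrI (i 0)); rewrite -(db_add dbX) !addr0.
by rewrite -[RHS]addr0 -i0 => /addrI/(db_inj dbX).
Qed.

(** Z_(j,l,t) is the map v -> u_j X_t C_l(v), where C_l(v) is the l-th D-coordinate of v: a matrix
    unit with coefficient X_t. *)
Lemma graded_End_basis (P : G -> Prop) : (forall g, exists t, P (g + i t)) ->
  exists k (g : 'I_k -> G) (Z : 'I_k * 'I_k * T -> 'M[F]_m) c,
  [/\ forall j, P (g j), dual_bases Z c,
      forall x y, Z x *m Z y =
        ((x.1.2 == y.1.1)%:R * tau x.2 y.2) *: Z (x.1.1, y.1.2, x.2 + y.2) &
      forall x, Z x \in R (g x.1.1 + i x.2 - g x.1.2)].
Proof.
move=> adjust; have [k [u [g [uW gP fu su]]]] := module_basis_exists hD hU dbX adjust.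
pose Y (x : 'I_k * T) := act (u x.1) (X x.2).
have sumY (a : 'I_k * T -> F) : \sum_x a x *: Y x = \sum_j act (u j) (\sum_t a (j, t) *: X t).
  transitivity (\sum_j \sum_t a (j, t) *: Y (j, t)).
    by rewrite pair_bigA; apply: eq_bigr => -[j t] _.
  by apply: eq_bigr => j _; rewrite act_sumr; apply: eq_bigr => t _; rewrite actZr.
have [||c dY] := @dual_bases_exist F U _ Y.
- by move=> a; rewrite sumY => /fu e [j t]; apply: (db_free dbX (e j) t).
- move=> v; have [d ->] := su v.
  have [a ad] := fin_all_exists (fun j => db_span dbX (d j)).
  by exists (fun x => a x.1 x.2); rewrite sumY; apply: eq_bigr => j _; rewrite ad.
pose C j v := \sum_t c (j, t) v *: X t.
have CE v : v = \sum_j act (u j) (C j v) by case: (dY) => _ _ cE; rewrite {1}(cE v) sumY.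
have Cuniq v (d : 'I_k -> D) : v = \sum_j act (u j) (d j) -> forall j, C j v = d j.
  move=> vd j; apply/eqP; rewrite -subr_eq0; apply/eqP; apply: (fu (fun j => C j v - d j)).
  under eq_bigr => l _ do rewrite actDr -scaleN1r actZr scaleN1r.
  by rewrite sumrB -CE -vd subrr.
have Clin a v w j : C j (a *: v + w) = a *: C j v + C j w.
  rewrite /C scaler_sumr -big_split; apply: eq_bigr => t _ /=.
  by case: (dY) => cL _ _; rewrite cL scalerDl scalerA.
have Cact j v d : C j (act v d) = C j v * d.
  apply: (Cuniq _ (fun j => C j v * d)); rewrite {1}(CE v) act_suml.
  by apply: eq_bigr => l _; rewrite actM.
have Cu j l d : C j (act (u l) d) = (j == l)%:R *: d.
  apply: (Cuniq _ (fun j => (j == l)%:R *: d)); rewrite (bigD1 l) //= eqxx scale1r big1 ?addr0 //.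
  by move=> j' /negPf ->; rewrite scale0r act0r.
have [p [s [pP ps]]] := projections_exist dW.
have dD : direct_decomposition DE by case: hD.
have [q [r [qP qr]]] := projections_exist dD.
have pa (z : U) a (y : D) b : z \in W a -> p b (act z y) = act z (q (b - a) y).
  move=> za; apply: (homogeneous_map_proj qP pP qr) => [x y1 y2|b' y' yb']; first by rewrite actLr.
  exact: actW.
(* Projecting the expansion of v shows that the coordinates of a homogeneous vector are
   homogeneous. *)
have CW h v j : v \in W h -> C j v \in DE (h - g j).
  move=> vh; have -> : C j v = q (h - g j) (C j v).
    apply: (Cuniq v (fun j => q (h - g j) (C j v))); case: (pP) => pL _ p1 _; rewrite -[LHS](p1 h v vh) {1}(CE v).
    have pD x y : p h (x + y) = p h x + p h y by have := pL h 1 x y; rewrite !scale1r.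
    have p0' : p h 0 = 0.
      by have := pL h 1 0 0; rewrite scaler0 add0r scale1r -[LHS]addr0 => /addrI/esym.
    elim/big_rec2: _ => [|l x y _ <-]; first exact: p0'.
    by rewrite pD (pa _ _ _ _ (uW l)).
  by case: qP => _ + _ _; apply.
have [Z ZE] : exists Z : 'I_k * 'I_k * T -> 'M[F]_m,
    forall x v, phi (Z x) v = act (u x.1.1) (X x.2 * C x.1.2 v).
  apply: (fin_all_exists (P := fun x a => forall v, phi a v = act (u x.1.1) (X x.2 * C x.1.2 v))).
  move=> [[j l] t] /=; pose f v := act (u j) (X t * C l v).
  have fL : linear f.
    by move=> a v w; rewrite /f Clin mulrDr -scalerAr actLr.
  have [|a ea] := phi_ex (f := linfun f).
    by move=> v d; rewrite !(linfunE fL) /f Cact mulrA actM.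
  by exists a => v; rewrite ea (linfunE fL).
have phi_sum (a : 'I_k * 'I_k * T -> F) v : phi (\sum_x a x *: Z x) v = \sum_x a x *: phi (Z x) v.
  by rewrite linear_sum sum_lfunE; apply: eq_bigr => x _; rewrite linearZ /= lfunE.
have sum_u (a : 'I_k * 'I_k * T -> F) v : \sum_x a x *: phi (Z x) v =
    \sum_l act (\sum_j act (u j) (\sum_t a (j, l, t) *: X t)) (C l v).
  transitivity (\sum_j \sum_l \sum_t a (j, l, t) *: phi (Z (j, l, t)) v).
    by rewrite pair_bigA pair_bigA /=; apply: eq_bigr => -[[j l] t] _.
  rewrite exchange_big; apply: eq_bigr => l _; rewrite act_suml; apply: eq_bigr => j _.
  rewrite -actM mulr_suml act_sumr; apply: eq_bigr => t _.
  by rewrite ZE -scalerAl actZr.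
have [||c' dZ] := @dual_bases_exist F _ _ Z.
- move=> a e [[j l] t].
  have := phi_sum a (u l); rewrite e linear0 zero_lfunE sum_u.
  rewrite (bigD1 l) //= [X in _ + X]big1 ?addr0 => [|l' /negPf l'l]; last first.
    by rewrite -[u l]act1 Cu l'l scale0r act0r.
  rewrite -[X in C l X]act1 Cu eqxx scale1r act1 => /esym/fu/(_ j) e2.
  exact: (db_free dbX e2 t).
- move=> b; exists (fun x => c (x.1.1, x.2) (phi b (u x.1.2))).
  apply: phiI; apply/lfunP => v; rewrite phi_sum sum_u {1}(CE v) linear_sum.
  by apply: eq_bigr => l _ /=; rewrite phi_lin {1}(CE (phi b (u l))).
exists k, g, Z, c'; split=> // [[[j l] t] [[j' l'] t']|[[j l] t]].
  apply: phiI; apply/lfunP => v; rewrite phiM linearZ /= lfunE /= !ZE /= Cu.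
  have [_|_] := eqVneq l j'; last by rewrite !scale0r mulr0 act0r mul0r scale0r.
  by rewrite scale1r mul1r mulrA (db_mul dbX) -scalerAl actZr.
apply: phiR => h v vh; rewrite ZE /=.
have -> : g j + i t - g l + h = g j + (i t + (h - g l)).
  by rewrite -!addrA; congr (_ + (_ + _)); rewrite addrC.
apply: actW (uW j) _; case: hD => _ mD _; apply: mD (CW _ _ _ vh); exact: db_mem dbX t.
Qed.

End GradedEnd.

(** * Odd fine gradings *)

Lemma Mnn_direct (F : fieldType) n : direct_decomposition (@Mnn F n).
Proof.
pose Z (x : 'I_(n + n) * 'I_(n + n)) : 'M[F]_(n + n) := delta_mx x.1 x.2.
pose c (x : 'I_(n + n) * 'I_(n + n)) (M : 'M[F]_(n + n)) := M x.1 x.2.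
pose par (x : 'I_(n + n) * 'I_(n + n)) : 'Z_2 := if (x.1 < n)%N == (x.2 < n)%N then 0 else 1.
have dZ : dual_bases Z c.
  split=> [x a u v|[x y] [x' y']|M]; first by rewrite /c !mxE.
    by rewrite /c /Z mxE /= xpair_eqE.
  rewrite {1}[M]matrix_sum_delta pair_bigA; apply: eq_bigr => -[x y] _.
  by apply/matrixP=> i j; rewrite !mxE.
have parE (a b : 'I_n) : [/\ par (lshift n a, lshift n b) = 0, par (lshift n a, rshift n b) = 1,
    par (rshift n a, lshift n b) = 1 & par (rshift n a, rshift n b) = 0].
  by rewrite /par /= !ltn_ord !ltnNge !leq_addr.
have -> : @Mnn F n = span_deg par Z; last exact: span_deg_direct dZ.
apply: functional_extensionality => i; apply/vspaceP => v.
apply/idP/(span_degP _ _ _ dZ); case: (Z2P i) => ->; rewrite ?mem_Mnn_even ?mem_Mnn_odd.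
- case/andP=> /eqP/matrixP u /eqP/matrixP d [x y].
  case: (split_ordP x) (split_ordP y) => a -> [] b ->; rewrite /c /=; have [] := parE a b => // _ _ _ _.
    by have := u a b; rewrite !mxE => ->; rewrite eqxx.
  by have := d a b; rewrite !mxE => ->; rewrite eqxx.
- case/andP=> /eqP/matrixP u /eqP/matrixP d [x y].
  case: (split_ordP x) (split_ordP y) => a -> [] b ->; rewrite /c /=; have [] := parE a b => // _ _ _ _.
    by have := u a b; rewrite !mxE => ->; rewrite eqxx.
  by have := d a b; rewrite !mxE => ->; rewrite eqxx.
- move=> vP; apply/andP; split; apply/eqP/matrixP => a b; rewrite !mxE; apply/eqP/contraT.
    by move/(vP (_, _)); have [_ -> _ _] := parE a b.
  by move/(vP (_, _)); have [_ _ -> _] := parE a b.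
- move=> vP; apply/andP; split; apply/eqP/matrixP => a b; rewrite !mxE; apply/eqP/contraT.
    by move/(vP (_, _)); have [-> _ _ _] := parE a b.
  by move/(vP (_, _)); have [_ _ _ ->] := parE a b.
Qed.

Section FineIsGamma.

Variables (F : closedFieldType) (m k : nat) (A : 'Z_2 -> {vspace 'M[F]_m}).
Variables (G : zmodType) (E : G -> {vspace 'M[F]_m}) (T H : finZmodType) (t0 : TH F H).
Variables (i : T -> G * 'Z_2) (f : T -> TH F H) (tau : T -> T -> F) (g : 'I_k -> G * 'Z_2).
Variables (Z : 'I_k * 'I_k * T -> 'M[F]_m) (c : 'I_k * 'I_k * T -> 'M[F]_m -> F).
Hypotheses (dA : direct_decomposition A) (hE : is_superalgebra_grading A E) (fE : is_fine A E).
Hypotheses (H_neq0 : #|H|%:R != 0 :> F) (dZ : dual_bases Z c).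
Hypotheses (tau0 : forall u v, tau u v != 0)
  (tauC : forall u v w, tau u v * tau (u + v) w = tau v w * tau u (v + w))
  (fD : forall u v, f (u + v) = f u + f v) (f_bij : bijective f)
  (fbeta : forall u v, tau u v = beta (f u) (f v) * tau v u).
Hypothesis ZM : forall x y, Z x *m Z y =
  ((x.1.2 == y.1.1)%:R * tau x.2 y.2) *: Z (x.1.1, y.1.2, x.2 + y.2).
Hypotheses (g_even : forall j, (g j).2 = 0)
  (ZE : forall x, Z x \in (E (g x.1.1 + i x.2 - g x.1.2).1 :&: A (g x.1.1 + i x.2 - g x.1.2).2)%VS)
  (parityE : forall t, parity t0 (f t) = (i t).2).

(** Gamma, pulled back to the given algebra, is a refinement [E'] of [E]; fineness turns the
    inclusions of nonzero components into equalities. *)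
Lemma fine_equivalent_Gamma :
  gradings_equivalent A E (kron_superalgebra t0 k) (@Gamma F H k).
Proof.
have [phi [bphi phiM phiZ]] := iso_to_Gamma tau0 tauC fD fbeta H_neq0 f_bij dZ ZM.
have phiI := bij_inj bphi.
pose e (x : 'I_k * 'I_k * T) : Gidx F H k := (x.1, f x.2).
have be : bijective e.
  by case: f_bij => f' fK f'K; exists (fun x => (x.1, f' x.2)) => -[x y]; rewrite /e /= ?fK ?f'K.
pose par (x : 'I_k * 'I_k * T) := (i x.2).2; pose degE (x : 'I_k * 'I_k * T) := (g x.1.1 + i x.2 - g x.1.2).1.
have dE : direct_decomposition E by case: hE.
(* The basis of U is even, so the parity of Z_(a,b,t) is that of t alone. *)
have AE : A = span_deg par Z.
  apply: functional_extensionality; apply: (homogeneous_basis dZ dA) => x.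
  have := ZE x; rewrite memv_cap => /andP[_].
  by rewrite /= !g_even add0r oppr0 addr0.
have EE : E =1 span_deg degE Z.
  by apply: (homogeneous_basis dZ dE) => x; have := ZE x; rewrite memv_cap => /andP[].
pose degG (x : 'I_k * 'I_k * T) := Gdeg (e x); pose E' := span_deg degG Z.
have hE' : is_superalgebra_grading A E'.
  rewrite AE; apply: (superalgebra_grading_of_basis dZ) => x y.
  rewrite ZM; case: eqP => [xy|_]; last by rewrite mul0r scale0r mem0v.
  rewrite memvZ //.
  have -> : degG x + degG y = degG (x.1.1, y.1.2, x.2 + y.2); last exact: memv_span_deg.
  by rewrite /degG /e /Gdeg /= fD xy; congr pair; rewrite /= addrA subrK.
have dE' : direct_decomposition E' by case: hE'.
(* Degrees for Gamma coincide only on the diagonal, where g_a - g_a cancels in the original degree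
   as well. *)
have degGE x y : degG x = degG y -> degE x = degE y.
  case: x y => [[a b] t] [[a' b'] t'] /Gdeg_diag[] /=.
    by case=> -> -> /(bij_inj f_bij) ->.
  case=> ab [a'']; case=> -> -> /(bij_inj f_bij) ->.
  by rewrite /degE /= ab addrAC subrr add0r addrAC subrr add0r.
have sub x : (E' (degG x) <= E (degE x))%VS.
  rewrite EE; apply/subv_sumP => y /eqP xy; rewrite -memvE -(degGE _ _ xy).
  exact: memv_span_deg.
have refE : refines E' E.
  move=> h; have [/(span_deg_neq0P _ _ dZ)[x <-]|] := boolP (E' h != 0%VS).
    by exists (degE x).
  by rewrite negbK => /eqP->; exists 0; apply: sub0v.
have eqE x : E' (degG x) = E (degE x).
  apply/eqP/contraT => ne; case: (fE hE'); split=> //; exists (degG x), (degE x); split=> //.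
  by apply/(span_deg_neq0P _ _ dZ); exists x.
have phiE' h : (phi @: E' h)%VS = @Gamma F H k h.
  by rewrite Gamma_span; apply: (limg_span_deg be phiZ).
apply: (gradings_equivalent_of_iso (phi := phi)) => //.
- split=> // j; rewrite AE kron_span; apply: (limg_span_deg be phiZ) => x.
  by rewrite /Gpar /= parityE.
- by rewrite Gamma_span; apply: (span_deg_direct _ (GZ_dual k H_neq0)).
- move=> g'; rewrite EE => /(span_deg_neq0P _ _ dZ)[x <-]; exists (degG x).
  by rewrite -EE -eqE phiE'.
- move=> h; rewrite -phiE' limg_eq0_inj // => /(span_deg_neq0P _ _ dZ)[x <-].
  by exists (degE x); rewrite -eqE phiE'.
Qed.

End FineIsGamma.

(** The map x -> b(x, .) embeds T into its dual, which has the same order. *)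
Lemma nondegenerate_represents (F : closedFieldType) (T : finZmodType) (b : T -> T -> F) (q : T -> F) :
  (forall x y, b x y != 0) -> (forall x y z, b (x + y) z = b x z * b y z) ->
  (forall x y z, b x (y + z) = b x y * b x z) -> (forall x, (forall y, b x y = 1) -> x = 0) ->
  #|T|%:R != 0 :> F -> (forall x, q x != 0) -> (forall x y, q (x + y) = q x * q y) ->
  exists t, forall x, b t x = q x.
Proof.
move=> b0 bDl bDr nb T0 q0 qD.
have [theta thE] := fin_all_exists (fun t => dual_exists (b0 t) (bDr t)).
have [psi psiE] := dual_exists q0 qD.
have thI : injective theta.
  move=> u v uv; apply/eqP; rewrite -subr_eq0; apply/eqP/nb => y.
  by apply: (mulIf (b0 v y)); rewrite -bDl subrK mul1r -!thE uv.
have [thi thiK] : bijective theta by apply: inj_card_bij; rewrite // card_dual.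
by move=> thK; exists (thi psi) => x; rewrite -thE thK psiE.
Qed.

Section OddFine.

Variables (F : closedFieldType) (n : nat) (Theta : nat -> finZmodType -> Prop).
Hypotheses (c2 : 2%N \notin [pchar F]) (n_gt0 : (1 <= n)%N)
  (hTheta : forall m, is_representative_set m (Theta m)).

Lemma odd_fine_equivalent_Gamma (G : zmodType) (E : G -> {vspace 'M[F]_(n + n)}) :
  is_superalgebra_grading (@Mnn F n) E -> is_odd_grading (@Mnn F n) E -> is_fine (@Mnn F n) E ->
  exists (l : nat) (H : finZmodType) (t0 : TH F H), Gamma_data n Theta l t0 /\
    gradings_equivalent (@Mnn F n) E (kron_superalgebra t0 (n %/ l)) (@Gamma F H (n %/ l)).
Proof.
move=> hE [D [DE [U [act [W [phi [hD hU hphi [gi [gi0 gi1]]]]]]]]] fE.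
have m_gt0 : (0 < n + n)%N by rewrite addn_gt0 n_gt0.
have [T [i [X [tau dbX]]]] := division_basis_exists hD.
have tauC u v w : tau u v * tau (u + v) w = tau v w * tau u (v + w).
  have := mulrA (X u) (X v) (X w).
  rewrite !(db_mul dbX) -scalerAr -scalerAl !(db_mul dbX) !scalerA addrA => /eqP.
  rewrite -subr_eq0 -scalerBl scaler_eq0 (negPf (db_neq0 dbX _)) orbF subr_eq0.
  by move/eqP->.
have tau0 := db_tau dbX.
pose b := commutation_factor tau.
have b0 : forall x y, b x y != 0 := commutation_factor_neq0 tau0.
have bDl : forall x y z, b (x + y) z = b x z * b y z := commutation_factorDl tau0 tauC.
have bDr : forall x y z, b x (y + z) = b x y * b x z := commutation_factorDr tau0 tauC.
have b1 : forall x, b x x = 1 := commutation_factor_alt tau0.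
have nb x : (forall y, b x y = 1) -> x = 0.
  by apply: (graded_center hD hU dbX m_gt0 hphi).
have T0 : #|T|%:R != 0 :> F := nondegenerate_card_neq0 b0 bDl nb.
have [t1 it1] := db_supp dbX gi0.
have i0 : i 0 = 0 by apply: (addrI (i 0)); rewrite -(db_add dbX) !addr0.
have two0 := char2_neq0 c2.
(* X_t1 is odd and exists because the grading is odd; it corrects the parity of a basis vector. *)
have adjust (g : G * 'Z_2) : exists t, (g + i t).2 = 0.
  case: (Z2P g.2) => g2; first by exists 0; rewrite i0 addr0.
  exists t1; rewrite /= it1 g2; case: (Z2P gi.2) gi1 => -> //= _; exact/val_inj.
have [k [g [Z [c [g_even dZ ZM ZE]]]]] := graded_End_basis hD hU dbX hphi (P := fun x : G * 'Z_2 => x.2 = 0) adjust.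
have [K [K0 cardT main]] := symplectic_classification b0 bDl bDr b1 nb.
(* Comparing dimensions gives k^2 #|K|^2 = (2 n)^2. *)
have kK : (k * #|K| = n + n)%N.
  have := dual_bases_card dZ; rewrite dimvf /dim /= !card_prod !card_ord cardT.
  move: (n + n)%N #|K| => N q e; apply/eqP; rewrite -(eqn_exp2r _ _ (isT : (0 < 2)%N)).
  by rewrite expnMn; apply/eqP; rewrite -!mulnn in e *.
(* Parity as a character of T with values 1 and -1; the element [s] that represents it is sent to
   t0. *)
pose q t : F := if (i t).2 == 0 then 1 else -1.
have q0 t : q t != 0 by rewrite /q; case: ifP; rewrite ?oppr_eq0 oner_eq0.
have qD u v : q (u + v) = q u * q v.
  rewrite /q (db_add dbX) /=.
  by case: (Z2P (i u).2) (Z2P (i v).2) => -> [] ->; rewrite ?addr0 ?add0r ?eqxx /= ?mul1r ?mulr1 ?mulrNN ?mulr1.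
have [s sq] := nondegenerate_represents b0 bDl bDr nb T0 q0 qD.
have qt1 : q t1 != 1.
  rewrite /q it1 (negPf gi1) eq_sym -subr_eq0 opprK -mulr2n; exact: two0.
have s0 : s != 0.
  by apply: contra qt1 => /eqP s0; rewrite -sq s0 (bichar0l b0 bDl).
have s2 : s *+ 2 = 0.
  apply: nb => y; rewrite mulr2n bDl sq /q; case: ifP => _; by rewrite ?mulrNN mulr1.
(* [s] has order 2, so #|T| = #|K|^2 is even and #|K| has the form 2 l. *)
have evK : (2 %| #|K|)%N.
  have : (2 %| #|T|)%N.
    have os : #[s]%g = 2%N by apply: nt_prime_order.
    by rewrite -os -cardsT order_dvdG ?inE.
  by rewrite cardT Euclid_dvdX // andbT.
pose l := (#|K| %/ 2)%N.
have lK : (2 * l = #|K|)%N by rewrite mulnC divnK.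
have l_gt0 : (0 < l)%N.
  have : (0 < #|K|)%N by apply/card_gt0P; exists 0.
  by rewrite -lK muln_gt0 => /andP[].
have kl : n = (k * l)%N by move: kK; rewrite -lK; lia.
have nlk : (n %/ l = k)%N by rewrite kl mulnK.
have [cardTh repTh _] := hTheta (2 * l).
have [H [ThH isoKH]] := repTh K (esym lK).
have H0 : #|H|%:R != 0 :> F by rewrite (cardTh H ThH) lK.
have [f [f_bij fD fbeta]] := main H isoKH.
have f0 : f 0 = 0 by apply: (addrI (f 0)); rewrite -fD !addr0.
exists l, H, (f s); split.
  split=> //; first by apply/dvdnP; exists k.
    by move: K0; rewrite natf_neq0_pchar -lK pnatM => /andP[].
  split; first by rewrite -f0 => /(bij_inj f_bij) e; rewrite e eqxx in s0.
  by rewrite mulr2n -fD -mulr2n s2.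
rewrite nlk; apply: (fine_equivalent_Gamma (@Mnn_direct F n) hE fE H0 dZ tau0 tauC fD f_bij _ ZM g_even ZE).
  by move=> u v; rewrite fbeta; apply: commutation_factorE.
move=> t; rewrite /parity fbeta sq /q; case: (Z2P (i t).2) => -> /=; first by rewrite eqxx.
by rewrite eq_sym -subr_eq0 opprK -mulr2n (negPf two0).
Qed.

End OddFine.

Theorem theorem4p26 (F : closedFieldType) (n : nat)
    (Theta : nat -> finZmodType -> Prop)
    (hchar : 2%N \notin [pchar F]) (hn : (1 <= n)%N)
    (hTheta : forall m, is_representative_set m (Theta m)) :
  [/\ (forall (G : zmodType) (E : G -> {vspace 'M[F]_(n + n)}),
         is_superalgebra_grading (@Mnn F n) E ->
         is_odd_grading (@Mnn F n) E ->
         is_fine (@Mnn F n) E ->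
         exists (l : nat) (H : finZmodType) (t0 : TH F H),
           Gamma_data n Theta l t0 /\
           gradings_equivalent (@Mnn F n) E
             (kron_superalgebra t0 (n %/ l)) (@Gamma F H (n %/ l))),
      (forall (l : nat) (H : finZmodType) (t0 : TH F H),
         Gamma_data n Theta l t0 ->
         [/\ superalgebras_isomorphic
               (kron_superalgebra t0 (n %/ l)) (@Mnn F n),
             is_superalgebra_grading
               (kron_superalgebra t0 (n %/ l)) (@Gamma F H (n %/ l)),
             is_fine (kron_superalgebra t0 (n %/ l)) (@Gamma F H (n %/ l)) &
             is_universal_group (@Gamma F H (n %/ l)) (@GH F H (n %/ l))]) &
      (forall (l : nat) (H : finZmodType) (t0 : TH F H)
              (l' : nat) (H' : finZmodType) (t0' : TH F H'),
         Gamma_data n Theta l t0 -> Gamma_data n Theta l' t0' ->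
         (gradings_equivalent
            (kron_superalgebra t0 (n %/ l)) (@Gamma F H (n %/ l))
            (kron_superalgebra t0' (n %/ l')) (@Gamma F H' (n %/ l'))
          <->
          exists eHH' : H = H', exists f : {additive TH F H -> TH F H},
            in_Aut_beta f /\
            eq_rect H (fun K : finZmodType => TH F K) (f t0) H' eHH' = t0'))].
Proof.
have data l (H : finZmodType) (t0 : TH F H) : Gamma_data n Theta l t0 ->
    [/\ #|H| = (2 * l)%N, #|H|%:R != 0 :> F, (n %/ l * #|H| = n + n)%N & (0 < n %/ l)%N].
  case=> ln nl ThH _; have [cardTh _ _] := hTheta (2 * l).
  have cH := cardTh H ThH; have l_gt0 : (0 < l)%N by apply: dvdn_gt0 ln.
  split=> //; last by rewrite divn_gt0 // dvdn_leq.
    by rewrite natf_neq0_pchar cH pnatM nl andbT pnatE.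
  by rewrite cH mulnCA divnK // mul2n addnn.
split; first exact: odd_fine_equivalent_Gamma.
  move=> l H t0 dt; have [cH H0 sz k0] := data l H t0 dt; case: dt => _ _ _ t02; split.
  - exact: kron_Mnn_isomorphic.
  - exact: Gamma_grading.
  - exact: Gamma_fine.
  (* Positivity of k supplies the base index for the normal forms. *)
  - by rewrite Gamma_span; apply: (span_deg_universal H0 (Ordinal k0)).
move=> l H t0 l' H' t0' dt dt'.
have [cH H0 sz k0] := data _ _ _ dt; have [cH' H'0 sz' k0'] := data _ _ _ dt'.
case: dt dt' => _ _ ThH t02 [_ _ ThH' t02']; split.
  case/(equivalent_orbit H0 H'0 k0 k0' t02 t02') => f [f_bij fD fbeta ft0].
  have iso := groups_isomorphic_of_TH H0 H'0 f_bij fD.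
  (* l is determined by #|H| = 2 l, so both gradings have the same k. *)
  have ll : l' = l.
    have : #|H| = #|H'| by case: iso => h h_bij; apply: bij_eq_card h_bij.
    by rewrite cH cH'; lia.
  subst l'; have [_ _ uniqTh] := hTheta (2 * l).
  have eH := uniqTh H H' ThH ThH' iso; subst H'.
  have f0 : f 0 = 0 by apply: (addrI (f 0)); rewrite -fD !addr0.
  pose fA : {additive TH F H -> TH F H} :=
    HB.pack f (GRing.isNmodMorphism.Build (TH F H) (TH F H) f (conj f0 fD)).
  by exists erefl, fA.
case=> eH [f [f_aut]]; subst H' => /= <-.
have ll : l' = l by move: cH'; rewrite cH; lia.
by subst l'; apply: Gamma_equivalent_orbit.
Qed.
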